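(* Let $K$ be a field and let $\theta$ be a unital action of an inverse monoid $S$ on a unital associative $K$-algebra $A$. Then for any $A\rtimes_\theta S$-bimodule $M$ there exists a third quadrant cohomology spectral sequence $$E^{p,q}_2=H^p(S,(R^qT_1)M)\Rightarrow H^{p+q}(A\rtimes_\theta S,M),$$ where $T_1=\operatorname{Hom}_{A^e}(A,-):(A\rtimes_\theta S)^e\text{-}\mathbf{Mod}\to KS\text{-}\mathbf{Mod}$ and $R^qT_1$ denotes its $q$-th right derived functor.
   Context: Inverse monoids and actions. For an inverse monoid $S$, $E(S)$ is its set of idempotents, $s\le t$ means $s=et$ for some $e\in E(S)$, and $KS$, $KE(S)$ are the semigroup algebras (free $K$-modules on $S$, $E(S)$ with the multiplication extended linearly). $\mathcal I(A)$ is the symmetric inverse monoid of all bijections between subsets of $A$. A unital action of $S$ on $A$ is a semigroup homomorphism $\theta:S\to\mathcal I(A)$, $s\mapsto\theta_s$, such that the domain and range of each $\theta_s$ are ideals of $A$, $\theta_s$ is an isomorphism of $K$-algebras from its domain onto its range, $\theta_{1_S}=\mathrm{id}_A$, and the range of $\theta_s$ is $1_sA$ for some central idempotent $1_s$ of $A$ (so $\theta_s:1_{s^{-1}}A\to 1_sA$). Crossed product. $L(A,\theta,S)=\bigoplus_{s\in S}1_sA\,\delta_s$ ($\delta_s$ are symbols) with product $a\delta_s\cdot b\delta_t=a\,\theta_s(1_{s^{-1}}b)\,\delta_{st}$ is an associative $K$-algebra; $\mathcal N$ is its ideal generated by all $a\delta_s-a\delta_t$ with $s\le t$ and $a\in 1_sA$.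 The crossed product is $A\rtimes_\theta S=L(A,\theta,S)/\mathcal N$; $\overline w$ denotes the class of $w$. The map $A\to A\rtimes_\theta S$, $a\mapsto\overline{a\delta_1}$, is an injective homomorphism of unital algebras, and through it any $A\rtimes_\theta S$-bimodule is an $A$-bimodule. Bimodules and Hochschild cohomology. For a unital $K$-algebra $R$, $R^e=R\otimes_K R^{\mathrm{op}}$; $R$-bimodules are identified with left $R^e$-modules by $(a\otimes b)\cdot x=axb$. For an $R$-bimodule $M$, $H^n(R,M)=\operatorname{Ext}^n_{R^e}(R,M)$. $KS$-module structures. $A$ is a left $KS$-module by $s\cdot a=\theta_s(1_{s^{-1}}a)$. An $A\rtimes_\theta S$-bimodule $M$ is a left $KS$-module by $s\cdot x=\overline{1_s\delta_s}\cdot x\cdot\overline{1_{s^{-1}}\delta_{s^{-1}}}$. Then $\operatorname{Hom}_{A^e}(A,M)$ is a left $KS$-module by $(s\cdot f)(a)=s\cdot f(s^{-1}\cdot a)$; this gives the left exact functor $T_1$. Cohomology of $S$. $KE(S)$ is a left $KS$-module by $s\cdot e=ses^{-1}$ ($e\in E(S)$, $s\in S$). For a left $KS$-module $V$, $H^n(S,V)=\operatorname{Ext}^n_{KS}(KE(S),V)$. *)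

(* Defs.v *)
From HB Require Import structures.
From mathcomp Require Import all_boot all_order all_algebra.
From mathcomp Require Import finmap boolp classical_sets functions.
From mathcomp Require Import monalg.

Set Implicit Arguments.
Unset Strict Implicit.
Unset Printing Implicit Defensive.

Import GRing.Theory.
Local Open Scope ring_scope.

(* A unital associative K-algebra: a ring with a central homomorphism from K.
   The library's algType is not used because it excludes the zero algebra. *)
Record algebra (K : fieldType) := Algebra {
  aring :> pzRingType;
  aunit : {rmorphism K -> aring};
  aunitC : forall (k : K) (x : aring), aunit k * x = x * aunit k
}.

Lemma algType_aunitC (K : fieldType) (A : algType K) (k : K) (x : A) :
  in_alg A k * x = x * in_alg A k.
Proof. by rewrite /= mulr_algl mulr_algr. Qed.

Definition algebra_of (K : fieldType) (A : algType K) : algebra K :=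
  Algebra (@algType_aunitC K A).

Section Submodules.
Variable R : pzRingType.

Record submodule (V : lmodType R) := Submodule {
  smem :> V -> Prop;
  smem0 : smem 0;
  smemP : forall a x y, smem x -> smem y -> smem (a *: x + y)
}.

Definition spred (V : lmodType R) (U : submodule V) : {pred V} :=
  fun x => `[< U x >].

Lemma spredP (V : lmodType R) (U : submodule V) x : reflect (U x) (x \in spred U).
Proof. exact: asboolP. Qed.

Lemma spred_closed (V : lmodType R) (U : submodule V) : submod_closed (spred U).
Proof.
split=> [|a x y /spredP Ux /spredP Uy]; apply/spredP; first exact: smem0.
exact: smemP.
Qed.

HB.instance Definition _ (V : lmodType R) (U : submodule V) :=
  GRing.isSubmodClosed.Build R V (spred U)
    (spred_closed U).

Definition submod_type (V : lmodType R) (U : submodule V) : predArgType :=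
  {x : V | x \in spred U}.

HB.instance Definition _ (V : lmodType R) (U : submodule V) :=
  [isSub of submod_type U for @sval V (fun x => x \in spred U)].
HB.instance Definition _ (V : lmodType R) (U : submodule V) :=
  [Choice of submod_type U by <:].
HB.instance Definition _ (V : lmodType R) (U : submodule V) :=
  [SubChoice_isSubLmodule of submod_type U by <:].

Definition quotm (V : lmodType R) (U : submodule V) : Type :=
  Quotient.quot (spred U : zmodClosed V).

HB.instance Definition _ (V : lmodType R) (U : submodule V) :=
  GRing.Zmodule.on (quotm U).

Section Quotm.
Variables (V : lmodType R) (U : submodule V).

Definition qpi (x : V) : quotm U := \pi_(Quotient.quot (spred U : zmodClosed V))%qT x.
Definition qrepr (x : quotm U) : V := repr (x : Quotient.quot (spred U : zmodClosed V)).

Lemma qreprK x : qpi (qrepr x) = x.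
Proof. exact: reprK. Qed.

Lemma qpi_eq x y : qpi x = qpi y <-> U (x - y).
Proof.
split=> [/eqP|Uxy].
  by rewrite /qpi -Quotient.idealrBE => /spredP.
by apply/eqP; rewrite /qpi -Quotient.idealrBE; apply/spredP.
Qed.

Lemma qpiD x y : qpi (x + y) = qpi x + qpi y.
Proof. by rewrite /qpi raddfD. Qed.

Lemma qrepr_pi x : U (qrepr (qpi x) - x).
Proof. by apply/qpi_eq; rewrite qreprK. Qed.

Definition qscale (a : R) (x : quotm U) : quotm U := qpi (a *: qrepr x).

Lemma smemZ a x : U x -> U (a *: x).
Proof. by move=> Ux; rewrite -[_ *: _]addr0; apply: smemP => //; exact: smem0. Qed.

Lemma qscale_pi a x : qscale a (qpi x) = qpi (a *: x).
Proof. by apply/qpi_eq; rewrite -scalerBr; apply/smemZ/qrepr_pi. Qed.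

Lemma qpiP (P : quotm U -> Prop) : (forall x, P (qpi x)) -> forall x, P x.
Proof. by move=> h x; rewrite -(qreprK x). Qed.

Fact qscaleA a b v : qscale a (qscale b v) = qscale (a * b) v.
Proof. by elim/qpiP: v => v; rewrite !qscale_pi scalerA. Qed.
Fact qscale1 : left_id 1 qscale.
Proof. by elim/qpiP => v; rewrite !qscale_pi scale1r. Qed.
Fact qscaleDr : right_distributive qscale +%R.
Proof.
move=> a; elim/qpiP => v; elim/qpiP => w.
by rewrite -qpiD !qscale_pi scalerDr qpiD.
Qed.
Fact qscaleDl v : {morph qscale^~ v : a b / a + b}.
Proof. by elim/qpiP: v => v a b; rewrite !qscale_pi scalerDl qpiD. Qed.

HB.instance Definition _ :=
  GRing.Zmodule_isLmodule.Build R (quotm U) qscaleA qscale1 qscaleDr qscaleDl.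

Lemma qpi_is_linear : linear qpi.
Proof. by move=> a x y; rewrite qpiD -qscale_pi. Qed.
HB.instance Definition _ := GRing.isLinear.Build R V (quotm U) _ qpi qpi_is_linear.

End Quotm.

Section Subquotient.
Variables (V : lmodType R).

Fact sub_preim0 (Z B : submodule V) : B (val (0 : submod_type Z)).
Proof. by rewrite raddf0; apply: smem0. Qed.
Fact sub_preimP (Z B : submodule V) a (x y : submod_type Z) :
  B (val x) -> B (val y) -> B (val (a *: x + y)).
Proof. by move=> Bx By; rewrite linearP; apply: smemP. Qed.
Definition sub_preim (Z B : submodule V) : submodule (submod_type Z) :=
  @Submodule (submod_type Z) (fun x => B (val x)) (@sub_preim0 Z B)
    (@sub_preimP Z B).

(* Z / (Z :&: B) *)
Definition subquot (Z B : submodule V) : lmodType R := quotm (sub_preim Z B).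

End Subquotient.

Section KerIm.
Variables (U V W : lmodType R).

Fact ker_sub0 (g : {linear V -> W}) : g 0 = 0.
Proof. exact: raddf0. Qed.
Fact ker_subP (g : {linear V -> W}) a x y :
  g x = 0 -> g y = 0 -> g (a *: x + y) = 0.
Proof. by move=> gx gy; rewrite linearP gx gy scaler0 addr0. Qed.
Definition ker_sub (g : {linear V -> W}) : submodule V :=
  @Submodule V (fun x => g x = 0) (ker_sub0 g) (ker_subP (g := g)).

Fact im_sub0 (f : {linear U -> V}) : exists x, f x = 0.
Proof. by exists 0; rewrite raddf0. Qed.
Fact im_subP (f : {linear U -> V}) a x y :
  (exists u, f u = x) -> (exists u, f u = y) -> exists u, f u = a *: x + y.
Proof. by move=> [u <-] [v <-]; exists (a *: u + v); rewrite linearP. Qed.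
Definition im_sub (f : {linear U -> V}) : submodule V :=
  @Submodule V (fun y => exists x, f x = y) (im_sub0 f) (im_subP (f := f)).

Definition homology (f : {linear U -> V}) (g : {linear V -> W}) : lmodType R :=
  subquot (ker_sub g) (im_sub f).

End KerIm.

Definition lmod_iso (U V : lmodType R) : Prop :=
  exists f : {linear U -> V}, bijective f.

Definition lmod_trivial (V : lmodType R) : Prop := forall x : V, x = 0.

Record cochain := Cochain {
  cobj :> nat -> lmodType R;
  cdiff : forall n, {linear cobj n -> cobj n.+1};
  cdiffK : forall n x, cdiff n.+1 (cdiff n x) = 0
}.

Definition cohomology (C : cochain) (n : nat) : lmodType R :=
  match n with
  | 0 => homology (\0 : {linear C 0%N -> C 0%N}) (cdiff C 0)
  | m.+1 => homology (cdiff C m) (cdiff C m.+1)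
  end.

Definition injective_module (I : lmodType R) : Prop :=
  forall (X Y : lmodType R) (i : {linear X -> Y}) (f : {linear X -> I}),
    injective i -> exists g : {linear Y -> I}, forall x, g (i x) = f x.

Record injective_resolution (V : lmodType R) := InjectiveResolution {
  ires :> cochain;
  iaug : {linear V -> ires 0%N};
  ires_injective : forall n, injective_module (ires n);
  iaug_inj : injective iaug;
  ires_exact0 : forall x, cdiff ires 0 x = 0 <-> exists v, iaug v = x;
  ires_exact : forall n x,
    cdiff ires n.+1 x = 0 <-> exists y, cdiff ires n y = x
}.

Definition mk_linear (X Y : lmodType R) (f : X -> Y) (f_lin : linear f) :
  {linear X -> Y} := HB.pack f (GRing.isLinear.Build R X Y _ f f_lin).

Lemma linear_ext (X Y : lmodType R) (f g : {linear X -> Y}) : f =1 g -> f = g.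
Proof.
case: f => f [[Hf1] [Hf2]]; case: g => g [[Hg1] [Hg2]] /= fg.
have E : f = g by apply: funext.
case: _ / E in Hg1 Hg2 *; congr (GRing.Linear.Pack (GRing.Linear.Class _ _)).
  by congr (Algebra.isNmodMorphism.Axioms_ _); exact: Prop_irrelevance.
by congr (GRing.isScalable.Axioms_ _); exact: Prop_irrelevance.
Qed.

Definition lhom (X Y : lmodType R) : Type := {linear X -> Y}.

Section Hom.
Variables X Y : lmodType R.
HB.instance Definition _ := gen_eqMixin (lhom X Y).
HB.instance Definition _ := gen_choiceMixin (lhom X Y).

Definition hom_zero : lhom X Y := (\0 : {linear X -> Y}).
Definition hom_opp (f : lhom X Y) : lhom X Y := (\- f : {linear X -> Y}).
Definition hom_add (f g : lhom X Y) : lhom X Y := (f \+ g : {linear X -> Y}).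

Fact hom_addA : associative hom_add.
Proof. by move=> f g h; apply: linear_ext => x /=; rewrite addrA. Qed.
Fact hom_addC : commutative hom_add.
Proof. by move=> f g; apply: linear_ext => x /=; rewrite addrC. Qed.
Fact hom_add0 : left_id hom_zero hom_add.
Proof. by move=> f; apply: linear_ext => x /=; rewrite add0r. Qed.
Fact hom_addN : left_inverse hom_zero hom_opp hom_add.
Proof. by move=> f; apply: linear_ext => x /=; rewrite addNr. Qed.

HB.instance Definition _ :=
  GRing.isZmodule.Build (lhom X Y) hom_addA hom_addC hom_add0 hom_addN.

Lemma hom0E x : (0 : lhom X Y) x = 0. Proof. by []. Qed.
Lemma homDE (f g : lhom X Y) x : (f + g) x = f x + g x. Proof. by []. Qed.
End Hom.

End Submodules.
Arguments lmod_iso {R} U V.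
Arguments qpi {R V} U x.

Record mod_functor (R R' : pzRingType) := ModFunctor {
  fobj :> lmodType R -> lmodType R';
  fmap : forall X Y : lmodType R, {linear X -> Y} -> {linear fobj X -> fobj Y};
  fmap_id : forall X : lmodType R, fmap (idfun : {linear X -> X}) =1 id;
  fmap_comp : forall (X Y Z : lmodType R) (f : {linear X -> Y})
    (g : {linear Y -> Z}), fmap (g \o f : {linear X -> Z}) =1 fmap g \o fmap f;
  fmapD : forall (X Y : lmodType R) (f g : {linear X -> Y}),
    fmap (f \+ g : {linear X -> Y}) =1 fmap f \+ fmap g
}.

Arguments fmap {R R'} m {X Y} _.

Section FunctorCochain.
Variables (R R' : pzRingType) (F : mod_functor R R').

Lemma fmap0 (X Y : lmodType R) (x : F X) :
  fmap F (\0 : {linear X -> Y}) x = 0.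
Proof.
have /(_ x) /= := @fmapD _ _ F X Y (\0 : {linear X -> Y}) \0.
rewrite (_ : (_ \+ _ : {linear X -> Y}) = \0); last first.
  by apply: linear_ext => y /=; rewrite addr0.
by move/eqP; rewrite -[X in X == _]addr0 (inj_eq (addrI _)) eq_sym => /eqP.
Qed.

Fact map_cochainK (C : cochain R) n (x : F (C n)) :
  fmap F (cdiff C n.+1) (fmap F (cdiff C n) x) = 0.
Proof.
have /(_ x) /= <- := @fmap_comp _ _ F _ _ _ (cdiff C n) (cdiff C n.+1).
rewrite (_ : (_ \o _ : {linear C n -> C n.+2}) = \0) ?fmap0 //.
by apply: linear_ext => y /=; rewrite cdiffK.
Qed.
Definition map_cochain (C : cochain R) : cochain R' :=
  @Cochain R' (fun n => F (C n)) (fun n => fmap F (cdiff C n)) (@map_cochainK C).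

End FunctorCochain.

Section RestrictScalars.
Variables (K : fieldType) (R : algebra K).

Lemma aunit_scaleC (V : lmodType R) (k : K) (a : R) (x : V) :
  a *: (aunit R k *: x) = aunit R k *: (a *: x).
Proof. by rewrite !scalerA aunitC. Qed.

Definition resK (V : lmodType R) : Type := V.

Section ResK.
Variable V : lmodType R.
HB.instance Definition _ := GRing.Zmodule.on (resK V).

Definition resK_scale (k : K) (x : resK V) : resK V := aunit R k *: (x : V).

Fact resK_scaleA a b v : resK_scale a (resK_scale b v) = resK_scale (a * b) v.
Proof. by rewrite /resK_scale scalerA rmorphM. Qed.
Fact resK_scale1 : left_id 1 resK_scale.
Proof. by move=> v; rewrite /resK_scale rmorph1 scale1r. Qed.
Fact resK_scaleDr : right_distributive resK_scale +%R.
Proof. by move=> a v w; exact: scalerDr. Qed.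
Fact resK_scaleDl v : {morph resK_scale^~ v : a b / a + b}.
Proof. by move=> a b; rewrite /resK_scale rmorphD scalerDl. Qed.
HB.instance Definition _ := GRing.Zmodule_isLmodule.Build K (resK V)
  resK_scaleA resK_scale1 resK_scaleDr resK_scaleDl.
End ResK.

Lemma resK_linear (V W : lmodType R) (f : {linear V -> W}) :
  linear (f : resK V -> resK W).
Proof. by move=> a x y; exact: (linearP f). Qed.
End RestrictScalars.

Definition homK (K : fieldType) (R : algebra K) (X Y : lmodType R) : Type :=
  lhom X Y.

Section HomK.
Variables (K : fieldType) (R : algebra K) (X Y : lmodType R).

HB.instance Definition _ := GRing.Zmodule.on (homK X Y).

Fact homK_scale_linear (k : K) (f : homK X Y) :
  linear (fun x => aunit R k *: f x).
Proof. by move=> a x y; rewrite linearP scalerDr !scalerA aunitC. Qed.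
Definition homK_scale (k : K) (f : homK X Y) : homK X Y :=
  mk_linear (homK_scale_linear k f).

Fact homK_scaleA a b v : homK_scale a (homK_scale b v) = homK_scale (a * b) v.
Proof. by apply: linear_ext => x /=; rewrite scalerA rmorphM. Qed.
Fact homK_scale1 : left_id 1 homK_scale.
Proof. by move=> v; apply: linear_ext => x /=; rewrite rmorph1 scale1r. Qed.
Fact homK_scaleDr : right_distributive homK_scale +%R.
Proof. by move=> a v w; apply: linear_ext => x /=; rewrite scalerDr. Qed.
Fact homK_scaleDl v : {morph homK_scale^~ v : a b / a + b}.
Proof. by move=> a b; apply: linear_ext => x /=; rewrite rmorphD scalerDl. Qed.
HB.instance Definition _ := GRing.Zmodule_isLmodule.Build K (homK X Y)
  homK_scaleA homK_scale1 homK_scaleDr homK_scaleDl.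
End HomK.

Section HomFunctor.
Variables (K : fieldType) (R : algebra K) (X : lmodType R).

Definition homK_map (Y Z : lmodType R) (g : {linear Y -> Z}) (f : homK X Y) :
  homK X Z := (g \o f : {linear X -> Z}).

Fact homK_map_linear (Y Z : lmodType R) (g : {linear Y -> Z}) :
  linear (homK_map g).
Proof.
move=> a x y; apply: linear_ext => t /=; rewrite linearD linearZ_LR.
by [].
Qed.
HB.instance Definition _ (Y Z : lmodType R) (g : {linear Y -> Z}) :=
  GRing.isLinear.Build K (homK X Y) (homK X Z) _ (homK_map g)
    (homK_map_linear g).

Fact homK_map_id (Y : lmodType R) : homK_map (idfun : {linear Y -> Y}) =1 id.
Proof. by move=> f; apply: linear_ext. Qed.
Fact homK_map_comp (Y Z W : lmodType R) (f : {linear Y -> Z})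
  (g : {linear Z -> W}) :
  homK_map (g \o f : {linear Y -> W}) =1 homK_map g \o homK_map f.
Proof. by move=> h; apply: linear_ext. Qed.
Fact homK_mapD (Y Z : lmodType R) (f g : {linear Y -> Z}) :
  homK_map (f \+ g : {linear Y -> Z}) =1 homK_map f \+ homK_map g.
Proof. by move=> h; apply: linear_ext. Qed.

Definition hom_functor : mod_functor R K :=
  @ModFunctor R K (fun Y => homK X Y)
    (fun Y Z g => homK_map g) homK_map_id homK_map_comp homK_mapD.

End HomFunctor.

Section EnoughInjectives.

Section Extension.
Variables (K : fieldType) (X Y W : lmodType K).
Variables (i : {linear X -> Y}) (phi : {linear X -> W}).
Hypothesis i_inj : injective i.

Let good (G : set (Y * W)) : Prop :=
  [/\ forall x, G (i x, phi x),
      forall a u v, G u -> G v -> G (a *: u.1 + v.1, a *: u.2 + v.2) &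
      forall y w w', G (y, w) -> G (y, w') -> w = w'].

Let G0 : set (Y * W) := fun p => exists x, p = (i x, phi x).

Let good0 : good G0.
Proof.
split=> [x|a u v [x ->] [x' ->]|y w w' [x [-> ->]] [x' [/i_inj -> ->]]] //.
  by exists x.
by exists (a *: x + x'); rewrite /= !linearP.
Qed.

Let gT := {G : set (Y * W) | good G}.

Let maxG : exists t : gT, forall s : gT,
  (sval t `<=` sval s)%classic -> s = t.
Proof.
pose Rel (s t : gT) := `[< (sval s `<=` sval t)%classic >].
have [|||A Atot|t ht] := @Zorn gT Rel; last first.
- by exists t => s ts; apply: ht; apply/asboolP.
- have [[a Aa]|nA] := pselect (exists a, A a); last first.
    exists (exist _ G0 good0) => s As; case: nA; by exists s.
  pose U : set (Y * W) := fun p => exists2 s : gT, A s & sval s p.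
  suff gU : good U.
    by exists (exist _ U gU) => s As; apply/asboolP => p sp; exists s.
  split=> [x|c u v [s As su] [t At tv]|y w w' [s As su] [t At tv]].
  + by exists a => //; case: (svalP a) => + _ _; apply.
  + have [/asboolP st|/asboolP ts] := Atot s t As At.
      by exists t => //; case: (svalP t) => _ h _; apply: h => //; exact: st.
    by exists s => //; case: (svalP s) => _ h _; apply: h => //; exact: ts.
  + have [/asboolP st|/asboolP ts] := Atot s t As At.
      by case: (svalP t) => _ _; apply; [apply: st su|apply: tv].
    by case: (svalP s) => _ _; apply; [apply: su|apply: ts tv].
- move=> s t /asboolP st /asboolP ts.
  have E : sval s = sval t by apply/seteqP; split.
  case: s t E {st ts} => [s gs] [t gt] /= E; case: _ / E in gt *.
  by congr exist; exact: Prop_irrelevance.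
- move=> r s t /asboolP rs /asboolP st; apply/asboolP.
  by move=> p /rs/st.
- by move=> t; apply/asboolP.
Qed.

Lemma linear_extension : exists psi : {linear Y -> W}, forall x, psi (i x) = phi x.
Proof.
have [[G gG] Gmax] := maxG; case: (gG) => [Gi Glin Gfun].
have G00 : G (0, 0) by have := Gi 0; rewrite !raddf0.
have Gtot y : exists w, G (y, w).
  have [//|ny] := pselect (exists w, G (y, w)).
  pose H : set (Y * W) := fun p => exists u k, G u /\ p = (u.1 + k *: y, u.2).
  have gH : good H.
    split=> [x|a _ _ [u [k [Gu ->]]] [v [l [Gv ->]]]|z w w'].
    - by exists (i x, phi x), 0; split => //; rewrite /= scale0r addr0.
    - exists (a *: u.1 + v.1, a *: u.2 + v.2), (a * k + l); split; first exact: Glin.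
      by congr pair => /=; rewrite scalerDr !scalerDl -!scalerA addrACA.
    - move=> [u [k [Gu [-> ->]]]] [v [l [Gv [+ ->]]]] => E.
      have [kl|kl] := eqVneq k l.
        move: E; rewrite kl => /addIr E; apply: (Gfun u.1).
          by case: u Gu {E}.
        by rewrite E; case: v Gv {E}.
      case: ny; exists ((k - l)^-1 *: (v.2 - u.2)).
      have Guv : G (v.1 - u.1, v.2 - u.2).
        have := Glin (-1) _ _ Gu Gv.
        by rewrite !scaleN1r ![- _ + _]addrC.
      have := Glin (k - l)^-1 _ _ Guv G00; rewrite /= !addr0.
      suff -> : v.1 - u.1 = (k - l) *: y by rewrite scalerK // subr_eq0.
      rewrite scalerBl; apply/eqP.
      by rewrite subr_eq addrAC eq_sym subr_eq addrC E addrC.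
  have sGH : (G `<=` H)%classic.
    by move=> u Gu; exists u, 0; rewrite scale0r addr0; split => //; case: u {Gu}.
  have [EH] := Gmax (exist _ H gH) sGH.
  case: ny; exists 0; rewrite -EH; exists (0, 0), 1; split => //=.
  by rewrite add0r scale1r.
pose psi y := sval (cid (Gtot y)).
have psiP y : G (y, psi y) by exact: svalP (cid (Gtot y)).
have psi_lin : linear psi.
  move=> a u v; apply: (Gfun (a *: u + v)) => //.
  exact: (Glin a (u, psi u) (v, psi v)).
by exists (mk_linear psi_lin) => x; apply: (Gfun (i x)) => //; exact: psiP.
Qed.

End Extension.

Variables (K : fieldType) (R : algebra K).

Section Coinduced.
Variable V : lmodType R.

(* Hom_K(R, V) with (r f)(x) = f(x r); it is injective because every K-linear
   injection splits, and V embeds in it by v |-> (x |-> x v). *)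
Definition coind : Type := lhom (resK R^o) (resK V).
HB.instance Definition _ := GRing.Zmodule.on coind.

Fact coind_scale_linear (r : R) (f : coind) :
  linear (fun x : resK R^o => f ((x : R) * r)).
Proof.
move=> k x y; rewrite -linearP; congr (f _).
by rewrite mulrDl; congr (_ + _); rewrite -mulrA.
Qed.
Definition coind_scale (r : R) (f : coind) : coind :=
  mk_linear (coind_scale_linear r f).

Fact coind_scaleA a b v : coind_scale a (coind_scale b v) = coind_scale (a * b) v.
Proof. by apply: linear_ext => x /=; rewrite mulrA. Qed.
Fact coind_scale1 : left_id 1 coind_scale.
Proof. by move=> v; apply: linear_ext => x /=; rewrite mulr1. Qed.
Fact coind_scaleDr : right_distributive coind_scale +%R.
Proof. by move=> a v w; apply: linear_ext. Qed.
Fact coind_scaleDl v : {morph coind_scale^~ v : a b / a + b}.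
Proof.
move=> a b; apply: linear_ext => x; rewrite [LHS]/= mulrDr.
exact: (linearD v).
Qed.
HB.instance Definition _ := GRing.Zmodule_isLmodule.Build R coind
  coind_scaleA coind_scale1 coind_scaleDr coind_scaleDl.

Fact coaug_linear0 (v : V) : linear (fun x : resK R^o => (x : R) *: v : resK V).
Proof. by move=> k x y; rewrite scalerDl -scalerA. Qed.
Definition coaug_fun (v : V) : coind := mk_linear (coaug_linear0 v).
Fact coaug_linear : linear coaug_fun.
Proof.
by move=> a u v; apply: linear_ext => x /=; rewrite scalerDr scalerA.
Qed.
Definition coaug : {linear V -> coind} := mk_linear coaug_linear.

Lemma coaug_inj : injective coaug.
Proof.
move=> u v /(congr1 (fun f : coind => f (1 : R))).
by rewrite /= !scale1r.
Qed.

Lemma coind_injective : injective_module coind.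
Proof.
move=> X Y i f i_inj.
have phi_lin : linear (fun x : resK X => (f x : coind) (1 : R) : resK V).
  move=> k x y; rewrite (linearP f) /=.
  congr (_ + _); rewrite mul1r -[aunit R k]mulr1.
  exact: (linearZ_LR (f x : coind)).
have [psi psiE] := @linear_extension K (resK X) (resK Y) (resK V)
  (mk_linear (resK_linear i)) (mk_linear phi_lin) i_inj.
have g0_lin y : linear (fun r : resK R^o => psi ((r : R) *: y) : resK V).
  by move=> k r r'; rewrite -linearP scalerDl -scalerA.
pose g y : coind := mk_linear (g0_lin y).
have g_lin : linear g.
  move=> a y y'; apply: linear_ext => r /=.
  by rewrite scalerDr scalerA (linearD psi).
exists (mk_linear g_lin) => x; apply: linear_ext => r /=.
rewrite -linearZ_LR (psiE ((r : R) *: x)) /= linearZ_LR /=.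
by rewrite mul1r.
Qed.

End Coinduced.

(* Derived functors are computed from the resolution obtained by iterating the
   embedding of a module in its coinduced module. *)
Section StandardResolution.
Variable V : lmodType R.

Fixpoint cosyzygy (n : nat) : lmodType R :=
  match n with
  | 0 => V
  | m.+1 => quotm (im_sub (coaug (cosyzygy m)))
  end.

Definition injres_diff n :
  {linear coind (cosyzygy n) -> coind (cosyzygy n.+1)} :=
  (coaug (cosyzygy n.+1) \o qpi (im_sub (coaug (cosyzygy n)))
    : {linear coind (cosyzygy n) -> coind (cosyzygy n.+1)}).

Lemma injres_diff_ker n x :
  injres_diff n x = 0 <-> exists v, coaug (cosyzygy n) v = x.
Proof.
split=> [h|[v vx]].
  have : qpi (im_sub (coaug (cosyzygy n))) x = qpi _ 0.
    apply: (@coaug_inj (cosyzygy n.+1)); apply: etrans h _.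
    by rewrite (raddf0 (qpi _)) raddf0.
  by move/qpi_eq; rewrite subr0.
have E : qpi (im_sub (coaug (cosyzygy n))) x = qpi _ 0.
  by apply/qpi_eq; exists v; rewrite subr0.
apply: etrans (congr1 (coaug (cosyzygy n.+1)) E) _.
by rewrite (raddf0 (qpi _)) raddf0.
Qed.

Lemma injres_diffK n x : injres_diff n.+1 (injres_diff n x) = 0.
Proof. by apply/injres_diff_ker; exists (qpi _ x). Qed.

Lemma injres_exact n x :
  injres_diff n.+1 x = 0 <-> exists y, injres_diff n y = x.
Proof.
rewrite injres_diff_ker; split=> [[v <-]|[y <-]].
  by exists (qrepr v); exact: congr1 (qreprK v).
by exists (qpi _ y).
Qed.

Definition injres : injective_resolution V :=
  @InjectiveResolution R V
    (@Cochain R (fun n => coind (cosyzygy n)) injres_diff injres_diffK)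
    (coaug V) (fun n => @coind_injective (cosyzygy n)) (@coaug_inj V)
    (@injres_diff_ker 0) injres_exact.

End StandardResolution.

End EnoughInjectives.

Section DerivedFunctors.
Variables (K : fieldType) (R : algebra K).

Definition rderived (R' : pzRingType) (F : mod_functor R R') (n : nat)
    (V : lmodType R) : lmodType R' :=
  cohomology (map_cochain F (injres V)) n.

Definition Ext (n : nat) (X V : lmodType R) : lmodType K :=
  rderived (hom_functor X) n V.

End DerivedFunctors.

Section FiniteSums.
Variables (T : choiceType) (A V : zmodType) (f : T -> A -> V).
Hypothesis fD : forall t a b, f t (a + b) = f t a + f t b.

(* the additive extension of  a t |-> f t a  to formal sums *)
Definition msum (g : {malg A[T]}) : V := \sum_(t <- msupp g) f t (g@_t).

Let f0 t : f t 0 = 0.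
Proof. by apply: (addrI (f t 0)); rewrite -fD !addr0. Qed.

Lemma msumEw (d : {fset T}) (g : {malg A[T]}) :
  (msupp g `<=` d)%fset -> msum g = \sum_(t <- d) f t (g@_t).
Proof.
move=> le; rewrite /msum (big_fset_incl _ le) => //= x xd /mcoeff_outdom ->.
by rewrite f0.
Qed.

Lemma msumU t a : msum << a *g t >> = f t a.
Proof. by rewrite (msumEw msuppU_le) big_seq_fset1 mcoeffUU. Qed.

Lemma msumD g h : msum (g + h) = msum g + msum h.
Proof.
rewrite (msumEw (msuppD_le g h)) (msumEw (fsubsetUl (msupp g) (msupp h))).
rewrite (msumEw (fsubsetUr (msupp g) (msupp h))) -big_split /=.
by apply: eq_bigr => t _; rewrite mcoeffD fD.
Qed.

Lemma msum0 : msum 0 = 0.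
Proof. by apply: (addrI (msum 0)); rewrite -msumD !addr0. Qed.

End FiniteSums.

Lemma malg_ind (T : choiceType) (A : zmodType) (P : {malg A[T]} -> Prop) :
  P 0 -> (forall g h, P g -> P h -> P (g + h)) ->
  (forall a t, P << a *g t >>) -> forall g, P g.
Proof. by move=> P0 PD PU g; rewrite (monalgE g); apply: big_ind => // t _. Qed.

Lemma msum_ext (T : choiceType) (A V : zmodType) (f f' : T -> A -> V) g :
  (forall t a, f t a = f' t a) -> msum f g = msum f' g.
Proof. by move=> ff'; apply: eq_bigr => t _; rewrite ff'. Qed.

(* Product  a s * b t = a (s . b) (s t)  of formal sums with coefficients in a
   ring on which the monoid S acts *)
Section SkewProduct.
Variables (S : monoidType) (A : pzRingType) (act : S -> A -> A).
Hypothesis actD : forall s a b, act s (a + b) = act s a + act s b.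
Hypothesis actM : forall s a b, act s (a * b) = act s a * act s b.
Hypothesis act_act : forall s t a, act (s * t)%g a = act s (act t a).

Definition skew_mul (g h : {malg A[S]}) : {malg A[S]} :=
  msum (fun s a => msum (fun t b => << a * act s b *g (s * t)%g >>) h) g.

Let in1D s a t b b' : << a * act s (b + b') *g (s * t)%g >> =
  << a * act s b *g (s * t)%g >> + << a * act s b' *g (s * t)%g >> :> {malg A[S]}.
Proof. by rewrite actD mulrDr monalgUD. Qed.

Let in2D h s a a' :
  msum (fun t b => << (a + a') * act s b *g (s * t)%g >> : {malg A[S]}) h =
  msum (fun t b => << a * act s b *g (s * t)%g >> : {malg A[S]}) h +
  msum (fun t b => << a' * act s b *g (s * t)%g >> : {malg A[S]}) h.
Proof.
elim/malg_ind: h => [|h h' IH IH'|b t]; first by rewrite !msum0 ?addr0.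
  by rewrite !msumD // IH IH' addrACA.
by rewrite !msumU // mulrDl monalgUD.
Qed.

Lemma skew_mulDl g g' h : skew_mul (g + g') h = skew_mul g h + skew_mul g' h.
Proof. by rewrite /skew_mul msumD //; exact: in2D. Qed.

Lemma skew_mul0l h : skew_mul 0 h = 0.
Proof. by rewrite /skew_mul msum0 //; exact: in2D. Qed.

Lemma skew_mulUl a s h :
  skew_mul << a *g s >> h = msum (fun t b => << a * act s b *g (s * t)%g >>) h.
Proof. by rewrite /skew_mul msumU //; exact: in2D. Qed.

Lemma skew_mulDr g h h' : skew_mul g (h + h') = skew_mul g h + skew_mul g h'.
Proof.
elim/malg_ind: g => [|g g' IH IH'|b t]; first by rewrite !skew_mul0l addr0.
  by rewrite !skew_mulDl IH IH' addrACA.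
by rewrite !skew_mulUl msumD.
Qed.

Lemma skew_mul0r g : skew_mul g 0 = 0.
Proof. by apply: (addrI (skew_mul g 0)); rewrite -skew_mulDr !addr0. Qed.

Lemma skew_mulUU a s b t :
  skew_mul << a *g s >> << b *g t >> = << a * act s b *g (s * t)%g >>.
Proof. by rewrite skew_mulUl msumU. Qed.

Lemma skew_mulA g h k : skew_mul g (skew_mul h k) = skew_mul (skew_mul g h) k.
Proof.
elim/malg_ind: g => [|g g' IH IH'|a s]; first by rewrite !skew_mul0l.
  by rewrite !skew_mulDl IH IH'.
elim/malg_ind: h => [|h h' IH IH'|b t].
- by rewrite skew_mul0l !skew_mul0r skew_mul0l.
- by rewrite skew_mulDl !skew_mulDr skew_mulDl IH IH'.
elim/malg_ind: k => [|k k' IH IH'|c u]; first by rewrite !skew_mul0r.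
  by rewrite !skew_mulDr IH IH'.
by rewrite !skew_mulUU actM act_act mulrA mulgA.
Qed.

End SkewProduct.

Section MonoidAlgebra.
Variables (K : fieldType) (G : monoidType).

Definition monalg_type : Type := {malg K[G]}.
HB.instance Definition _ := GRing.Zmodule.on monalg_type.

Definition monalg_mul : monalg_type -> monalg_type -> monalg_type :=
  @skew_mul G K (fun _ a => a).
Definition monalg_one : monalg_type := << 1 *g 1%g >>.

Fact monalg_mulA : associative monalg_mul.
Proof. by move=> x y z; apply: skew_mulA. Qed.
Fact monalg_mulDl : left_distributive monalg_mul +%R.
Proof. by move=> x y z; apply: skew_mulDl. Qed.
Fact monalg_mulDr : right_distributive monalg_mul +%R.
Proof. by move=> x y z; apply: skew_mulDr. Qed.
Fact monalg_mul1 : left_id monalg_one monalg_mul.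
Proof.
elim/malg_ind => [|g h IH IH'|a t]; first exact: skew_mul0r.
  by rewrite monalg_mulDr IH IH'.
by rewrite /monalg_mul skew_mulUU // mul1r mul1g.
Qed.
Fact monalg_1mul : right_id monalg_one monalg_mul.
Proof.
elim/malg_ind => [|g h IH IH'|a t]; first exact: skew_mul0l.
  by rewrite monalg_mulDl IH IH'.
by rewrite /monalg_mul skew_mulUU // mulr1 mulg1.
Qed.
HB.instance Definition _ := GRing.Zmodule_isPzRing.Build monalg_type
  monalg_mulA monalg_mul1 monalg_1mul monalg_mulDl monalg_mulDr.

Definition monalg_unit (k : K) : monalg_type := << k *g 1%g >>.
Fact monalg_unit_zmod : zmod_morphism monalg_unit.
Proof. by move=> a b; exact: monalgUB. Qed.
Fact monalg_unit_monoid : monoid_morphism monalg_unit.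
Proof.
split=> // a b; rewrite [RHS]skew_mulUU //.
by rewrite mulg1.
Qed.
HB.instance Definition _ :=
  GRing.isZmodMorphism.Build K monalg_type monalg_unit monalg_unit_zmod.
HB.instance Definition _ :=
  GRing.isMonoidMorphism.Build K monalg_type monalg_unit monalg_unit_monoid.

Lemma monalg_unitC (k : K) (x : monalg_type) :
  monalg_unit k * x = x * monalg_unit k.
Proof.
elim/malg_ind: x => [|g h IH IH'|a t]; first by rewrite mulr0 mul0r.
  by rewrite mulrDl mulrDr IH IH'.
by rewrite [LHS]skew_mulUU // [RHS]skew_mulUU // mulg1 mul1g mulrC.
Qed.

Definition monoid_algebra : algebra K := Algebra monalg_unitC.

End MonoidAlgebra.

Record linrep (K : fieldType) (G : monoidType) := LinRep {
  rep_space :> lmodType K;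
  rep : G -> rep_space -> rep_space;
  rep_linear : forall g, linear (rep g);
  rep1 : forall x, rep 1%g x = x;
  repM : forall g h x, rep (g * h)%g x = rep g (rep h x)
}.

Section RepModule.
Variables (K : fieldType) (G : monoidType) (V : linrep K G).

Definition repmod : Type := rep_space V.
HB.instance Definition _ := GRing.Zmodule.on repmod.

Definition repmod_scale (a : monoid_algebra K G) (v : repmod) : repmod :=
  msum (fun g k => k *: rep g v) (a : {malg K[G]}).

Let repD g x y : @rep _ _ V g (x + y) = rep g x + rep g y.
Proof. by have := rep_linear g 1 x y; rewrite !scale1r. Qed.
Let rep0 g : @rep _ _ V g 0 = 0.
Proof. by apply: (addrI (rep g 0)); rewrite -repD !addr0. Qed.
Let repZ g k x : @rep _ _ V g (k *: x) = k *: rep g x.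
Proof. by have := rep_linear g k x 0; rewrite rep0 !addr0. Qed.

Let fD v (g : G) (a b : K) :
  (a + b) *: @rep _ _ V g v = a *: rep g v + b *: rep g v.
Proof. exact: scalerDl. Qed.

Lemma repmod_scaleU k g v :
  repmod_scale (<< k *g g >> : {malg K[G]}) v = k *: @rep _ _ V g v.
Proof. exact: msumU. Qed.

Fact repmod_scaleDl v : {morph repmod_scale^~ v : a b / a + b}.
Proof. by move=> a b; apply: msumD. Qed.
Fact repmod_scaleDr : right_distributive repmod_scale +%R.
Proof.
move=> a v w; rewrite /repmod_scale /msum -big_split /=.
by apply: eq_bigr => g _; rewrite repD scalerDr.
Qed.
Fact repmod_scale1 : left_id 1 repmod_scale.
Proof. by move=> v; rewrite [LHS]repmod_scaleU scale1r rep1. Qed.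
Let repmod_scale0l v : repmod_scale 0 v = 0.
Proof. exact: msum0. Qed.
Let repmod_scale0r a : repmod_scale a 0 = 0.
Proof. by apply: (addrI (repmod_scale a 0)); rewrite -repmod_scaleDr !addr0. Qed.
Fact repmod_scaleA a b v :
  repmod_scale a (repmod_scale b v) = repmod_scale (a * b) v.
Proof.
elim/malg_ind: a => [|g h IH IH'|k s].
- by rewrite mul0r !repmod_scale0l.
- by rewrite mulrDl !repmod_scaleDl IH IH'.
elim/malg_ind: b => [|g h IH IH'|l t].
- by rewrite mulr0 !repmod_scale0l repmod_scale0r.
- by rewrite mulrDr !repmod_scaleDl repmod_scaleDr IH IH'.
rewrite [_ * _]skew_mulUU // !repmod_scaleU repM repZ scalerA.
by [].
Qed.
HB.instance Definition _ := GRing.Zmodule_isLmodule.Build (monoid_algebra K G) repmod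
  repmod_scaleA repmod_scale1 repmod_scaleDr repmod_scaleDl.
End RepModule.

Definition is_ideal (L : pzRingType) (I : L -> Prop) : Prop :=
  [/\ I 0, forall x y, I x -> I y -> I (x + y), forall a x, I x -> I (a * x) &
      forall a x, I x -> I (x * a)].

Definition ideal_gen (L : pzRingType) (P : L -> Prop) (x : L) : Prop :=
  forall I : L -> Prop, is_ideal I -> (forall y, P y -> I y) -> I x.

Lemma ideal_genP (L : pzRingType) (P : L -> Prop) : is_ideal (ideal_gen P).
Proof.
split=> [|x y hx hy|a x hx|a x hx] I iI PI; case: (iI) => I0 ID IL IR //.
- by apply: ID; [exact: hx|exact: hy].
- by apply: IL; exact: hx.
- by apply: IR; exact: hx.
Qed.

Section QuotientRing.
Variables (L : pzRingType) (P : L -> Prop).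

Fact ideal_gen0 : ideal_gen P (0 : L^o). Proof. by case: (ideal_genP P). Qed.
Fact ideal_genZ (a : L) (x y : L^o) :
  ideal_gen P x -> ideal_gen P y -> ideal_gen P (a *: x + y).
Proof. by case: (ideal_genP P) => _ ID IL _ hx hy; apply: ID => //; apply: IL. Qed.
Definition ideal_submod : submodule (L^o) := Submodule ideal_gen0 ideal_genZ.

Definition quotring : Type := quotm ideal_submod.
HB.instance Definition _ := GRing.Zmodule.on quotring.

Definition rpi (x : L) : quotring := qpi ideal_submod (x : L^o).
Definition rrepr (x : quotring) : L := qrepr (x : quotm ideal_submod).

Lemma rreprK x : rpi (rrepr x) = x. Proof. exact: qreprK. Qed.
Lemma rpiP (Q : quotring -> Prop) : (forall x, Q (rpi x)) -> forall x, Q x.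
Proof. by move=> h x; rewrite -(rreprK x). Qed.
Lemma rpi_eq x y : rpi x = rpi y <-> ideal_gen P (x - y).
Proof. exact: qpi_eq. Qed.
Lemma rrepr_pi x : ideal_gen P (rrepr (rpi x) - x).
Proof. by apply/rpi_eq; rewrite rreprK. Qed.
Lemma rpiD x y : rpi (x + y) = rpi x + rpi y. Proof. exact: qpiD. Qed.

Definition quotring_mul (x y : quotring) : quotring := rpi (rrepr x * rrepr y).
Lemma quotring_mul_pi x y : quotring_mul (rpi x) (rpi y) = rpi (x * y).
Proof.
apply/rpi_eq; set x' := rrepr _; set y' := rrepr _.
have -> : x' * y' - x * y = (x' - x) * y' + x * (y' - y).
  by rewrite mulrBl mulrBr addrA subrK.
case: (ideal_genP P) => _ ID IL IR; apply: ID.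
  by apply: IR; exact: rrepr_pi.
by apply: IL; exact: rrepr_pi.
Qed.

Fact quotring_mulA : associative quotring_mul.
Proof.
elim/rpiP => x; elim/rpiP => y; elim/rpiP => z.
by rewrite !quotring_mul_pi mulrA.
Qed.
Fact quotring_mul1 : left_id (rpi 1) quotring_mul.
Proof. by elim/rpiP => x; rewrite quotring_mul_pi mul1r. Qed.
Fact quotring_1mul : right_id (rpi 1) quotring_mul.
Proof. by elim/rpiP => x; rewrite quotring_mul_pi mulr1. Qed.
Fact quotring_mulDl : left_distributive quotring_mul +%R.
Proof.
elim/rpiP => x; elim/rpiP => y; elim/rpiP => z.
by rewrite -rpiD !quotring_mul_pi mulrDl rpiD.
Qed.
Fact quotring_mulDr : right_distributive quotring_mul +%R.
Proof.
elim/rpiP => x; elim/rpiP => y; elim/rpiP => z.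
by rewrite -rpiD !quotring_mul_pi mulrDr rpiD.
Qed.
HB.instance Definition _ := GRing.Zmodule_isPzRing.Build quotring
  quotring_mulA quotring_mul1 quotring_1mul quotring_mulDl quotring_mulDr.

Fact rpi_zmod : zmod_morphism rpi.
Proof. by move=> x y; exact: (raddfB (qpi ideal_submod)). Qed.
Fact rpi_monoid : monoid_morphism rpi.
Proof. by split=> // x y; rewrite -quotring_mul_pi. Qed.
HB.instance Definition _ := GRing.isZmodMorphism.Build L quotring rpi rpi_zmod.
HB.instance Definition _ :=
  GRing.isMonoidMorphism.Build L quotring rpi rpi_monoid.

Section QuotModule.
Variables (V : lmodType L).
Hypothesis PV : forall p, P p -> forall v : V, p *: v = 0.

Definition quotring_mod of (forall p, P p -> forall v : V, p *: v = 0) : Type := V.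
Local Notation V' := (quotring_mod PV).
HB.instance Definition _ := GRing.Zmodule.on V'.

Definition quotring_scale (a : quotring) (v : V') : V' := rrepr a *: (v : V).

Lemma quotring_scale_pi a (v : V') : quotring_scale (rpi a) v = a *: (v : V).
Proof.
apply/eqP; rewrite -subr_eq0; apply/eqP.
have /= := @scalerBl _ V (rrepr (rpi a)) a v; rewrite /quotring_scale => <-.
pose I x := forall w : V, x *: w = 0.
suff : I (rrepr (rpi a) - a) by apply.
apply: rrepr_pi => //; rewrite /I; split=> [w|x y hx hy w|b x hx w|b x hx w].
- by rewrite scale0r.
- by rewrite scalerDl hx hy addr0.
- by rewrite -scalerA hx scaler0.
- by rewrite -scalerA hx.
Qed.

Fact quotring_scaleA a b v :
  quotring_scale a (quotring_scale b v) = quotring_scale (a * b) v.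
Proof.
elim/rpiP: a => a; elim/rpiP: b => b.
by rewrite -rmorphM !quotring_scale_pi scalerA.
Qed.
Fact quotring_scale1 : left_id 1 quotring_scale.
Proof. by move=> v; rewrite -(rmorph1 rpi) quotring_scale_pi scale1r. Qed.
Fact quotring_scaleDr : right_distributive quotring_scale +%R.
Proof. by move=> a v w; exact: scalerDr. Qed.
Fact quotring_scaleDl v : {morph quotring_scale^~ v : a b / a + b}.
Proof.
elim/rpiP => a; elim/rpiP => b.
by rewrite -rmorphD !quotring_scale_pi scalerDl.
Qed.
HB.instance Definition _ := GRing.Zmodule_isLmodule.Build quotring V'
  quotring_scaleA quotring_scale1 quotring_scaleDr quotring_scaleDl.
End QuotModule.

End QuotientRing.

Section QuotientAlgebra.
Variables (K : fieldType) (L : algebra K) (P : L -> Prop).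

Definition quotalg_unit (k : K) : quotring P := rpi P (aunit L k).
Fact quotalg_unit_zmod : zmod_morphism quotalg_unit.
Proof. by move=> x y; rewrite /quotalg_unit !rmorphB. Qed.
Fact quotalg_unit_monoid : monoid_morphism quotalg_unit.
Proof. by split=> [|x y]; rewrite /quotalg_unit ?rmorph1 // !rmorphM. Qed.
HB.instance Definition _ :=
  GRing.isZmodMorphism.Build K (quotring P) quotalg_unit quotalg_unit_zmod.
HB.instance Definition _ :=
  GRing.isMonoidMorphism.Build K (quotring P) quotalg_unit quotalg_unit_monoid.

Lemma quotalg_unitC (k : K) (x : quotring P) :
  quotalg_unit k * x = x * quotalg_unit k.
Proof.
elim/rpiP: x => x; rewrite /quotalg_unit -[LHS](rmorphM (rpi P)).
by rewrite aunitC rmorphM.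
Qed.

Definition quotalg : algebra K := Algebra quotalg_unitC.
End QuotientAlgebra.

(* Enveloping algebra  R^e = R (x)_K R^op, as the monoid algebra of R x R^op
   modulo the bilinearity relations of the tensor product. *)
Definition envmon (K : fieldType) (R : algebra K) : Type := (R * R)%type.

Section EnvelopingMonoid.
Variables (K : fieldType) (R : algebra K).
HB.instance Definition _ := Choice.on (envmon R).

Definition envmon_one : envmon R := (1, 1).
Definition envmon_mul (x y : envmon R) : envmon R := (x.1 * y.1, y.2 * x.2).
Fact envmon_mulA : associative envmon_mul.
Proof. by move=> x y z; rewrite /envmon_mul /= !mulrA. Qed.
Fact envmon_mul1 : left_id envmon_one envmon_mul.
Proof. by case=> x y; rewrite /envmon_mul /= mul1r mulr1. Qed.
Fact envmon_1mul : right_id envmon_one envmon_mul.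
Proof. by case=> x y; rewrite /envmon_mul /= mul1r mulr1. Qed.
HB.instance Definition _ :=
  isMonoid.Build (envmon R) envmon_mulA envmon_mul1 envmon_1mul.

Definition tens0 (a b : R) : monoid_algebra K (envmon R) :=
  << 1 *g ((a, b) : envmon R) >> : {malg K[envmon R]}.

Inductive env_rel : monoid_algebra K (envmon R) -> Prop :=
| EnvAddl a a' b : env_rel (tens0 (a + a') b - (tens0 a b + tens0 a' b))
| EnvAddr a b b' : env_rel (tens0 a (b + b') - (tens0 a b + tens0 a b'))
| EnvScalel k a b :
    env_rel (tens0 (aunit R k * a) b - aunit (monoid_algebra K _) k * tens0 a b)
| EnvScaler k a b :
    env_rel (tens0 a (aunit R k * b) - aunit (monoid_algebra K _) k * tens0 a b).

Definition env : algebra K := quotalg env_rel.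

Definition tens (a b : R) : env := rpi env_rel (tens0 a b).

Lemma tensM a b c d : tens a b * tens c d = tens (a * c) (d * b).
Proof.
rewrite -[LHS](rmorphM (rpi env_rel)); congr (rpi _ _).
by rewrite [LHS]skew_mulUU // mulr1.
Qed.
Lemma tens1 : tens 1 1 = 1. Proof. by []. Qed.

Lemma tens_scaleA (M : lmodType env) a b c d (x : M) :
  tens a b *: (tens c d *: x) = tens (a * c) (d * b) *: x.
Proof. by rewrite scalerA tensM. Qed.

Lemma env_relP x y : env_rel (x - y) -> rpi env_rel x = rpi env_rel y.
Proof. by move=> h; apply/rpi_eq => I _; apply. Qed.

Lemma tensDl a a' b : tens (a + a') b = tens a b + tens a' b.
Proof. by rewrite /tens (env_relP (EnvAddl _ _ _)) rmorphD. Qed.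
Lemma tensDr a b b' : tens a (b + b') = tens a b + tens a b'.
Proof. by rewrite /tens (env_relP (EnvAddr _ _ _)) rmorphD. Qed.
Lemma tensKl k a b : tens (aunit R k * a) b = aunit env k * tens a b.
Proof. by rewrite /tens (env_relP (EnvScalel _ _ _)) rmorphM. Qed.
Lemma tensKr k a b : tens a (aunit R k * b) = aunit env k * tens a b.
Proof. by rewrite /tens (env_relP (EnvScaler _ _ _)) rmorphM. Qed.

Lemma tens_aunit k : tens (aunit R k) 1 = aunit env k.
Proof. by rewrite -[aunit R k]mulr1 tensKl tens1 mulr1. Qed.

End EnvelopingMonoid.

(* R-bimodules on which both actions of K agree *)
Record bimodule (K : fieldType) (R : algebra K) := Bimodule {
  bisort :> zmodType;
  bil : R -> bisort -> bisort;
  bir : bisort -> R -> bisort;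
  bilDl : forall a b x, bil (a + b) x = bil a x + bil b x;
  bilDr : forall a x y, bil a (x + y) = bil a x + bil a y;
  birDl : forall x y a, bir (x + y) a = bir x a + bir y a;
  birDr : forall x a b, bir x (a + b) = bir x a + bir x b;
  bil1 : forall x, bil 1 x = x;
  bir1 : forall x, bir x 1 = x;
  bilM : forall a b x, bil (a * b) x = bil a (bil b x);
  birM : forall x a b, bir x (a * b) = bir (bir x a) b;
  bilr : forall a x b, bir (bil a x) b = bil a (bir x b);
  biK : forall k x, bil (aunit R k) x = bir x (aunit R k)
}.

(* R^e acts by  (a (x) b) x = a x b  (see env_modE). *)
Section BimoduleEnv.
Variables (K : fieldType) (R : algebra K) (B : bimodule R).

Definition bimK : Type := bisort B.
HB.instance Definition _ := GRing.Zmodule.on bimK.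
Definition bimK_scale (k : K) (x : bimK) : bimK := bil (aunit R k) (x : B).
Fact bimK_scaleA a b v : bimK_scale a (bimK_scale b v) = bimK_scale (a * b) v.
Proof. by rewrite /bimK_scale rmorphM bilM. Qed.
Fact bimK_scale1 : left_id 1 bimK_scale.
Proof. by move=> v; rewrite /bimK_scale rmorph1 bil1. Qed.
Fact bimK_scaleDr : right_distributive bimK_scale +%R.
Proof. by move=> a v w; exact: bilDr. Qed.
Fact bimK_scaleDl v : {morph bimK_scale^~ v : a b / a + b}.
Proof. by move=> a b; rewrite /bimK_scale rmorphD bilDl. Qed.
HB.instance Definition _ := GRing.Zmodule_isLmodule.Build K bimK
  bimK_scaleA bimK_scale1 bimK_scaleDr bimK_scaleDl.

Definition bim_act (u : envmon R) (x : bimK) : bimK := bil u.1 (bir (x : B) u.2).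
Let bilK a k (x : B) : bil a (bil (aunit R k) x) = bil (aunit R k) (bil a x).
Proof. by rewrite -!bilM aunitC. Qed.
Fact bim_act_linear u : linear (bim_act u).
Proof.
move=> k x y; change (bil u.1 (bir (bil (aunit R k) x + y : B) u.2) =
  bil (aunit R k) (bil u.1 (bir (x : B) u.2)) + bil u.1 (bir (y : B) u.2)).
by rewrite birDl bilDr bilr bilK.
Qed.
Fact bim_act1 x : bim_act 1%g x = x.
Proof. by rewrite /bim_act /= bil1 bir1. Qed.
Fact bim_actM u v x : bim_act (u * v)%g x = bim_act u (bim_act v x).
Proof. by rewrite /bim_act /= bilM birM bilr. Qed.
Definition bim_rep : linrep K (envmon R) :=
  @LinRep K (envmon R) bimK bim_act bim_act_linear bim_act1 bim_actM.

Lemma bim_repE a b (x : repmod bim_rep) :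
  tens0 a b *: x = bil a (bir (x : B) b) :> B.
Proof.
have := repmod_scaleU 1 ((a, b) : envmon R) x; rewrite scale1r; apply.
Qed.

Lemma bim_repK k (y : monoid_algebra K (envmon R)) (x : repmod bim_rep) :
  (aunit (monoid_algebra K (envmon R)) k * y) *: x = bil (aunit R k) (y *: x : B) :> B.
Proof.
rewrite -scalerA.
have := repmod_scaleU k (1%g : envmon R) (y *: x); rewrite rep1; apply.
Qed.

Fact bim_rep_rel p : env_rel p -> forall x : repmod bim_rep, p *: x = 0.
Proof.
case=> [a a' b|a b b'|k a b|k a b] x; rewrite scalerBl; apply/eqP;
  rewrite subr_eq0; apply/eqP; rewrite ?scalerDl ?bim_repK !bim_repE.
- by rewrite bilDl.
- by rewrite birDr bilDr.
- by rewrite bilM.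
- by rewrite birM -biK bilr bilK.
Qed.

Definition env_mod : lmodType (env R) := quotring_mod bim_rep_rel.

Lemma env_modE a b (x : env_mod) : tens a b *: x = bil a (bir (x : B) b) :> B.
Proof.
have := quotring_scale_pi (PV := bim_rep_rel) (tens0 a b) x.
by rewrite (bim_repE a b x); apply.
Qed.

End BimoduleEnv.

Section RegularBimodule.
Variables (K : fieldType) (R : algebra K).
Definition regular_bimodule : bimodule R :=
  @Bimodule K R R (fun a x => a * x) (fun x a => x * a)
    (fun a b x => mulrDl a b x) (fun a x y => mulrDr a x y)
    (fun x y a => mulrDl x y a) (fun x a b => mulrDr x a b)
    (@mul1r R) (@mulr1 R) (fun a b x => esym (mulrA a b x))
    (fun x a b => mulrA x a b) (fun a x b => esym (mulrA a x b)) (@aunitC K R).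

Definition hochschild (n : nat) (M : lmodType (env R)) : lmodType K :=
  Ext n (env_mod regular_bimodule) M.
End RegularBimodule.

Section BimoduleRestriction.
Variables (K : fieldType) (A R : algebra K) (iota : {rmorphism A -> R}).
Hypothesis iotaK : forall k, iota (aunit A k) = aunit R k.
Variable M : lmodType (env R).

Definition restr_l (a : A) (x : M) : M := tens (iota a) 1 *: x.
Definition restr_r (x : M) (a : A) : M := tens 1 (iota a) *: x.

Lemma restr_lr a x b : restr_l a (restr_r x b) = tens (iota a) (iota b) *: x.
Proof. by rewrite /restr_l /restr_r scalerA tensM !mulr1. Qed.

Program Definition restr_bimodule : bimodule A :=
  @Bimodule K A M restr_l restr_r _ _ _ _ _ _ _ _ _ _.
Next Obligation. by rewrite /restr_l rmorphD tensDl scalerDl. Qed.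
Next Obligation. by rewrite /restr_l scalerDr. Qed.
Next Obligation. by rewrite /restr_r scalerDr. Qed.
Next Obligation. by rewrite /restr_r rmorphD tensDr scalerDl. Qed.
Next Obligation. by rewrite /restr_l rmorph1 tens1 scale1r. Qed.
Next Obligation. by rewrite /restr_r rmorph1 tens1 scale1r. Qed.
Next Obligation. by rewrite /restr_l scalerA tensM rmorphM mulr1. Qed.
Next Obligation. by rewrite /restr_r scalerA tensM rmorphM mulr1. Qed.
Next Obligation. by rewrite /restr_l /restr_r !scalerA !tensM !mul1r !mulr1. Qed.
Next Obligation.
rewrite /restr_l /restr_r iotaK -[aunit R k]mulr1.
by rewrite tensKl tensKr.
Qed.
End BimoduleRestriction.

(* Inverse monoids: sinv s is the unique t with s t s = s and t s t = t. *)
HB.mixin Record isInverseMonoid S of Monoid S := {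
  sinv : S -> S;
  sinvP : forall s t : S,
    t = sinv s <-> (s * t * s = s)%g /\ (t * s * t = t)%g
}.
#[short(type="inverseMonoidType")]
HB.structure Definition InverseMonoid := {S of isInverseMonoid S & Monoid S}.

Section InverseMonoidTheory.
Variable S : inverseMonoidType.
Implicit Types s t e f : S.
Local Open Scope group_scope.
Local Notation "x ^-1" := (sinv x) : group_scope.

Definition idem (e : S) : bool := e * e == e.

Definition nat_le (s t : S) : Prop := exists2 e, idem e & s = e * t.

Lemma mulsVs s : s * s^-1 * s = s.
Proof. by have [/(_ erefl) []] := sinvP s s^-1. Qed.
Lemma mulVsV s : s^-1 * s * s^-1 = s^-1.
Proof. by have [/(_ erefl) []] := sinvP s s^-1. Qed.
Lemma sinv_eq s t : s * t * s = s -> t * s * t = t -> t = s^-1.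
Proof. by move=> h1 h2; apply/sinvP. Qed.
Lemma sinvK s : s^-1^-1 = s.
Proof. by apply/esym/sinv_eq; [exact: mulVsV|exact: mulsVs]. Qed.
Lemma idemE e : idem e -> e * e = e. Proof. by move/eqP. Qed.
Lemma idemV e : idem e -> e^-1 = e.
Proof. by move/idemE=> ee; apply/esym/sinv_eq; rewrite ee. Qed.
Lemma sinv1 : 1^-1 = 1 :> S.
Proof. by apply/esym/sinv_eq; rewrite !mulg1. Qed.
Lemma idem_mulsV s : idem (s * s^-1).
Proof. by apply/eqP; rewrite mulgA mulsVs. Qed.
Lemma idem_mulVs s : idem (s^-1 * s).
Proof. by apply/eqP; rewrite mulgA mulVsV. Qed.

Lemma idemM e f : idem e -> idem f -> idem (e * f).
Proof.
move=> /idemE ee /idemE ff; set x := (e * f)^-1.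
have xE : f * x * e = x.
  apply: sinv_eq.
    have -> : e * f * (f * x * e) * (e * f) = e * (f * f) * x * (e * e) * f.
      by rewrite !mulgA.
    by rewrite ee ff -(mulgA _ e f) mulsVs.
  have -> : f * x * e * (e * f) * (f * x * e) =
      f * (x * ((e * e) * (f * f)) * x) * e by rewrite !mulgA.
  by rewrite ee ff mulVsV.
have xx : idem x.
  apply/eqP; rewrite -{1 2}xE.
  have -> : f * x * e * (f * x * e) = f * (x * (e * f) * x) * e.
    by rewrite !mulgA.
  by rewrite mulVsV xE.
by rewrite -[e * f]sinvK -/x (idemV xx).
Qed.

Lemma idemC e f : idem e -> idem f -> e * f = f * e.
Proof.
move=> ie if_; have /idemE efef := idemM ie if_.
have /idemE fefe := idemM if_ ie.
have fe : f * e = (e * f)^-1.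
  apply: sinv_eq.
    have -> : e * f * (f * e) * (e * f) = e * (f * f) * (e * e) * f.
      by rewrite !mulgA.
    by rewrite !idemE // -(mulgA _ e f) efef.
  have -> : f * e * (e * f) * (f * e) = f * (e * e) * (f * f) * e.
    by rewrite !mulgA.
  by rewrite !idemE // -(mulgA _ f e) fefe.
by rewrite fe (idemV (idemM ie if_)).
Qed.

Lemma sinvM s t : (s * t)^-1 = t^-1 * s^-1.
Proof.
have C := idemC (idem_mulsV t) (idem_mulVs s).
apply/esym/sinv_eq.
  have -> : s * t * (t^-1 * s^-1) * (s * t) = s * ((t * t^-1) * (s^-1 * s)) * t.
    by rewrite !mulgA.
  by rewrite C !mulgA mulsVs -!mulgA (mulgA t) mulsVs.
have -> : t^-1 * s^-1 * (s * t) * (t^-1 * s^-1) =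
    t^-1 * ((s^-1 * s) * (t * t^-1)) * s^-1 by rewrite !mulgA.
by rewrite -C !mulgA mulVsV -!mulgA (mulgA s^-1) mulVsV.
Qed.

Lemma idem_conj s e : idem e -> idem (s * e * s^-1).
Proof.
move=> ie; apply/eqP.
have -> : s * e * s^-1 * (s * e * s^-1) = s * (e * (s^-1 * s)) * e * s^-1.
  by rewrite !mulgA.
by rewrite (idemC ie (idem_mulVs s)) !mulgA mulsVs -(mulgA s) idemE.
Qed.

Definition idempotents : predArgType := {e : S | idem e}.
HB.instance Definition _ := [isSub of idempotents for @sval S idem].
HB.instance Definition _ := [Choice of idempotents by <:].

Definition idem_act s (e : idempotents) : idempotents :=
  Sub (s * val e * s^-1) (idem_conj s (valP e)).

Lemma idem_act1 (e : idempotents) : idem_act 1 e = e.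
Proof. by apply: val_inj; rewrite /= sinv1 mul1g mulg1. Qed.
Lemma idem_actM s t (e : idempotents) : idem_act (s * t) e = idem_act s (idem_act t e).
Proof. by apply: val_inj; rewrite /= sinvM !mulgA. Qed.
End InverseMonoidTheory.

Section Cohomology.
Variables (K : fieldType) (S : inverseMonoidType).

Local Notation KE0 := {malg K[idempotents S]}.

Definition KE_act (s : S) (x : KE0) : KE0 :=
  msum (fun e k => << k *g idem_act s e >>) x.

Let KE_fD s (e : idempotents S) a b :
  << a + b *g idem_act s e >> = << a *g idem_act s e >> + << b *g idem_act s e >>
  :> KE0.
Proof. exact: monalgUD. Qed.
Let KE_actU s a e : KE_act s << a *g e >> = << a *g idem_act s e >>.
Proof. exact: (msumU (KE_fD s)). Qed.
Let KE_actD s x y : KE_act s (x + y) = KE_act s x + KE_act s y.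
Proof. exact: (msumD (KE_fD s)). Qed.
Let KE_act0 s : KE_act s 0 = 0.
Proof. exact: (msum0 (KE_fD s)). Qed.
Let malgZU k a (f : idempotents S) : k *: << a *g f >> = << k * a *g f >> :> KE0.
Proof. by apply/malgP => f'; rewrite mcoeffZ !mcoeffU mulrnAr. Qed.
Let KE_actZ s k x : KE_act s (k *: x) = k *: KE_act s x.
Proof.
elim/malg_ind: x => [|g h IH IH'|a e]; first by rewrite scaler0 KE_act0 scaler0.
  by rewrite scalerDr !KE_actD IH IH' scalerDr.
by rewrite malgZU !KE_actU malgZU.
Qed.
Fact KE_act_linear s : linear (KE_act s).
Proof. by move=> k x y; rewrite KE_actD KE_actZ. Qed.

Fact KE_act1 x : KE_act 1%g x = x.
Proof.
elim/malg_ind: x => [|g h IH IH'|a e]; first exact: KE_act0.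
  by rewrite KE_actD IH IH'.
by rewrite KE_actU idem_act1.
Qed.
Fact KE_actM s t x : KE_act (s * t)%g x = KE_act s (KE_act t x).
Proof.
elim/malg_ind: x => [|g h IH IH'|a e]; first by rewrite !KE_act0.
  by rewrite !KE_actD IH IH'.
by rewrite !KE_actU idem_actM.
Qed.

Definition KE_rep : linrep K S :=
  @LinRep K S {malg K[idempotents S]} KE_act KE_act_linear KE_act1 KE_actM.

Definition KE : lmodType (monoid_algebra K S) := repmod KE_rep.

Definition imonoid_cohomology (n : nat) (V : lmodType (monoid_algebra K S)) : lmodType K :=
  Ext n KE V.

End Cohomology.

(* The symmetric inverse monoid: bijections between subsets of A, seen as
   injective partial maps. *)
Record pbij (A : Type) := PBij {
  pfun_of :> A -> option A;
  pbij_inj : forall x y z, pfun_of x = Some z -> pfun_of y = Some z -> x = y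
}.

Section SymmetricInverseMonoid.
Variable A : Type.

Fact pbij_id_inj (x y z : A) : Some x = Some z -> Some y = Some z -> x = y.
Proof. by move=> [->] [->]. Qed.
Definition pbij_id : pbij A := PBij pbij_id_inj.

Fact pbij_comp_inj (f g : pbij A) (x y z : A) :
  obind f (g x) = Some z -> obind f (g y) = Some z -> x = y.
Proof.
case gx: (g x) => [u|] //= fu; case gy: (g y) => [v|] //= fv.
by apply: (pbij_inj gx); rewrite gy (pbij_inj fu fv).
Qed.
Definition pbij_comp (f g : pbij A) : pbij A :=
  @PBij A (fun x => obind f (g x)) (@pbij_comp_inj f g).

Definition pdom (f : pbij A) (x : A) : Prop := exists y, f x = Some y.
Definition pran (f : pbij A) (y : A) : Prop := exists x, f x = Some y.
End SymmetricInverseMonoid.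

Record unital_action (K : fieldType) (S : inverseMonoidType) (A : algebra K) :=
    UnitalAction {
  ua_map :> S -> pbij A;
  ua_mul : forall s t, ua_map (s * t)%g = pbij_comp (ua_map s) (ua_map t);
  ua_one : ua_map 1%g = pbij_id A;
  ua_dom : forall s, is_ideal (pdom (ua_map s));
  ua_ran : forall s, is_ideal (pran (ua_map s));
  ua_morD : forall s a b a' b', ua_map s a = Some a' -> ua_map s b = Some b' ->
    ua_map s (a + b) = Some (a' + b');
  ua_morM : forall s a b a' b', ua_map s a = Some a' -> ua_map s b = Some b' ->
    ua_map s (a * b) = Some (a' * b');
  ua_morK : forall s k a a', ua_map s a = Some a' ->
    ua_map s (aunit A k * a) = Some (aunit A k * a');
  (* 1_s, uniquely determined by the range of theta_s *)
  ua_e : S -> A;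
  ua_e_idem : forall s, ua_e s * ua_e s = ua_e s;
  ua_e_central : forall s a, ua_e s * a = a * ua_e s;
  ua_e_ran : forall s a, pran (ua_map s) a <-> exists b, a = ua_e s * b
}.

Section Action.
Variables (K : fieldType) (S : inverseMonoidType) (A : algebra K).
Variable theta : unital_action S A.
Local Notation e := (ua_e theta).

(* s . a = theta_s (1_{s^-1} a) *)
Definition ua_act (s : S) (a : A) : A := odflt 0 (theta s (e (sinv s) * a)).

Lemma ua_inv s x y : theta s x = Some y -> theta (sinv s) y = Some x.
Proof.
move=> h; have := ua_mul theta (s * sinv s)%g s; rewrite mulsVs ua_mul => E.
have /= := congr1 (fun f : pbij A => f x) E; rewrite h /=.
case h1: (theta (sinv s) y) => [z|] //= /esym h2.
by rewrite (pbij_inj h h2).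
Qed.

Lemma ua_ran_fix s y : pran (theta s) y <-> e s * y = y.
Proof.
rewrite ua_e_ran; split=> [[b ->]|<-]; first by rewrite mulrA ua_e_idem.
by exists y.
Qed.

Lemma ua_dom_fix s x : pdom (theta s) x <-> e (sinv s) * x = x.
Proof.
rewrite -ua_ran_fix; split=> -[y] h; exists y; first exact: ua_inv.
by have := ua_inv h; rewrite sinvK.
Qed.

Lemma ua_actP s a : theta s (e (sinv s) * a) = Some (ua_act s a).
Proof.
have [|y h] := (ua_dom_fix s (e (sinv s) * a)).2.
  by rewrite mulrA ua_e_idem.
by rewrite /ua_act h.
Qed.

Lemma ua_actE s x y : theta s x = Some y -> ua_act s x = y.
Proof.
move=> h; have /ua_dom_fix hx : pdom (theta s) x by exists y.
by have := ua_actP s x; rewrite hx h => -[].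
Qed.

Lemma ua_act_inran s a : e s * ua_act s a = ua_act s a.
Proof. by apply/ua_ran_fix; exists (e (sinv s) * a); exact: ua_actP. Qed.

Lemma ua_actD s a b : ua_act s (a + b) = ua_act s a + ua_act s b.
Proof.
have := ua_morD (ua_actP s a) (ua_actP s b); rewrite -mulrDr ua_actP.
by case.
Qed.

Lemma ua_actM s a b : ua_act s (a * b) = ua_act s a * ua_act s b.
Proof.
have := ua_morM (ua_actP s a) (ua_actP s b).
have -> : e (sinv s) * a * (e (sinv s) * b) = e (sinv s) * (a * b).
  by rewrite -mulrA (mulrA a) -ua_e_central !mulrA ua_e_idem.
by rewrite ua_actP; case.
Qed.

Lemma ua_actK s k a : ua_act s (aunit A k * a) = aunit A k * ua_act s a.
Proof.
have := ua_morK k (ua_actP s a).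
by rewrite mulrA aunitC -mulrA ua_actP; case.
Qed.

Lemma ua_act_one s : ua_act s 1 = e s.
Proof.
have [x hx] : pran (theta s) (e s) by apply/ua_ran_fix; exact: ua_e_idem.
have xE := ua_actE hx.
rewrite -[LHS]ua_act_inran ua_e_central -{1}xE -ua_actM mul1r.
by [].
Qed.

Lemma ua_e1 : e 1%g = 1.
Proof.
have /ua_ran_fix : pran (theta 1%g) 1 by exists 1; rewrite ua_one.
by rewrite mulr1.
Qed.

Lemma ua_act1 a : ua_act 1%g a = a.
Proof. by apply: ua_actE; rewrite ua_one. Qed.

Lemma ua_act_act s t a : ua_act (s * t)%g a = ua_act s (ua_act t a).
Proof.
set f := e (sinv (s * t)%g).
have main b : ua_act (s * t)%g b = ua_act s (ua_act t f) * ua_act s (ua_act t b).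
  have := ua_actP (s * t)%g b; rewrite ua_mul /= -/f.
  case h: (theta t (f * b)) => [z|] //= /ua_actE <-.
  by rewrite -(ua_actE h) !ua_actM.
have fix_ : e (s * t)%g * ua_act s (ua_act t a) = ua_act s (ua_act t a).
  apply/ua_ran_fix.
  have [v hv] : pran (theta t) (e (sinv s) * ua_act t a).
    by apply/ua_ran_fix; rewrite mulrA ua_e_central -mulrA ua_act_inran.
  by exists v; rewrite ua_mul /= hv /= ua_actP.
rewrite main -!ua_actM; move: fix_.
by rewrite -(ua_act_one (s * t)%g) main -!ua_actM mulr1.
Qed.

Lemma ua_act_inv s a : ua_act s (ua_act (sinv s) a) = e s * a.
Proof.
by apply: ua_actE; have := ua_inv (ua_actP (sinv s) a); rewrite sinvK.
Qed.

End Action.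

Section CrossedProduct.
Variables (K : fieldType) (S : inverseMonoidType) (A : algebra K).
Variable theta : unital_action S A.
Local Notation e := (ua_e theta).
Local Notation act := (ua_act theta).
Local Notation mulL := (@skew_mul S A act).

Definition in_eA (s : S) (a : A) : Prop := exists b, a = e s * b.

Lemma in_eAP s a : in_eA s a <-> e s * a = a.
Proof.
split=> [[b ->]|<-]; first by rewrite mulrA ua_e_idem.
by exists a.
Qed.

(* L(A, theta, S): formal sums of  a delta_s  with  a \in 1_s A *)
Definition inL (g : {malg A[S]}) : bool := `[< forall s, in_eA s (g@_s) >].

Definition Lalg : predArgType := {g : {malg A[S]} | inL g}.
HB.instance Definition _ := [isSub of Lalg for @sval {malg A[S]} inL].
HB.instance Definition _ := [Choice of Lalg by <:].

Fact inL_zmod : zmod_closed inL.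
Proof.
split=> [|g h /asboolP gL /asboolP hL]; apply/asboolP => s; apply/in_eAP.
  by rewrite mcoeff0 mulr0.
by rewrite mcoeffB mulrBr ((in_eAP _ _).1 (gL s)) ((in_eAP _ _).1 (hL s)).
Qed.
HB.instance Definition _ := GRing.isZmodClosed.Build {malg A[S]} inL inL_zmod.
HB.instance Definition _ := [SubChoice_isSubZmodule of Lalg by <:].

Lemma inL0 : inL 0. Proof. by case: inL_zmod. Qed.
Lemma inLD g h : inL g -> inL h -> inL (g + h).
Proof.
case: inL_zmod => L0 LB gL hL; rewrite -[h]opprK -[- h]sub0r.
by apply: (LB) => //; apply: (LB).
Qed.

Lemma inLU a s : in_eA s a -> inL << a *g s >>.
Proof.
move=> /in_eAP h; apply/asboolP => t; apply/in_eAP; rewrite mcoeffU.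
by case: eqP => [<-|_]; rewrite ?mulr1n ?mulr0n ?mulr0.
Qed.

Lemma in_eA_mul s t a b : in_eA s a -> in_eA t b ->
  in_eA (s * t)%g (a * act s b).
Proof.
move=> _ /in_eAP tb; apply/in_eAP.
rewrite mulrA ua_e_central -mulrA; congr (_ * _).
by rewrite -{2}tb ua_actM -!ua_act_one ua_act_act.
Qed.

Lemma inL_mul g h : inL g -> inL h -> inL (mulL g h).
Proof.
move=> /asboolP gL /asboolP hL; rewrite /skew_mul /msum.
apply: (big_ind (fun x => inL x)) => [|x y|s _]; [exact: inL0|exact: inLD|].
apply: (big_ind (fun x => inL x)) => [|x y|t _]; [exact: inL0|exact: inLD|].
exact/inLU/in_eA_mul.
Qed.

Let aD := @ua_actD K S A theta.
Let aM := @ua_actM K S A theta.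
Let aA := @ua_act_act K S A theta.

Definition L_mul (x y : Lalg) : Lalg := Sub (mulL (val x) (val y))
  (inL_mul (valP x) (valP y)).

Fact L_one_in : inL << 1 *g 1%g >>.
Proof. by apply: inLU; exists 1; rewrite ua_e1 mulr1. Qed.
Definition L_one : Lalg := Sub << 1 *g 1%g >> L_one_in.

Fact L_mulA : associative L_mul.
Proof. by move=> x y z; apply: val_inj; apply: skew_mulA. Qed.
Fact L_mulDl : left_distributive L_mul +%R.
Proof. by move=> x y z; apply: val_inj; apply: skew_mulDl. Qed.
Fact L_mulDr : right_distributive L_mul +%R.
Proof. by move=> x y z; apply: val_inj; apply: skew_mulDr. Qed.

Let mulL_unit_l a g :
  mulL << a *g 1%g >> g = msum (fun t b => << a * b *g t >>) g.
Proof.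
by rewrite skew_mulUl //; apply: msum_ext => t b; rewrite ua_act1 mul1g.
Qed.

Let mulL_unit_r a g (gL : inL g) :
  (forall s, act s a = e s * a) ->
  mulL g << a *g 1%g >> = msum (fun t b => << b * a *g t >>) g.
Proof.
move=> ha; apply: eq_bigr => s _; rewrite msumU; last first.
  by move=> t x y; rewrite aD mulrDr monalgUD.
rewrite mulg1 ha mulrA -ua_e_central.
by have /asboolP/(_ s)/in_eAP -> := gL.
Qed.

Fact L_mul1 : left_id L_one L_mul.
Proof.
move=> x; apply: val_inj => /=; rewrite mulL_unit_l [RHS]monalgE.
by apply: eq_bigr => s _; rewrite mul1r.
Qed.
Fact L_1mul : right_id L_one L_mul.
Proof.
move=> x; apply: val_inj => /=; rewrite mulL_unit_r ?(valP x) //; last first.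
  by move=> s; rewrite ua_act_one mulr1.
by rewrite [RHS]monalgE; apply: eq_bigr => s _; rewrite mulr1.
Qed.
HB.instance Definition _ := GRing.Zmodule_isPzRing.Build Lalg
  L_mulA L_mul1 L_1mul L_mulDl L_mulDr.

Fact in_eA1 a : in_eA 1%g a.
Proof. by exists a; rewrite ua_e1 mul1r. Qed.
Definition L_inj (a : A) : Lalg := Sub << a *g 1%g >> (inLU (in_eA1 a)).
Fact L_inj_zmod : zmod_morphism L_inj.
Proof. by move=> a b; apply: val_inj; rewrite raddfB /= monalgUB. Qed.
Fact L_inj_monoid : monoid_morphism L_inj.
Proof.
split=> [|a b]; apply: val_inj => //=.
by rewrite skew_mulUU // ua_act1 mulg1.
Qed.
HB.instance Definition _ := GRing.isZmodMorphism.Build A Lalg L_inj L_inj_zmod.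
HB.instance Definition _ :=
  GRing.isMonoidMorphism.Build A Lalg L_inj L_inj_monoid.

Definition L_unit : {rmorphism K -> Lalg} := (L_inj \o aunit A : {rmorphism K -> Lalg}).
Fact L_unitC k (x : Lalg) : L_unit k * x = x * L_unit k.
Proof.
apply: val_inj => /=; rewrite mulL_unit_l mulL_unit_r ?(valP x) //; last first.
  by move=> s; rewrite -[aunit A k]mulr1 ua_actK ua_act_one mulr1 aunitC.
by apply: msum_ext => s a; rewrite aunitC.
Qed.
Definition L_algebra : algebra K := Algebra L_unitC.

(* generators  a delta_s - a delta_t  (s <= t, a \in 1_s A)  of the ideal N *)
Definition N_gen (x : L_algebra) : Prop :=
  exists s t a, [/\ nat_le s t, in_eA s a &
    val (x : Lalg) = << a *g s >> - << a *g t >>].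

Definition crossed : algebra K := quotalg N_gen.

Lemma e_in_eA s a : in_eA s (e s * a). Proof. by exists a. Qed.

(* the class of  (1_s a) delta_s; equal to that of  a delta_s  if a is in 1_s A *)
Definition cdelta (s : S) (a : A) : crossed :=
  rpi N_gen (Sub << e s * a *g s >> (inLU (e_in_eA s a)) : Lalg).

Lemma ua_e_mul s t : e s * e (s * t)%g = e (s * t)%g.
Proof.
by rewrite -(ua_act_one theta (s * t)%g) ua_act_act ua_act_inran.
Qed.

Lemma cdeltaM s t a b : cdelta s a * cdelta t b = cdelta (s * t)%g (a * act s b).
Proof.
rewrite -[LHS](rmorphM (rpi N_gen)); congr (rpi _ _); apply: val_inj.
rewrite /= skew_mulUU //; congr (<< _ *g _ >>).
rewrite ua_actM -(ua_act_one theta t) -ua_act_act ua_act_one.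
rewrite -mulrA (mulrA a) -(ua_e_central theta _ a) -!mulrA !mulrA.
congr (_ * _ * _).
by rewrite -ua_e_mul mulrA ua_e_idem.
Qed.

Lemma cdelta1M s t : cdelta s 1 * cdelta t 1 = cdelta (s * t)%g 1.
Proof.
rewrite cdeltaM mul1r ua_act_one; congr (rpi _ _); apply: val_inj.
by rewrite /= mulr1 ua_e_central ua_e_mul.
Qed.

Lemma cdelta11 : cdelta 1%g 1 = 1.
Proof.
by congr (rpi _ _); apply: val_inj; rewrite /= ua_e1 mul1r.
Qed.

Lemma cdelta_proj s a : cdelta s (e s * a) = cdelta s a.
Proof. by congr (rpi _ _); apply: val_inj; rewrite /= mulrA ua_e_idem. Qed.

Definition ciota : {rmorphism A -> crossed} :=
  (rpi N_gen \o L_inj : {rmorphism A -> crossed}).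

Lemma ciotaE a : ciota a = cdelta 1%g a.
Proof. by congr (rpi _ _); apply: val_inj; rewrite /= ua_e1 mul1r. Qed.

Lemma ciotaK k : ciota (aunit A k) = aunit crossed k.
Proof. by []. Qed.

Lemma cdelta_iota_l s b :
  cdelta s 1 * ciota (act (sinv s) b) = ciota b * cdelta s 1.
Proof.
rewrite !ciotaE !cdeltaM mulg1 mul1g mul1r ua_act1 mulr1 ua_act_inv.
exact: cdelta_proj.
Qed.

Lemma cdelta_iota_r s c :
  ciota (act (sinv s) c) * cdelta (sinv s) 1 = cdelta (sinv s) 1 * ciota c.
Proof. by rewrite !ciotaE !cdeltaM mulg1 mul1g mul1r ua_act1 mulr1. Qed.

End CrossedProduct.

Section EnvLinear.
Variables (K : fieldType) (R : algebra K).

Lemma env_mod_linear (B B' : bimodule R) (f : B -> B') :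
  (forall x y, f (x + y) = f x + f y) ->
  (forall a x b, f (bil a (bir x b)) = bil a (bir (f x) b)) ->
  linear (f : env_mod B -> env_mod B').
Proof.
move=> fD fbi u x y.
have f0 : f 0 = 0 by apply: (addrI (f 0)); rewrite -fD !addr0.
rewrite [LHS]fD; congr (_ + _).
elim/rpiP: u => u.
have q (C : bimodule R) (z : env_mod C) :
    (rpi (@env_rel K R) u : env R) *: z = (u : monoid_algebra K _) *: (z : repmod (bim_rep C)).
  exact: (quotring_scale_pi (PV := @bim_rep_rel K R C)).
rewrite !q; elim/malg_ind: u {q} => [|g h IH IH'|k [a b]].
- by rewrite !scale0r.
- by rewrite !scalerDl [LHS]fD IH IH'.
have q (C : bimodule R) (z : repmod (bim_rep C)) :
    (<< k *g ((a, b) : envmon R) >> : monoid_algebra K _) *: z =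
    bil (aunit R k * a) (bir (z : C) b) :> C.
  by rewrite bilM; exact: (repmod_scaleU k ((a, b) : envmon R) z).
by rewrite !q fbi.
Qed.

Lemma repmod_linear (G : monoidType) (V V' : linrep K G) (f : V -> V') :
  linear f -> (forall g x, f (rep g x) = rep g (f x)) ->
  linear (f : repmod V -> repmod V').
Proof.
move=> f_lin frep u x y.
have fD z z' : f (z + z') = f z + f z'.
  by have := f_lin 1 z z'; rewrite !scale1r.
have f0 : f 0 = 0 by apply: (addrI (f 0)); rewrite -fD !addr0.
have fZ k z : f (k *: z) = k *: f z.
  by have := f_lin k z 0; rewrite f0 !addr0.
rewrite [LHS]fD; congr (_ + _).
elim/malg_ind: u => [|g h IH IH'|k g].
- by rewrite !scale0r.
- by rewrite !scalerDl [LHS]fD IH IH'.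
have q (W : linrep K G) (z : repmod W) :
    (<< k *g g >> : monoid_algebra K G) *: z = k *: rep g (z : W) :> W.
  exact: repmod_scaleU.
by rewrite !q fZ frep.
Qed.

End EnvLinear.

Section T1.
Variables (K : fieldType) (S : inverseMonoidType) (A : algebra K).
Variable theta : unital_action S A.
Local Notation Lambda := (crossed theta).
Local Notation e := (ua_e theta).
Local Notation act := (ua_act theta).

Section Objects.
Variable M : lmodType (env Lambda).

Definition resA_bimodule : bimodule A :=
  restr_bimodule (ciotaK theta) M.
Definition Aenv : lmodType (env A) := env_mod (regular_bimodule A).
Definition resA : lmodType (env A) := env_mod resA_bimodule.

(* s . x = (1_s delta_s) x (1_{s^-1} delta_{s^-1}) *)
Definition S_act (s : S) (x : M) : M :=
  tens (cdelta theta s 1) (cdelta theta (sinv s) 1) *: x.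

Definition T1_space : lmodType K := homK Aenv resA.

Lemma resA_biE (b c : A) (x : M) :
  @bil _ _ resA_bimodule b (@bir _ _ resA_bimodule x c) =
  tens (ciota theta b) (ciota theta c) *: x.
Proof. exact: restr_lr. Qed.

Lemma resA_linear_bi (f : T1_space) (b : A) (a : Aenv) (c : A) :
  f (b * ((a : A) * c) : A) = tens (ciota theta b) (ciota theta c) *: (f a : M) :> M.
Proof.
have E1 := linearZ_LR (f : {linear Aenv -> resA}) (tens b c) a.
have E2 := @env_modE _ _ (regular_bimodule A) b c a.
have E3 := @env_modE _ _ resA_bimodule b c (f a).
apply: etrans (congr1 f (esym E2)) _; apply: etrans E1 _; apply: etrans E3 _.
exact: resA_biE.
Qed.

Lemma T1_linearD (f : T1_space) a b : f (a + b) = f a + f b.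
Proof. exact: (linearD (f : {linear Aenv -> resA})). Qed.

(* (s . f)(a) = s . f(s^-1 . a) *)
Definition T1_act_fun (s : S) (f : T1_space) (a : Aenv) : resA :=
  S_act s (f (act (sinv s) (a : A)) : M).

Fact T1_act_linear (s : S) (f : T1_space) : linear (T1_act_fun s f).
Proof.
apply: (@env_mod_linear _ _ (regular_bimodule A) resA_bimodule) => [x y|b x c].
    apply: etrans (congr1 (fun y => S_act s (f y : M)) (ua_actD theta _ x y)) _.
  apply: etrans (congr1 (S_act s) (T1_linearD f _ _)) _.
  exact: scalerDr.
rewrite /T1_act_fun [X in f X](_ : _ = act (sinv s) b * (act (sinv s) x * act (sinv s) c) :> A);
  last by rewrite !ua_actM.
apply: etrans (congr1 (S_act s) (resA_linear_bi f _ _ _)) _.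
apply: etrans (tens_scaleA _ _ _ _ _) _.
rewrite cdelta_iota_l cdelta_iota_r.
apply: esym; apply: etrans (resA_biE _ _ _) _.
exact: tens_scaleA.
Qed.

Definition T1_act (s : S) (f : T1_space) : T1_space := mk_linear (T1_act_linear s f).

Lemma S_act1 x : S_act 1%g x = x.
Proof. by rewrite /S_act sinv1 cdelta11 tens1 scale1r. Qed.
Lemma S_actM s t x : S_act (s * t)%g x = S_act s (S_act t x).
Proof.
apply: esym; apply: etrans (tens_scaleA _ _ _ _ _) _.
by rewrite !cdelta1M -sinvM.
Qed.

Fact T1_act1 f : T1_act 1%g f = f.
Proof.
apply: linear_ext => a; apply: etrans (S_act1 _) _.
by rewrite sinv1 ua_act1.
Qed.
Fact T1_actM s t f : T1_act (s * t)%g f = T1_act s (T1_act t f).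
Proof.
apply: linear_ext => a; apply: etrans (S_actM _ _ _) _.
apply: (congr1 (fun y => S_act s (S_act t (f y : M)))).
by rewrite sinvM ua_act_act.
Qed.
Lemma resA_K k (y : resA) : aunit (env A) k *: y = aunit (env Lambda) k *: (y : M) :> M.
Proof.
rewrite -!tens_aunit.
apply: etrans (congr1 (fun z => tens (aunit A k) 1 *: (z : resA)) _) _; first exact: erefl.
apply: etrans (env_modE (B := resA_bimodule) (aunit A k) 1 y) _.
apply: etrans (resA_biE _ _ _) _; rewrite rmorph1; congr (tens _ _ *: _).
Qed.

Fact T1_act_Klinear s : linear (T1_act s).
Proof.
move=> k f g; apply: linear_ext => a.
set y := (f (act (sinv s) (a : A)) : M); set z := (g (act (sinv s) (a : A)) : M).
apply: etrans (_ : S_act s (aunit (env Lambda) k *: y + z) = _).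
  by congr (S_act s (_ + _)); exact: resA_K.
apply: etrans (scalerDr _ _ _) _; apply: (congr1 (fun u => u + S_act s z)).
by apply: etrans (aunit_scaleC _ _ _) _; exact/esym/resA_K.
Qed.

Definition T1_rep : linrep K S :=
  @LinRep K S T1_space T1_act T1_act_Klinear T1_act1 T1_actM.

Definition T1_obj : lmodType (monoid_algebra K S) := repmod T1_rep.

End Objects.

Section Morphisms.
Variables (M N : lmodType (env Lambda)) (g : {linear M -> N}).

Fact resA_map_linear : linear (g : resA M -> resA N).
Proof.
apply: (@env_mod_linear _ _ (resA_bimodule M) (resA_bimodule N)) => [x y|b x c].
  exact: raddfD.
apply: etrans (congr1 g (resA_biE _ _ _)) _.
by apply: etrans (linearZ_LR _ _ _) _; exact/esym/resA_biE.
Qed.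

Definition T1_map_fun : T1_space M -> T1_space N :=
  homK_map (mk_linear resA_map_linear).

Fact T1_map_linear : linear (T1_map_fun : T1_obj M -> T1_obj N).
Proof.
apply: (@repmod_linear _ _ (T1_rep M) (T1_rep N)); first exact: homK_map_linear.
by move=> s f; apply: linear_ext => a; exact: linearZ_LR.
Qed.
Definition T1_map : {linear T1_obj M -> T1_obj N} := mk_linear T1_map_linear.
End Morphisms.

Fact T1_map_id (M : lmodType (env Lambda)) :
  T1_map (idfun : {linear M -> M}) =1 id.
Proof. by move=> f; apply: linear_ext. Qed.
Fact T1_map_comp (M N P : lmodType (env Lambda)) (f : {linear M -> N})
  (g : {linear N -> P}) : T1_map (g \o f : {linear M -> P}) =1 T1_map g \o T1_map f.
Proof. by move=> h; apply: linear_ext. Qed.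
Fact T1_mapD (M N : lmodType (env Lambda)) (f g : {linear M -> N}) :
  T1_map (f \+ g : {linear M -> N}) =1 T1_map f \+ T1_map g.
Proof. by move=> h; apply: linear_ext. Qed.

Definition T1 : mod_functor (env Lambda) (monoid_algebra K S) :=
  @ModFunctor (env Lambda) (monoid_algebra K S) T1_obj T1_map T1_map_id T1_map_comp T1_mapD.

End T1.
Arguments T1 {K S A} theta.

(* Cohomology spectral sequences E_r^{p,q} (r >= 2) concentrated in p, q >= 0.
   The differential d_r has bidegree (r, 1 - r). *)
Record spectral_sequence (K : fieldType) := SpectralSequence {
  ss_page :> nat -> int -> int -> lmodType K;
  ss_diff : forall r p q,
    {linear ss_page r p q -> ss_page r (p + r%:Z) (q - r%:Z + 1)};
  ss_diffK : forall r p q, (2 <= r)%N -> forall x,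
    ss_diff r (p + r%:Z) (q - r%:Z + 1) (ss_diff r p q x) = 0;
  (* E_{r+1} = H(E_r); every pair of integers is of the form (p + r, q - r + 1) *)
  ss_next : forall r p q, (2 <= r)%N ->
    lmod_iso (ss_page r.+1 (p + r%:Z) (q - r%:Z + 1))
      (homology (ss_diff r p q) (ss_diff r (p + r%:Z) (q - r%:Z + 1)));
  ss_quadrant : forall r p q, (2 <= r)%N -> (p < 0) || (q < 0) ->
    lmod_trivial (ss_page r p q)
}.

(* E_oo^{p,q}: for r >= p + q + 2 the differentials d_r from and to position
   (p, q) vanish, so the pages are constant at that position. *)
Definition ss_infty (K : fieldType) (E : spectral_sequence K) (p q : nat) :
  lmodType K := E (p + q).+2 p q.

(* E_2^{p,q} => H^{p+q}:  H^n = F^0 >= F^1 >= ... >= F^{n+1} = 0  with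
   F^p / F^{p+1} = E_oo^{p,n-p} *)
Definition converges_to (K : fieldType) (E : spectral_sequence K)
    (H : nat -> lmodType K) : Prop :=
  forall n : nat, exists F : nat -> submodule (H n),
    [/\ forall x, F 0%N x, forall p x, F p.+1 x -> F p x,
        forall x, F n.+1 x -> x = 0 &
        forall p q, (p + q)%N = n ->
          lmod_iso (ss_infty E p q) (subquot (F p) (F p.+1))].

(* Main.v *)
(* For a cochain complex C of injective modules over a K-algebra B and a B-module
   N with free resolution F, filter the total complex of Hom(F_p, C^q) by p.  Since
   the F_p are projective, E_2 = Ext^p(N, H^q C); since the C^q are injective, the
   total complex computes H^n(Hom(N, C)).  The theorem is the case B = KS,
   N = KE(S), C = T1(I), with I the standard injective resolution of M.

   Two facts are specific to crossed products.  First, T1 maps a coinduced module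
   to an injective one: KS-linear maps from X to T1(coind W) correspond to bilinear
   maps psi : X x Lambda -> W with psi(e x, y) = psi(x, 1_e y), and these extend
   along X <= Y because KE(S) is generated by commuting idempotents (it is von
   Neumann regular, so its modules are flat).  Second, both Hom(Lambda, M) over
   Lambda^e and Hom(KE(S), T1 M) over KS are the space of x in M commuting with
   Lambda. *)
From HB Require Import structures.
Require Import Defs.
From mathcomp Require Import all_boot all_order all_algebra.
From mathcomp Require Import finmap boolp classical_sets monalg zify.

Set Implicit Arguments.
Unset Strict Implicit.
Unset Printing Implicit Defensive.

Import GRing.Theory Num.Theory Order.TTheory.
Local Open Scope ring_scope.

(** * Subquotients and linear relations *)

(** [Ext] is defined by injective resolutions of its second argument, while the filtration by p
    needs projectives in the first. Balancing reconciles the two, and one lemma on double complexes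
    with exact rows, [edge_cohomology], serves both for it (on the transposed complex) and for the
    abutment. Resolving only KE(S), and not the complex T1(I), avoids Cartan-Eilenberg resolutions.
    The obstacle in extending psi is that S may have infinitely many idempotents. One idempotent is
    handled by an explicit projection, finitely many by composing such commuting projections, but an
    infinite composite makes no sense. The conditions on psi are therefore written as linear
    equations for a map on a free vector space, and solvability for every finite set of idempotents
    is shown to suffice. Tensor products over KE(S) are never formed; only bilinear maps occur.
    Isomorphisms of subquotients are obtained from linear relations between representatives, since
    the natural correspondences (modulo higher filtration, or up to a coboundary) are not
    functions. *)

Section LinearRelations.
Variable R : pzRingType.

Lemma lin_combB (V : lmodType R) a (x y x' y' : V) :
  a *: x + y - (a *: x' + y') = a *: (x - x') + (y - y').
Proof. by rewrite scalerBr opprD addrACA. Qed.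

(** By linearity the condition on zeros gives uniqueness on both sides, so arbitrary choices of
    partners are linear and mutually inverse. *)
Lemma lmod_iso_of_relation (U V : lmodType R) (rel : U -> V -> Prop) :
  (forall a x y x' y', rel x x' -> rel y y' -> rel (a *: x + y) (a *: x' + y')) ->
  (forall x, exists x', rel x x') -> (forall x', exists x, rel x x') ->
  (forall x x', rel x x' -> (x = 0 <-> x' = 0)) -> lmod_iso U V.
Proof.
move=> rlin rtot rsurj r0.
have r_sub x x' y y' : rel x x' -> rel y y' -> rel (x - y) (x' - y').
  by move=> h h'; rewrite ![_ - _]addrC -!scaleN1r; apply: rlin.
pose f x := sval (cid (rtot x)); pose g x' := sval (cid (rsurj x')).
have fP x : rel x (f x) by exact: svalP (cid (rtot x)).
have gP x : rel (g x) x by exact: svalP (cid (rsurj x)).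
have uniq_r x x' y' : rel x x' -> rel x y' -> x' = y'.
  move=> h h'; apply/eqP; rewrite -subr_eq0; apply/eqP.
  by apply/(r0 _ _ (r_sub _ _ _ _ h h')); rewrite subrr.
have uniq_l x y x' : rel x x' -> rel y x' -> x = y.
  move=> h h'; apply/eqP; rewrite -subr_eq0; apply/eqP.
  by apply/(r0 _ _ (r_sub _ _ _ _ h h')); rewrite subrr.
have f_lin : linear f.
  by move=> a x y; apply: (uniq_r (a *: x + y)) => //; apply: rlin.
exists (mk_linear f_lin); exists g => x.
  by apply: (uniq_l _ _ (f x)).
by apply: (uniq_r (g x)).
Qed.

Lemma lmod_iso_sym (U V : lmodType R) : lmod_iso U V -> lmod_iso V U.
Proof.
move=> [f [g fK gK]]; apply: (@lmod_iso_of_relation _ _ (fun x y => f y = x)).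
- by move=> a x y x' y' <- <-; rewrite linearP.
- by move=> x; exists (g x).
- by move=> y; exists (f y).
- move=> x y <-; split=> [fy0|->]; last exact: raddf0.
  by rewrite -(fK y) fy0 -(raddf0 f) fK.
Qed.

Lemma lmod_iso_trans (U V W : lmodType R) :
  lmod_iso U V -> lmod_iso V W -> lmod_iso U W.
Proof.
move=> [f f_bij] [g g_bij]; exists (g \o f : {linear U -> W}).
exact: bij_comp.
Qed.

(* [cl] exhibits [Q] as [Z / (Z :&: B)]; its values outside [Z] are irrelevant. *)
Definition class_map (V Q : lmodType R) (Z B : V -> Prop) (cl : V -> Q) :=
  [/\ forall a x y, Z x -> Z y -> cl (a *: x + y) = a *: cl x + cl y,
      forall h, exists2 x, Z x & cl x = h &
      forall x, Z x -> (cl x = 0 <-> B x)].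

Definition is_subquot (V : lmodType R) (Z B : V -> Prop) (Q : lmodType R) :=
  exists cl : V -> Q, class_map Z B cl.

(** The junk value 0 outside [Z] makes this a total function, so classes can be written without
    membership proofs. *)
Definition subquot_class (V : lmodType R) (Z B : submodule V) (x : V) :
    subquot Z B :=
  if insub x is Some z then qpi (sub_preim Z B) (z : submod_type Z) else 0.

Lemma subquot_classP (V : lmodType R) (Z B : submodule V) :
  class_map Z B (subquot_class Z B).
Proof.
have clE x (Zx : Z x) : exists2 z : submod_type Z, val z = x &
    subquot_class Z B x = qpi (sub_preim Z B) z.
  have /spredP xZ := Zx.
  exists (Sub x xZ : submod_type Z); first exact: SubK.
  by rewrite /subquot_class insubT.
split=> [a x y Zx Zy|h|x Zx].
- have [u ux ->] := clE _ Zx; have [v vy ->] := clE _ Zy.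
  have Zxy : Z (a *: x + y) by apply: smemP.
  have [w wE ->] := clE _ Zxy.
  by rewrite -linearP; congr qpi; apply: val_inj; rewrite linearP /= wE ux vy.
- elim/qpiP: h => z; have Zz : Z (val z) by apply/spredP; exact: valP.
  exists (val z) => //; have [w wE ->] := clE _ Zz.
  by congr qpi; exact: val_inj.
- have [u <- ->] := clE _ Zx.
  have -> : (0 : subquot Z B) = qpi (sub_preim Z B) 0 by rewrite raddf0.
  by rewrite qpi_eq subr0.
Qed.

Lemma subquot_is_subquot (V : lmodType R) (Z B : submodule V) :
  is_subquot Z B (subquot Z B).
Proof. by exists (subquot_class Z B); exact: subquot_classP. Qed.

(** The equivalence of [B] and [B'] on related cycles gives at once well-definedness and injectivity
    in both directions, so [rel] may be many-to-many. *)
Lemma subquot_iso (V V' : lmodType R) (Z B : V -> Prop) (Z' B' : V' -> Prop)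
    (Q Q' : lmodType R) (rel : V -> V' -> Prop) :
  is_subquot Z B Q -> is_subquot Z' B' Q' ->
  (forall a x y, Z x -> Z y -> Z (a *: x + y)) ->
  (forall a x y, Z' x -> Z' y -> Z' (a *: x + y)) ->
  (forall a x y x' y', rel x x' -> rel y y' -> rel (a *: x + y) (a *: x' + y')) ->
  (forall x, Z x -> exists2 x', Z' x' & rel x x') ->
  (forall x', Z' x' -> exists2 x, Z x & rel x x') ->
  (forall x x', Z x -> Z' x' -> rel x x' -> (B x <-> B' x')) ->
  lmod_iso Q Q'.
Proof.
move=> [cl [cl_lin cl_surj cl0]] [cl' [cl_lin' cl_surj' cl0']] ZP ZP' rlin
  rtot rsurj rB.
apply: (@lmod_iso_of_relation _ _ (fun h h' =>
  exists x x', [/\ Z x, Z' x', rel x x', cl x = h & cl' x' = h'])).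
- move=> a _ _ _ _ [x [x' [Zx Zx' r <- <-]]] [y [y' [Zy Zy' s <- <-]]].
  exists (a *: x + y), (a *: x' + y'); rewrite cl_lin // cl_lin' //.
  by split=> //; [apply: ZP|apply: ZP'|apply: rlin].
- move=> h; have [x Zx <-] := cl_surj h; have [x' Zx' r] := rtot x Zx.
  by exists (cl' x'), x, x'.
- move=> h; have [x Zx <-] := cl_surj' h; have [x' Zx' r] := rsurj x Zx.
  by exists (cl x'), x', x.
- move=> _ _ [x [x' [Zx Zx' r <- <-]]]; rewrite cl0 // cl0' //.
  exact: rB.
Qed.

Lemma is_subquot_ext (V : lmodType R) (Z B Z' B' : V -> Prop) (Q : lmodType R) :
  (forall x, Z x <-> Z' x) -> (forall x, Z x -> (B x <-> B' x)) ->
  is_subquot Z B Q -> is_subquot Z' B' Q.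
Proof.
move=> ZZ' BB' [cl [cl_lin cl_surj cl0]]; exists cl; split=> [a x y||x].
- by move=> /ZZ' Zx /ZZ' Zy; exact: cl_lin.
- by move=> h; have [x /ZZ' Zx <-] := cl_surj h; exists x.
- by move=> /ZZ' Zx; rewrite cl0 // BB'.
Qed.

Lemma class_map_eq (V Q : lmodType R) (Z B : V -> Prop) (cl : V -> Q) x y :
  class_map Z B cl -> (forall a x y, Z x -> Z y -> Z (a *: x + y)) ->
  Z x -> Z y -> (cl x = cl y <-> B (x - y)).
Proof.
move=> [cl_lin _ cl0] ZP Zx Zy; have E : cl (x - y) = cl x - cl y.
  by rewrite addrC -scaleN1r cl_lin // scaleN1r addrC.
rewrite -cl0 ?E; last by rewrite addrC -scaleN1r; apply: ZP.
by split=> [->|/eqP]; rewrite ?subrr // subr_eq0 => /eqP.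
Qed.

Section SubquotMap.
Variables (V V' : lmodType R) (f : {linear V -> V'}).
Variables (Z B : submodule V) (Z' B' : submodule V').
Hypothesis fZ : forall x, Z x -> Z' (f x).
Hypothesis fB : forall x, Z x -> B x -> B' (f x).

Definition subquot_map_fun (h : subquot Z B) : subquot Z' B' :=
  subquot_class Z' B' (f (val (qrepr h))).

Let subquot_map_class x : Z x ->
  subquot_map_fun (subquot_class Z B x) = subquot_class Z' B' (f x).
Proof.
move=> Zx; rewrite /subquot_map_fun; set z := val _.
have Zz : Z z by apply/spredP; exact: valP.
apply/(class_map_eq (subquot_classP Z' B')); [exact: smemP|exact: fZ|exact: fZ|].
rewrite -raddfB; apply: fB.
  by rewrite addrC -scaleN1r; apply: smemP.
apply/(class_map_eq (subquot_classP Z B) _ Zz Zx); first exact: smemP.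
rewrite -[RHS]qreprK {1}/subquot_class insubT; first exact/spredP.
by move=> zZ; congr qpi; exact: val_inj.
Qed.

Fact subquot_map_linear : linear subquot_map_fun.
Proof.
have [cl_lin cl_surj _] := subquot_classP Z B.
have [cl_lin' _ _] := subquot_classP Z' B'.
move=> a h h'; have [x Zx <-] := cl_surj h; have [y Zy <-] := cl_surj h'.
rewrite -cl_lin // !subquot_map_class //; last exact: smemP.
by rewrite linearP cl_lin' //; apply: fZ.
Qed.

Definition subquot_map : {linear subquot Z B -> subquot Z' B'} :=
  mk_linear subquot_map_linear.

Lemma subquot_mapE x : Z x ->
  subquot_map (subquot_class Z B x) = subquot_class Z' B' (f x).
Proof. exact: subquot_map_class. Qed.
End SubquotMap.

Lemma homology_class (U V W : lmodType R) (f : {linear U -> V}) (g : {linear V -> W}) :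
  is_subquot (fun x => g x = 0) (fun x => exists u, f u = x) (homology f g).
Proof. exact: (subquot_is_subquot (ker_sub g) (im_sub f)). Qed.

(** Homology of a complex of subquotients, read off on representatives in the middle ambient space:
    this turns [E_(r+1) = H(E_r)] into a comparison of two subquotients of the filtered complex
    itself. *)
Lemma homology_is_subquot (U V W Q1 Q2 Q3 : lmodType R)
    (Z1 B1 : U -> Prop) (Z2 B2 : V -> Prop) (Z3 B3 : W -> Prop)
    (cl1 : U -> Q1) (cl2 : V -> Q2) (cl3 : W -> Q3) (f : U -> V) (g : V -> W)
    (phi : {linear Q1 -> Q2}) (psi : {linear Q2 -> Q3}) :
  class_map Z1 B1 cl1 -> class_map Z2 B2 cl2 -> class_map Z3 B3 cl3 ->
  (forall a x y, Z2 x -> Z2 y -> Z2 (a *: x + y)) ->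
  (forall x, Z1 x -> Z2 (f x)) -> (forall x, Z2 x -> Z3 (g x)) ->
  (forall x, Z1 x -> phi (cl1 x) = cl2 (f x)) ->
  (forall x, Z2 x -> psi (cl2 x) = cl3 (g x)) ->
  is_subquot (fun x => Z2 x /\ B3 (g x))
    (fun x => exists2 u, Z1 u & B2 (x - f u)) (homology phi psi).
Proof.
move=> [_ surj1 _] cm2 [_ _ cl30] Z2P fZ gZ phiE psiE.
have [cl2_lin surj2 _] := cm2.
have [cl [cl_lin cl_surj cl0]] := homology_class phi psi.
exists (cl \o cl2); split=> [a x y [Zx Bx] [Zy By]|h|x [Zx Bx]] /=.
- rewrite cl2_lin // cl_lin // psiE //; apply/cl30 => //; exact: gZ.
- have [q q0 <-] := cl_surj h; have [x Zx xq] := surj2 q.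
  exists x; last by rewrite /= xq.
  by split=> //; apply/cl30; [exact: gZ|rewrite -psiE // xq].
- rewrite cl0; last by rewrite psiE //; apply/cl30 => //; exact: gZ.
  split=> [[q qx]|[u Zu Bu]].
    have [u Zu uq] := surj1 q; exists u => //.
    apply/(class_map_eq cm2) => //; first exact: fZ.
    by rewrite -phiE // uq.
  exists (cl1 u); rewrite phiE //; apply/esym/(class_map_eq cm2) => //.
  exact: fZ.
Qed.

End LinearRelations.

(** * The spectral sequence of a filtered complex *)

Section FilteredComplex.
Variables (K : fieldType) (V : lmodType K) (D : {linear V -> V}).
(* [Fil p n]: the elements of degree [n] and filtration at least [p]. *)
Variable Fil : int -> int -> submodule V.
Hypothesis DD : forall x, D (D x) = 0.
Hypothesis FilD : forall (p n : int) x, Fil p n x -> Fil p (n + 1) (D x).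
Hypothesis FilW : forall (p p' n : int) x, p' <= p -> Fil p n x -> Fil p' n x.
Hypothesis Fil_neg : forall (p n : int) x, p < 0 -> Fil p n x -> Fil 0 n x.
Hypothesis Fil_gt : forall (p n : int) x, n < p -> Fil p n x -> x = 0.

Let FilB p n x y : Fil p n x -> Fil p n y -> Fil p n (x - y).
Proof. by move=> hx hy; rewrite addrC -scaleN1r; apply: smemP. Qed.
Let FilDD p n x y : Fil p n x -> Fil p n y -> Fil p n (x + y).
Proof. by move=> hx hy; rewrite -[x]scale1r; apply: smemP. Qed.
Let FilE p n p' n' x : p = p' -> n = n' -> Fil p n x -> Fil p' n' x.
Proof. by move=> -> ->. Qed.

(* Z_r and B_r.  In B_r only [x - D v] is asked to have filtration p + 1: for [x]
   in Z_r it then lies in Z_(r-1) of filtration p + 1, so that Z_r / (Z_r :&: B_r)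
   is the usual Z_r^p / (Z_(r-1)^(p+1) + D Z_(r-1)^(p-r+1)). *)
Fact fcyc0 r p n : Fil p n 0 /\ Fil (p + r%:Z) (n + 1) (D 0).
Proof. by rewrite linear0; split; exact: smem0. Qed.
Fact fcycP r p n a x y : Fil p n x /\ Fil (p + r%:Z) (n + 1) (D x) ->
  Fil p n y /\ Fil (p + r%:Z) (n + 1) (D y) ->
  Fil p n (a *: x + y) /\ Fil (p + r%:Z) (n + 1) (D (a *: x + y)).
Proof. by move=> [? ?] [? ?]; rewrite linearP; split; apply: smemP. Qed.
Definition fcyc r p n : submodule V :=
  @Submodule _ V (fun x => Fil p n x /\ Fil (p + r%:Z) (n + 1) (D x))
    (fcyc0 r p n) (@fcycP r p n).

Fact fbnd0 r p n :
  exists2 v, Fil (p + 1 - r%:Z) (n - 1) v & Fil (p + 1) n (0 - D v).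
Proof.
by exists 0; [exact: smem0|rewrite (linear0 D) subrr; exact: smem0].
Qed.
Fact fbndP r p n a x y :
  (exists2 v, Fil (p + 1 - r%:Z) (n - 1) v & Fil (p + 1) n (x - D v)) ->
  (exists2 v, Fil (p + 1 - r%:Z) (n - 1) v & Fil (p + 1) n (y - D v)) ->
  exists2 v, Fil (p + 1 - r%:Z) (n - 1) v & Fil (p + 1) n (a *: x + y - D v).
Proof.
move=> [v Fv Fx] [w Fw Fy]; exists (a *: v + w); first exact: smemP.
by rewrite linearP lin_combB; apply: smemP.
Qed.
Definition fbnd r p n : submodule V :=
  @Submodule _ V
    (fun x => exists2 v, Fil (p + 1 - r%:Z) (n - 1) v & Fil (p + 1) n (x - D v))
    (fbnd0 r p n) (@fbndP r p n).

Definition fpage r p q : lmodType K := subquot (fcyc r p (p + q)) (fbnd r p (p + q)).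

Let fdiffZ r (p q : int) x : fcyc r p (p + q) x ->
  fcyc r (p + r%:Z) (p + r%:Z + (q - r%:Z + 1)) (D x).
Proof.
move=> [Fx FDx]; split; last by rewrite DD; exact: smem0.
by apply: FilE FDx => //; lia.
Qed.

Let fdiffB r (p q : int) x : fcyc r p (p + q) x -> fbnd r p (p + q) x ->
  fbnd r (p + r%:Z) (p + r%:Z + (q - r%:Z + 1)) (D x).
Proof.
(* [D (D v) = 0] gives [D x = D (x - D v)], and p + 1 = (p + r) + 1 - r is the level required of a
   bounding element at position p + r. *)
move=> [Fx FDx] [v Fv Fxv]; exists (x - D v).
  by apply: FilE Fxv; lia.
by rewrite (linearB D) DD subr0 subrr; exact: smem0.
Qed.

Definition fdiff r p q : {linear fpage r p q -> fpage r (p + r%:Z) (q - r%:Z + 1)} :=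
  subquot_map (@fdiffZ r p q) (@fdiffB r p q).

Fact fdiffK r p q : (2 <= r)%N -> forall x,
  fdiff r (p + r%:Z) (q - r%:Z + 1) (fdiff r p q x) = 0.
Proof.
move=> _ h; have [_ cl_surj _] := subquot_classP (fcyc r p (p + q)) (fbnd r p (p + q)).
have [x Zx <-] := cl_surj h.
rewrite (subquot_mapE _ _ Zx) (subquot_mapE _ _ (fdiffZ Zx)).
have [_ _ cl0] := subquot_classP
  (fcyc r (p + r%:Z + r%:Z) (p + r%:Z + r%:Z + (q - r%:Z + 1 - r%:Z + 1)))
  (fbnd r (p + r%:Z + r%:Z) (p + r%:Z + r%:Z + (q - r%:Z + 1 - r%:Z + 1))).
apply/cl0; first exact: fdiffZ (fdiffZ Zx).
by rewrite DD; exact: smem0.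
Qed.

(** A class dies under d_r when [D x - D v] has filtration p' + r + 1 for some v of level (p' + r) +
    1 - r = p' + 1. Then [x - v] is a cycle for the next page, so representatives are compared
    modulo filtration p' + 1. *)
Fact fnext r p q : (2 <= r)%N ->
  lmod_iso (fpage r.+1 (p + r%:Z) (q - r%:Z + 1))
    (homology (fdiff r p q) (fdiff r (p + r%:Z) (q - r%:Z + 1))).
Proof.
move=> r2; set p' := p + r%:Z; set q' := q - r%:Z + 1.
have nE : p' + q' = p + q + 1 by rewrite /p' /q'; lia.
have S2 := homology_is_subquot
  (subquot_classP (fcyc r p (p + q)) (fbnd r p (p + q)))
  (subquot_classP (fcyc r p' (p' + q')) (fbnd r p' (p' + q')))
  (subquot_classP (fcyc r (p' + r%:Z) (p' + r%:Z + (q' - r%:Z + 1)))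
    (fbnd r (p' + r%:Z) (p' + r%:Z + (q' - r%:Z + 1))))
  (@smemP _ _ (fcyc r p' (p' + q'))) (@fdiffZ r p q) (@fdiffZ r p' q')
  (fun x Zx => subquot_mapE (@fdiffZ r p q) (@fdiffB r p q) Zx)
  (fun x Zx => subquot_mapE (@fdiffZ r p' q') (@fdiffB r p' q') Zx).
apply: (subquot_iso (rel := fun y x => Fil (p' + 1) (p' + q') (x - y))
  (subquot_is_subquot _ _) S2).
- exact: smemP.
- move=> a x y [Zx Bx] [Zy By]; split; first exact: smemP.
  by rewrite linearP; apply: smemP.
- move=> a x y x' y' r1 r3; rewrite lin_combB; exact: smemP.
- move=> y [Fy FDy]; exists y; last by rewrite subrr; exact: smem0.
  split; first by split=> //; apply: FilW FDy; lia.
  exists 0; first exact: smem0.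
  by rewrite linear0 subr0; apply: FilE FDy; lia.
- move=> x [[Fx FDx] [v Fv Fxv]].
  have Fv' : Fil (p' + 1) (p' + q') v by apply: FilE Fv; lia.
  exists (x - v); last by rewrite subKr.
  split; first by apply: FilB => //; apply: FilW Fv'; lia.
  by rewrite linearB; apply: FilE Fxv; lia.
- move=> y x [Fy FDy] [[Fx FDx] _] rel_yx; split.
  + move=> [w Fw Fyw].
    have Fxw : Fil (p' + 1) (p' + q') (x - D w).
      have -> : x - D w = (x - y) + (y - D w) by rewrite addrA subrK.
      exact: FilDD.
    (* The level p' + 1 - (r + 1) is p, so the same [w] is a representative at position (p, q), the
       source of d_r. *)
    exists w; last first.
      exists 0; first exact: smem0.
      by rewrite linear0 subr0.
    split; first by apply: FilE Fw; lia.
    rewrite -(subKr x (D w)); apply: FilE (FilB Fx (FilW _ Fxw)); lia.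
  + move=> [u [Fu FDu] [v Fv Fxuv]]; exists (u + v).
      apply: FilDD; first by apply: FilE Fu; lia.
      by apply: FilW Fv; lia.
    have -> : y - D (u + v) = (x - D u - D v) - (x - y).
      by rewrite linearD opprB [RHS]addrC !addrA subrK opprD addrA.
    exact: FilB.
Qed.

(** For p < 0, filtration p already implies filtration p + 1; for q < 0, the degree p + q is below
    the filtration and the representative is zero. *)
Fact fquadrant r p q : (2 <= r)%N -> (p < 0) || (q < 0) -> lmod_trivial (fpage r p q).
Proof.
move=> r2 pq h; have [_ cl_surj cl0] :=
  subquot_classP (fcyc r p (p + q)) (fbnd r p (p + q)).
have [x [Fx FDx] <-] := cl_surj h; apply/cl0; first by split.
exists 0; first exact: smem0.
rewrite linear0 subr0; have [p0|p0] := ltP p 0.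
  by apply: FilW (Fil_neg p0 Fx); lia.
by rewrite (Fil_gt _ Fx); [exact: smem0|lia].
Qed.

Definition filtered_ss : spectral_sequence K :=
  SpectralSequence fdiffK fnext fquadrant.

(** The abutment is filtered by the classes of cocycles of filtration p. For r = p + q + 2, a [D x]
    of filtration p + r > n + 1 vanishes, and the level p + 1 - r = - q - 1 is negative: the page
    consists of true cocycles modulo true coboundaries and filtration p + 1. *)
Lemma filtered_ss_converges (H : nat -> lmodType K) :
  (forall n, is_subquot (fun x => Fil 0 n%:Z x /\ D x = 0)
     (fun x => exists2 v, Fil 0 (n%:Z - 1) v & D v = x) (H n)) ->
  converges_to filtered_ss H.
Proof.
move=> HP n; have [cl cm] := HP n; have [cl_lin cl_surj cl0] := cm.
have Fil_0 p x : Fil p n%:Z x -> Fil 0 n%:Z x.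
  by have [p0|p0] := ltP p 0; [exact: Fil_neg|exact: FilW].
have Zcl p x : Fil p n%:Z x -> D x = 0 -> Fil 0 n%:Z x /\ D x = 0.
  by move=> Fx; split=> //; exact: Fil_0 Fx.
have ZP a x y : Fil 0 n%:Z x /\ D x = 0 -> Fil 0 n%:Z y /\ D y = 0 ->
    Fil 0 n%:Z (a *: x + y) /\ D (a *: x + y) = 0.
  move=> [Fx Dx] [Fy Dy]; split; first exact: smemP.
  by rewrite linearP Dx Dy scaler0 addr0.
have F0 p : exists2 x, Fil p n%:Z x /\ D x = 0 & cl x = 0.
  exists 0; first by rewrite linear0; split=> //; exact: smem0.
  by apply/cl0; [split; [exact: smem0|exact: linear0]|exists 0; [exact: smem0|exact: linear0]].
have FP p a h h' : (exists2 x, Fil p n%:Z x /\ D x = 0 & cl x = h) ->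
    (exists2 x, Fil p n%:Z x /\ D x = 0 & cl x = h') ->
    exists2 x, Fil p n%:Z x /\ D x = 0 & cl x = a *: h + h'.
  move=> [x [Fx Dx] <-] [y [Fy Dy] <-]; exists (a *: x + y).
    by rewrite linearP Dx Dy scaler0 addr0; split=> //; apply: smemP.
  by rewrite cl_lin //; [exact: Zcl Fx Dx|exact: Zcl Fy Dy].
pose F (p : nat) := @Submodule _ (H n)
  (fun h => exists2 x, Fil p n%:Z x /\ D x = 0 & cl x = h) (F0 p) (@FP p).
exists F; split=> [h|p h [x [Fx Dx] <-]|h [x [Fx Dx] <-]|p q pqn].
- by have [x [Fx Dx] <-] := cl_surj h; exists x.
- by exists x => //; split=> //; apply: FilW Fx; lia.
- apply/cl0; first by split=> //; exact: Fil_0 Fx.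
  exists 0; first exact: smem0.
  by rewrite (Fil_gt _ Fx) ?linear0 //; lia.
have cm_in x : Fil p%:Z n%:Z x -> D x = 0 -> F p (cl x) by move=> *; exists x.
apply: (subquot_iso (rel := fun x h => [/\ Fil p%:Z n%:Z x, D x = 0 & cl x = h])
  (subquot_is_subquot _ _) (subquot_is_subquot _ _)).
- exact: smemP.
- exact: smemP.
- move=> a x y h h' [Fx Dx <-] [Fy Dy <-].
  rewrite linearP Dx Dy scaler0 addr0; split=> //; first exact: smemP.
  by rewrite cl_lin //; [exact: Zcl Fx Dx|exact: Zcl Fy Dy].
- move=> x [Fx FDx].
  have Dx : D x = 0 by apply: Fil_gt FDx; lia.
  have Fx' : Fil p%:Z n%:Z x by apply: FilE Fx; lia.
  by exists (cl x); [exists x|split].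
- move=> h [x [Fx Dx] <-]; exists x => //.
  by split; [apply: FilE Fx; lia|rewrite Dx; exact: smem0].
- move=> x h _ _ [Fx Dx <-]; split=> [[v Fv Fxv]|[y [Fy Dy] xy]].
  + exists (x - D v); first split.
    * by apply: FilE Fxv; lia.
    * by rewrite linearB DD subr0.
    have Fv' : Fil 0 (n%:Z - 1) v.
      have [E|] := eqVneq (p%:Z + 1 - (p + q).+2%:Z) 0.
        by apply: FilE Fv => //; lia.
      by move=> _; apply: (@Fil_neg (p%:Z + 1 - (p + q).+2%:Z)); [lia|apply: FilE Fv; lia].
    have FDv : Fil 0 n%:Z (D v) by apply: FilE (FilD Fv'); lia.
    apply/(class_map_eq cm ZP).
    * by split; [apply: FilB => //; exact: Fil_0 Fx|rewrite linearB DD subr0].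
    * exact: Zcl Fx Dx.
    exists (- v); first by rewrite -scaleN1r -[_ *: _]addr0; apply: smemP => //; exact: smem0.
    by rewrite linearN [x - D v]addrC addrK.
  + have [v Fv Dv] := (class_map_eq cm ZP (Zcl _ _ Fx Dx) (Zcl _ _ Fy Dy)).1 (esym xy).
    exists v.
      by apply: FilE (@FilW 0 (p%:Z + 1 - (p + q).+2%:Z) _ _ _ Fv); lia.
    by rewrite Dv subKr; apply: FilE Fy; lia.
Qed.

End FilteredComplex.

(** * Double complexes *)

Section CohomologyClasses.
Variable R : pzRingType.

Definition cobound (C : cochain R) (n : nat) : C n -> Prop :=
  match n with
  | 0 => fun x => x = 0
  | m.+1 => fun x => exists u, cdiff C m u = x
  end.

Lemma cohomology_is_subquot (C : cochain R) n :
  is_subquot (fun x => cdiff C n x = 0) (@cobound C n) (cohomology C n).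
Proof.
case: n => [|n]; last exact: homology_class.
apply: is_subquot_ext (homology_class _ _) => // x _.
by split=> [[u <-]|->]; last exists 0.
Qed.

Lemma is_subquot_iso (V Q Q' : lmodType R) (Z B : V -> Prop) :
  is_subquot Z B Q -> lmod_iso Q Q' -> is_subquot Z B Q'.
Proof.
move=> [cl [cl_lin cl_surj cl0]] [f [g fK gK]]; exists (f \o cl).
split=> [a x y Zx Zy|h|x Zx] /=; first by rewrite cl_lin // linearP.
  by have [x Zx xh] := cl_surj (g h); exists x => //=; rewrite xh.
rewrite -cl0 //; split=> [fx0|->]; last exact: linear0.
by rewrite -(fK (cl x)) fx0 -(linear0 f) fK.
Qed.

End CohomologyClasses.

(** The squares anticommute, so the total differential is the plain sum of the two. *)
Record bicomplex (K : fieldType) := Bicomplex {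
  bobj :> nat -> nat -> lmodType K;
  bd1 : forall a b, {linear bobj a b -> bobj a.+1 b};
  bd2 : forall a b, {linear bobj a b -> bobj a b.+1};
  bd11 : forall a b x, bd1 a.+1 b (bd1 a b x) = 0;
  bd22 : forall a b x, bd2 a b.+1 (bd2 a b x) = 0;
  bd12 : forall a b x, bd1 a b.+1 (bd2 a b x) + bd2 a.+1 b (bd1 a b x) = 0
}.

Section TotalComplex.
Variables (K : fieldType) (X : bicomplex K).

(* The product of all the X a b; the degree-n part of the total complex is the
   subspace of families supported on a + b = n. *)
Definition biprod : Type := forall a b, X a b.
HB.instance Definition _ := gen_eqMixin biprod.
HB.instance Definition _ := gen_choiceMixin biprod.

Lemma biprod_ext (x y : biprod) : (forall a b, x a b = y a b) -> x = y.
Proof. by move=> xy; do 2 apply: functional_extensionality_dep => ?. Qed.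

Fact biprod_addA : associative (fun x y : biprod => (fun a b => x a b + y a b) : biprod).
Proof. by move=> x y z; apply: biprod_ext => a b; rewrite addrA. Qed.
Fact biprod_addC : commutative (fun x y : biprod => (fun a b => x a b + y a b) : biprod).
Proof. by move=> x y; apply: biprod_ext => a b; rewrite addrC. Qed.
Fact biprod_add0 : left_id ((fun a b => 0) : biprod)
  (fun x y : biprod => (fun a b => x a b + y a b) : biprod).
Proof. by move=> x; apply: biprod_ext => a b; rewrite add0r. Qed.
Fact biprod_addN : left_inverse ((fun a b => 0) : biprod)
  (fun x : biprod => (fun a b => - x a b) : biprod)
  (fun x y : biprod => (fun a b => x a b + y a b) : biprod).
Proof. by move=> x; apply: biprod_ext => a b; rewrite addNr. Qed.
HB.instance Definition _ := GRing.isZmodule.Build biprod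
  biprod_addA biprod_addC biprod_add0 biprod_addN.

Definition biprod_scale (k : K) (x : biprod) : biprod := fun a b => k *: x a b.
Fact biprod_scaleA k l x : biprod_scale k (biprod_scale l x) = biprod_scale (k * l) x.
Proof. by apply: biprod_ext => a b; rewrite /biprod_scale scalerA. Qed.
Fact biprod_scale1 : left_id 1 biprod_scale.
Proof. by move=> x; apply: biprod_ext => a b; rewrite /biprod_scale scale1r. Qed.
Fact biprod_scaleDr : right_distributive biprod_scale +%R.
Proof. by move=> k x y; apply: biprod_ext => a b; exact: scalerDr. Qed.
Fact biprod_scaleDl x : {morph biprod_scale^~ x : k l / k + l}.
Proof. by move=> k l; apply: biprod_ext => a b; exact: scalerDl. Qed.
HB.instance Definition _ := GRing.Zmodule_isLmodule.Build K biprod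
  biprod_scaleA biprod_scale1 biprod_scaleDr biprod_scaleDl.

Lemma biprodPE k (x y : biprod) a b : (k *: x + y) a b = k *: x a b + y a b.
Proof. by []. Qed.
Lemma biprodBE (x y : biprod) a b : (x - y) a b = x a b - y a b.
Proof. by []. Qed.

Definition tot1 (x : biprod) a b : X a b :=
  match a with 0 => 0 | a'.+1 => bd1 X a' b (x a' b) end.
Definition tot2 (x : biprod) a b : X a b :=
  match b with 0 => 0 | b'.+1 => bd2 X a b' (x a b') end.
Definition tot_fun (x : biprod) : biprod := fun a b => tot1 x a b + tot2 x a b.

Fact tot_linear : linear tot_fun.
Proof.
move=> k x y; apply: biprod_ext => a b.
rewrite biprodPE /tot_fun scalerDr addrACA; congr (_ + _).
  by case: a => [|a] /=; rewrite ?scaler0 ?addr0 // -linearP.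
by case: b => [|b] /=; rewrite ?scaler0 ?addr0 // -linearP.
Qed.
Definition tot : {linear biprod -> biprod} := mk_linear tot_linear.

Lemma totE x a b : tot x a b = tot1 x a b + tot2 x a b.
Proof. by []. Qed.

Lemma totK x : tot (tot x) = 0.
Proof.
apply: biprod_ext => a b; rewrite totE.
case: a b => [|a] [|b] /=; rewrite ?addr0 ?add0r //.
- by case: b => [|b]; rewrite /tot_fun /= ?addr0 ?add0r ?linear0 ?bd22.
- by case: a => [|a]; rewrite /tot_fun /= ?addr0 ?add0r ?linear0 ?bd11.
- rewrite /tot_fun !linearD /= addrA -[X in X + _ = _]addrA bd12 addr0.
  by case: a b => [|a] [|b] /=; rewrite ?linear0 ?bd11 ?bd22 ?addr0.
Qed.

Definition in_fil (p n : int) (x : biprod) : Prop :=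
  forall a b, ~~ ((p <= a%:Z) && (a%:Z + b%:Z == n)) -> x a b = 0.
Fact fil0 p n : in_fil p n 0. Proof. by []. Qed.
Fact filP p n k x y : in_fil p n x -> in_fil p n y -> in_fil p n (k *: x + y).
Proof.
by move=> hx hy a b ab; rewrite biprodPE hx // hy // scaler0 addr0.
Qed.
Definition fil p n : submodule biprod := @Submodule K biprod (in_fil p n) (@fil0 p n) (@filP p n).

Lemma filD (p n : int) x : fil p n x -> fil p (n + 1) (tot x).
Proof.
move=> hx a b ab; rewrite totE; case: a b ab => [|a] [|b] ab /=;
  rewrite ?add0r ?addr0 //; rewrite ?hx ?linear0 ?addr0 //; lia.
Qed.

Lemma filW (p p' n : int) x : p' <= p -> fil p n x -> fil p' n x.
Proof. by move=> pp' hx a b ab; apply: hx; lia. Qed.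

Lemma fil_neg (p n : int) x : p < 0 -> fil p n x -> fil 0 n x.
Proof. by move=> p0 hx a b ab; apply: hx; lia. Qed.

Lemma fil_gt (p n : int) x : n < p -> fil p n x -> x = 0.
Proof. by move=> np hx; apply: biprod_ext => a b; apply: hx; lia. Qed.

(** The type of a value depends on its position, so [y] is transported along decided equalities;
    [eq_axiomK] removes the transport at (a, b). *)
Lemma single_ex a b (y : X a b) : exists w : biprod, w a b = y /\
  forall a' b', (a' != a) || (b' != b) -> w a' b' = 0.
Proof.
pose w : biprod := fun a' b' => match eq_comparable a a', eq_comparable b b' with
  | left e, left f =>
      match e in _ = a', f in _ = b' return X a' b' with
      | erefl, erefl => y
      end
  | _, _ => 0
  end.
exists w; split=> [|a' b'].
  rewrite /w; case: (eq_comparable a a) => // e; case: (eq_comparable b b) => // f.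
  by rewrite !eq_axiomK.
move=> ab; rewrite /w; case: (eq_comparable a a') => // e.
by case: (eq_comparable b b') => // f; move: ab; rewrite {1}e {1}f !eqxx.
Qed.

End TotalComplex.

Section TotalCohomology.
Variables (K : fieldType) (X : bicomplex K).

Definition tot_cocycle (n : int) (x : biprod X) := fil X 0 n x /\ tot X x = 0.
Definition tot_cobound (n : int) (x : biprod X) :=
  exists2 v, fil X 0 (n - 1) v & tot X v = x.

Fact tot_cocycle0 n : tot_cocycle n 0.
Proof. by split; [exact: smem0|exact: linear0]. Qed.
Fact tot_cocycleP n k x y :
  tot_cocycle n x -> tot_cocycle n y -> tot_cocycle n (k *: x + y).
Proof.
move=> [hx x0] [hy y0]; split; first exact: smemP.
by rewrite linearP x0 y0 scaler0 addr0.
Qed.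
Fact tot_cobound0 n : tot_cobound n 0.
Proof. by exists 0; [exact: smem0|exact: linear0]. Qed.
Fact tot_coboundP n k x y :
  tot_cobound n x -> tot_cobound n y -> tot_cobound n (k *: x + y).
Proof.
move=> [v hv <-] [w hw <-]; exists (k *: v + w); first exact: smemP.
by rewrite linearP.
Qed.

Definition tot_cohomology (n : int) : lmodType K :=
  subquot (Submodule (tot_cocycle0 n) (@tot_cocycleP n))
    (Submodule (tot_cobound0 n) (@tot_coboundP n)).

Lemma tot_cohomology_is_subquot n :
  is_subquot (tot_cocycle n) (tot_cobound n) (tot_cohomology n).
Proof. exact: subquot_is_subquot. Qed.

End TotalCohomology.

(** * Symmetry of the total complex *)

Section Transpose.
Variables (K : fieldType) (X : bicomplex K).

Fact transpose_bd12 a b (x : X b a) :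
  bd2 X b.+1 a (bd1 X b a x) + bd1 X b a.+1 (bd2 X b a x) = 0.
Proof. by rewrite addrC bd12. Qed.
Definition transpose : bicomplex K :=
  @Bicomplex K (fun a b => X b a) (fun a b => bd2 X b a) (fun a b => bd1 X b a)
    (fun a b => bd22 (b:=a)) (fun a b => bd11 (b:=a)) transpose_bd12.

Definition biprod_tr (x : biprod X) : biprod transpose := fun a b => x b a.

Lemma tot_tr x : tot transpose (biprod_tr x) = biprod_tr (tot X x).
Proof. by apply: biprod_ext => a b; rewrite totE addrC. Qed.

Lemma fil_tr n x : fil transpose 0 n (biprod_tr x) <-> fil X 0 n x.
Proof.
split=> hx a b ab; [apply: (hx b a)|apply: (hx b a)];
  by move: ab; rewrite addrC.
Qed.

(** Only filtration 0 enters, which constrains neither index, so swapping the two directions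
    preserves both the degree and the total differential. *)
Lemma tot_cohomology_tr n :
  lmod_iso (tot_cohomology X n) (tot_cohomology transpose n).
Proof.
have tr_inj x y : biprod_tr x = biprod_tr y -> x = y.
  move=> xy; apply: biprod_ext => a b.
  exact: (congr1 (fun z : biprod transpose => z b a) xy).
apply: (subquot_iso (rel := fun x y => y = biprod_tr x)
  (tot_cohomology_is_subquot X n) (tot_cohomology_is_subquot transpose n)).
- exact: tot_cocycleP.
- exact: tot_cocycleP.
- by move=> k x y _ _ -> ->.
- move=> x [hx x0]; exists (biprod_tr x) => //.
  by split; [exact/fil_tr|rewrite tot_tr x0].
- move=> y [hy y0]; exists ((fun a b => y b a) : biprod X) => //.
  split; first exact/fil_tr.
  by apply: tr_inj; rewrite -tot_tr y0.
- move=> x _ _ _ ->; split=> [[v hv <-]|[v hv vx]].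
    by exists (biprod_tr v); [exact/fil_tr|rewrite tot_tr].
  exists ((fun a b => v b a) : biprod X); first exact/fil_tr.
  by apply: tr_inj; rewrite -tot_tr.
Qed.
End Transpose.

(** * Double complexes with exact rows *)

Section Edge.
Variables (K : fieldType) (X : bicomplex K) (Y : cochain K).
Variable eps : forall b, {linear Y b -> X 0%N b}.
Hypothesis eps_inj : forall b, injective (eps b).
Hypothesis eps_diff : forall b y, bd2 X 0 b (eps b y) = eps b.+1 (cdiff Y b y).
Hypothesis row_exact0 : forall b x, bd1 X 0 b x = 0 <-> exists y, eps b y = x.
Hypothesis row_exact : forall a b x,
  bd1 X a.+1 b x = 0 -> exists y, bd1 X a b y = x.

Let filB p n x y : fil X p n x -> fil X p n y -> fil X p n (x - y).
Proof. by move=> hx hy; rewrite addrC -scaleN1r; apply: smemP. Qed.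

(* Clears the columns a >= 1 one at a time, starting from the last one. *)
Lemma clear_columns (n : int) k (x : biprod X) : fil X 0 n x ->
  (forall a b, (0 < a)%N -> tot X x a b = 0) ->
  (forall a b, (k < a)%N -> x a b = 0) ->
  exists2 w, fil X 0 (n - 1) w &
    forall a b, (0 < a)%N -> (x - tot X w) a b = 0.
Proof.
elim: k x => [|k IH] x hx Dx xk.
  by exists 0; [exact: smem0|move=> a b a0; rewrite linear0 subr0 xk].
have [nk|kn] := ltP n k.+1%:Z.
  by apply: IH => // a b ka; apply: hx; lia.
pose b := `|n - k.+1%:Z|%N; have bE : k.+1%:Z + b%:Z = n by lia.
(* Column k + 2 of [x] is zero, so the vanishing of [tot X x] there says that the last nonzero entry
   is killed by the row differential. *)
have [y yx] : exists y, bd1 X k b y = x k.+1 b.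
  apply: row_exact; have := Dx k.+2 b isT; rewrite totE /= => <-.
  by rewrite -[LHS]addr0; congr (_ + _); case: b {bE} => //= b; rewrite xk ?linear0.
have [w [wy w0]] := single_ex y.
have hw : fil X 0 (n - 1) w by move=> a b' ab; apply: w0; lia.
have Dw_hi a b' : (k.+1 < a)%N -> tot X w a b' = 0.
  move=> ka; rewrite totE; case: a ka => //= a ka.
  rewrite w0 ?linear0 ?add0r; last lia.
  by case: b' => //= b'; rewrite w0 ?linear0 //; lia.
have Dw_k b' : tot X w k.+1 b' = bd1 X k b' (w k b').
  rewrite totE /= -[RHS]addr0; congr (_ + _).
  by case: b' => //= b'; rewrite w0 ?linear0 //; lia.
have hDw : fil X 0 n (tot X w).
  have := filD hw; by rewrite subrK.
have [|a b' a0|a b' ka|v hv xv] := IH (x - tot X w).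
- exact: filB.
- by rewrite (linearB (tot X)) totK subr0 Dx.
- rewrite biprodBE; have [->|ak] := eqVneq a k.+1; last first.
    by rewrite xk ?Dw_hi ?subrr //; lia.
  rewrite Dw_k; have [->|bb] := eqVneq b' b; first by rewrite wy yx subrr.
  have -> : w k b' = 0 by apply: w0; rewrite bb orbT.
  by rewrite linear0 subr0; apply: hx; lia.
exists (w + v); last first.
  have -> : x - tot X (w + v) = x - tot X w - tot X v by rewrite (linearD (tot X)) opprD addrA.
  exact: xv.
by rewrite -[w]scale1r; apply: smemP.
Qed.

Lemma clear_columns_deg (n : int) (x : biprod X) : fil X 0 n x ->
  (forall a b, (0 < a)%N -> tot X x a b = 0) ->
  exists2 w, fil X 0 (n - 1) w &
    forall a b, (0 < a)%N -> (x - tot X w) a b = 0.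
Proof.
move=> hx Dx; apply: (@clear_columns n `|n|%N) => // a b na.
by apply: hx; lia.
Qed.

Definition edge_family (n : nat) (y : Y n) (s : biprod X) : Prop :=
  s 0%N n = eps n y /\ forall a b, (a != 0)%N || (b != n) -> s a b = 0.

Lemma edge_family_tot n (y : Y n) s : edge_family y s ->
  edge_family (cdiff Y n y) (tot X s).
Proof.
move=> [sy s0]; split; first by rewrite totE /= add0r sy eps_diff.
move=> a b ab; rewrite totE.
have -> : tot1 s a b = 0.
  case: a ab => //= a _; have [->|a0] := posnP a; last by rewrite s0 ?linear0 // -lt0n a0.
  have [->|bn] := eqVneq b n; last by rewrite s0 ?linear0.
  by rewrite sy; apply/row_exact0; exists y.
rewrite add0r; case: b ab => //= b ab; rewrite s0 ?linear0 //.
Qed.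

Lemma edge_family_uniq n (y : Y n) s s' :
  edge_family y s -> edge_family y s' -> s = s'.
Proof.
move=> [sy s0] [sy' s0']; apply: biprod_ext => a b.
have [->|a0] := eqVneq a 0%N; last by rewrite s0 ?s0' ?a0.
by have [->|bn] := eqVneq b n; [rewrite sy sy'|rewrite s0 ?s0' ?bn ?orbT].
Qed.

Lemma edge_family0 n : edge_family (0 : Y n) 0.
Proof. by split; rewrite ?linear0. Qed.

(** [x] represents [y] when it is [eps n y], placed in column 0, up to a total coboundary. *)
Definition edge_rel (n : nat) (y : Y n) (x : biprod X) : Prop :=
  exists2 w, fil X 0 (n%:Z - 1) w & edge_family y (x - tot X w).

Lemma edge_rel_cocycle n y x : edge_rel (n:=n) y x ->
  (cdiff Y n y = 0 <-> tot X x = 0).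
Proof.
move=> [w hw /edge_family_tot]; rewrite (linearB (tot X)) totK subr0 => hy.
split=> [y0|tx]; first by move: hy; rewrite y0 => /edge_family_uniq; apply; exact: edge_family0.
by case: hy => + _; rewrite tx => /esym E; apply: (@eps_inj n.+1); rewrite linear0.
Qed.

(** Clearing the positive columns of a total cocycle leaves an entry in column 0 that exactness puts
    in the image of [eps]. Clearing them in a family that bounds such an entry shows that it comes
    from a coboundary of [Y]. *)
Lemma edge_cohomology n : lmod_iso (tot_cohomology X n%:Z) (cohomology Y n).
Proof.
apply: lmod_iso_sym.
have zeros_fil y x : edge_rel (n:=n) y x -> fil X 0 n%:Z x.
  move=> [w hw [_ z0]].
  have hDw : fil X 0 n%:Z (tot X w) by have := filD hw; rewrite subrK.
  rewrite -(subrK (tot X w) x) -[x - _]scale1r; apply: smemP => // a b ab.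
  by apply: z0; lia.
apply: (subquot_iso (rel := @edge_rel n)
  (cohomology_is_subquot Y n) (tot_cohomology_is_subquot X n%:Z)).
- by move=> k x y x0 y0; rewrite linearP x0 y0 scaler0 addr0.
- exact: tot_cocycleP.
- move=> k y y' x x' [w hw [wy w0]] [w' hw' [wy' w0']].
  exists (k *: w + w'); first exact: smemP.
  rewrite linearP lin_combB; split=> [|a b ab]; rewrite biprodPE.
    by rewrite wy wy' linearP.
  by rewrite w0 // w0' // scaler0 addr0.
- move=> y y0; have [x [xy x0]] := single_ex (eps n y).
  have r : edge_rel y x.
    by exists 0; [exact: smem0|rewrite linear0 subr0].
  by exists x => //; split; [exact: zeros_fil r|exact/(edge_rel_cocycle r)].
- move=> x [hx x0].
  have [|w hw xw] := clear_columns_deg hx; first by move=> a b _; rewrite x0.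
  have hDw : fil X 0 n%:Z (tot X w) by have := filD hw; rewrite subrK.
  have hz : fil X 0 n%:Z (x - tot X w) by exact: filB.
  have tz : tot X (x - tot X w) = 0 by rewrite (linearB (tot X)) x0 totK subrr.
  have /row_exact0 [y yz] : bd1 X 0 n ((x - tot X w) 0%N n) = 0.
    have := congr1 (fun u : biprod X => u 1%N n) tz; rewrite totE /= => E.
    rewrite -[LHS]addr0 -[RHS]E; congr (_ + _).
    by case: (n) => //= m; rewrite xw ?linear0.
  have r : edge_rel y x.
    exists w => //; split=> // a b ab; have [a0|a0] := posnP a; last exact: xw.
    by apply: hz; lia.
  by exists y => //; exact/(edge_rel_cocycle r).
- clear zeros_fil; move=> y x y0 [hx x0] r; split.
  + case: r => w hw hy yB; case: n hw hx y yB hy {y0} => [|n] hw hx y yB hy.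
      move: hy; rewrite yB => /edge_family_uniq/(_ (edge_family0 0)) /eqP.
      by rewrite subr_eq0 => /eqP ->; exists w.
    case: yB => u uy; have [s us] := single_ex (eps n u).
    have hs := edge_family_tot us; rewrite uy in hs.
    exists (w + s); last by rewrite (linearD (tot X)) -(edge_family_uniq hy hs) addrC subrK.
    rewrite -[w]scale1r; apply: smemP => // a b ab.
    by case: us => _ s0; apply: s0; lia.
  + case: r => w hw hy [v hv vx]; rewrite -vx -(linearB (tot X)) in hy.
    have hvw : fil X 0 (n%:Z - 1) (v - w) by exact: filB.
    (* Clearing applies to [v - w] although it is no cocycle: its total differential is concentrated
       in column 0. *)
    have [|w' hw' xw'] := clear_columns_deg hvw.
      by move=> a b a0; case: hy => _ -> //; case: a a0.
    set s := v - w - tot X w' in xw'.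
    have Ds : tot X (v - w) = tot X s by rewrite [in RHS](linearB (tot X)) totK subr0.
    have hs : fil X 0 (n%:Z - 1) s.
      by apply: filB => //; have := filD hw'; rewrite subrK.
    rewrite Ds in hy; case: n hw hx y y0 hy hv hvw hw' hs => [|n] hw hx y y0 [hy z0] hv hvw hw' hs.
      apply: (@eps_inj 0%N); rewrite linear0 -hy totE /= add0r //.
    have /row_exact0 [u us] : bd1 X 0 n (s 0%N n) = 0.
      have := z0 1%N n isT; rewrite totE /= => E.
      rewrite -[LHS]addr0 -[RHS]E; congr (_ + _).
      by case: (n) => //= m; rewrite xw' ?linear0.
    exists u; apply: (@eps_inj n.+1).
    by rewrite -eps_diff us -hy totE /= add0r.
Qed.
End Edge.

(** * Free resolutions *)

Section FreeModules.
Variables (R : pzRingType) (T : choiceType).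

Definition freemod : Type := {malg R[T]}.
HB.instance Definition _ := GRing.Zmodule.on freemod.

Definition free_scale (a : R) (g : freemod) : freemod :=
  msum (fun t b => << a * b *g t >>) g.

Let sD a (t : T) (b b' : R) :
  << a * (b + b') *g t >> = << a * b *g t >> + << a * b' *g t >> :> {malg R[T]}.
Proof. by rewrite mulrDr monalgUD. Qed.
Let sU a b t : free_scale a << b *g t >> = << a * b *g t >>.
Proof. exact: (msumU (sD a)). Qed.
Let sA a g h : free_scale a (g + h) = free_scale a g + free_scale a h.
Proof. exact: (msumD (sD a)). Qed.
Let s0 a : free_scale a 0 = 0.
Proof. exact: (msum0 (sD a)). Qed.

Fact free_scaleA a b v : free_scale a (free_scale b v) = free_scale (a * b) v.
Proof.
elim/malg_ind: v => [|g h IH IH'|c t]; first by rewrite !s0.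
  by rewrite !sA IH IH'.
by rewrite !sU mulrA.
Qed.
Fact free_scale1 : left_id 1 free_scale.
Proof.
elim/malg_ind => [|g h IH IH'|c t]; first by rewrite s0.
  by rewrite sA IH IH'.
by rewrite sU mul1r.
Qed.
Fact free_scaleDr : right_distributive free_scale +%R.
Proof. exact: sA. Qed.
Fact free_scaleDl v : {morph free_scale^~ v : a b / a + b}.
Proof.
move=> a b; elim/malg_ind: v => [|g h IH IH'|c t]; first by rewrite !s0 addr0.
  by rewrite !sA IH IH' addrACA.
by rewrite !sU mulrDl monalgUD.
Qed.
HB.instance Definition _ := GRing.Zmodule_isLmodule.Build R freemod
  free_scaleA free_scale1 free_scaleDr free_scaleDl.

Definition gen (t : T) : freemod := << 1 *g t >>.

Lemma freemod_ind (P : freemod -> Prop) :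
  P 0 -> (forall a g h, P g -> P h -> P (a *: g + h)) -> (forall t, P (gen t)) ->
  forall g, P g.
Proof.
move=> P0 PP Pg g; elim/malg_ind: g => [|g h Pg' Ph|a t] //.
  by have := PP 1 g h Pg' Ph; rewrite scale1r.
have := PP a _ _ (Pg t) P0; rewrite addr0 (_ : a *: gen t = << a *g t >> :> freemod) //.
by apply: etrans (sU _ _ _) _; rewrite mulr1.
Qed.

Variable V : lmodType R.

Definition free_lift_fun (f : T -> V) (g : freemod) : V := msum (fun t b => b *: f t) g.

Fact free_lift_linear f : linear (free_lift_fun f).
Proof.
have fD t a b : (a + b) *: f t = a *: f t + b *: f t by exact: scalerDl.
have lD g h : free_lift_fun f (g + h) = free_lift_fun f g + free_lift_fun f h.
  exact: msumD.
have l0 : free_lift_fun f 0 = 0 by exact: msum0.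
move=> a x y; rewrite lD; congr (_ + _).
elim/malg_ind: x => [|g h IH IH'|b t]; first by rewrite scaler0 l0 scaler0.
  by rewrite scalerDr !lD IH IH' scalerDr.
have -> : a *: (<< b *g t >> : freemod) = << a * b *g t >> by exact: sU.
by rewrite /free_lift_fun !msumU // scalerA.
Qed.
Definition free_lift f : {linear freemod -> V} := mk_linear (free_lift_linear f).

Lemma free_lift_gen f t : free_lift f (gen t) = f t.
Proof.
rewrite [LHS]msumU ?scale1r //.
by move=> u a b; exact: scalerDl.
Qed.

End FreeModules.

(** Projectivity along [cl], which is linear only on [Z], so that [freemod_projective] does not
    apply to it. *)
Lemma freemod_lift_class (R : pzRingType) (T : choiceType) (V Q : lmodType R)
    (Z B : V -> Prop) (cl : V -> Q) (h : {linear freemod R T -> Q}) :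
  class_map Z B cl -> Z 0 -> (forall a x y, Z x -> Z y -> Z (a *: x + y)) ->
  exists f : {linear freemod R T -> V}, forall g, Z (f g) /\ cl (f g) = h g.
Proof.
move=> [cl_lin cl_surj _] Z0 ZP.
have cl0 : cl 0 = 0.
  have := cl_lin 1 0 0 Z0 Z0; rewrite !scale1r addr0 => /eqP.
  by rewrite -[X in X == _]addr0 (inj_eq (addrI _)) eq_sym => /eqP.
pose f0 t := s2val (cid2 (cl_surj (h (gen R t)))).
have f0P t : Z (f0 t) /\ cl (f0 t) = h (gen R t).
  by rewrite /f0; case: cid2.
exists (free_lift f0); elim/freemod_ind => [|a x y [Zx hx] [Zy hy]|t].
- by rewrite !linear0.
- by rewrite !linearP -hx -hy; split; [exact: ZP|exact: cl_lin].
- by rewrite free_lift_gen.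
Qed.

Lemma freemod_projective (R : pzRingType) (T : choiceType) (Y Z : lmodType R)
    (p : {linear Y -> Z}) (f : {linear freemod R T -> Z}) :
  (forall x, exists y, p y = f x) ->
  exists g : {linear freemod R T -> Y}, forall x, p (g x) = f x.
Proof.
move=> fp; exists (free_lift (fun t => sval (cid (fp (gen R t))))).
elim/freemod_ind => [|a x y IH IH'|t]; first by rewrite !linear0.
  by rewrite !linearP IH IH'.
by rewrite free_lift_gen; case: cid.
Qed.

Lemma linear_factor_surj (R : pzRingType) (X Y Z : lmodType R)
    (p : {linear X -> Y}) (f : {linear X -> Z}) :
  (forall y, exists x, p x = y) -> (forall x, p x = 0 -> f x = 0) ->
  exists g : {linear Y -> Z}, forall x, g (p x) = f x.
Proof.
move=> p_surj pf; pose r y := sval (cid (p_surj y)).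
have rK y : p (r y) = y by exact: svalP (cid (p_surj y)).
have main x : f (r (p x)) = f x.
  by apply/eqP; rewrite -subr_eq0 -linearB pf // linearB rK subrr.
have g_lin : linear (f \o r).
  by move=> a x y /=; rewrite -linearP -{1}(rK x) -{1}(rK y) -linearP main.
by exists (mk_linear g_lin).
Qed.

Lemma linear_factor_inj (R : pzRingType) (X Y Z : lmodType R)
    (i : {linear Y -> Z}) (f : {linear X -> Z}) :
  injective i -> (forall x, exists y, i y = f x) ->
  exists g : {linear X -> Y}, forall x, i (g x) = f x.
Proof.
move=> i_inj fi; pose g x := sval (cid (fi x)).
have gK x : i (g x) = f x by exact: svalP (cid (fi x)).
have g_lin : linear g by move=> a x y; apply: i_inj; rewrite linearP !gK linearP.
by exists (mk_linear g_lin).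
Qed.

(* A free resolution of [fsyz 0], cut into short exact sequences
   0 -> fsyz n.+1 -> fres n -> fsyz n -> 0. *)
Record free_resolution (R : pzRingType) := FreeResolution {
  fbasis : nat -> choiceType;
  fsyz : nat -> lmodType R;
  faug : forall n, {linear freemod R (fbasis n) -> fsyz n};
  fincl : forall n, {linear fsyz n.+1 -> freemod R (fbasis n)};
  faug_surj : forall n y, exists x, faug n x = y;
  fincl_inj : forall n, injective (fincl n);
  faug_incl : forall n x, faug n (fincl n x) = 0;
  faug_ker : forall n x, faug n x = 0 -> exists y, fincl n y = x
}.

Section StandardFreeResolution.
Variables (R : pzRingType) (N : lmodType R).

(** The basis consists of all elements of [V], so no generators have to be chosen. *)
Definition free_cover (V : lmodType R) : {linear freemod R V -> V} := free_lift id.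

Fact free_cover_surj (V : lmodType R) (v : V) : exists x, free_cover V x = v.
Proof. by exists (gen R v); rewrite /free_cover free_lift_gen. Qed.

Fixpoint syzygy (n : nat) : lmodType R :=
  match n with
  | 0 => N
  | m.+1 => submod_type (ker_sub (free_cover (syzygy m)))
  end.

Definition syzygy_incl n : {linear syzygy n.+1 -> freemod R (syzygy n)} :=
  (val : submod_type (ker_sub (free_cover (syzygy n))) -> freemod R (syzygy n)).

Fact free_cover_incl n x : free_cover (syzygy n) (syzygy_incl n x) = 0.
Proof. by have /spredP := valP x. Qed.

Fact free_cover_ker n x :
  free_cover (syzygy n) x = 0 -> exists y, syzygy_incl n y = x.
Proof.
move=> x0; have xk : x \in spred (ker_sub (free_cover (syzygy n))) by exact/spredP.
by exists (Sub x xk : submod_type _).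
Qed.

Definition standard_resolution : free_resolution R :=
  @FreeResolution R (fun n => syzygy n) syzygy (fun n => free_cover (syzygy n))
    syzygy_incl (fun n => @free_cover_surj (syzygy n))
    (fun n => val_inj) free_cover_incl free_cover_ker.

End StandardFreeResolution.

Section ResolutionDifferential.
Variables (R : pzRingType) (P : free_resolution R).

Definition fres n : lmodType R := freemod R (fbasis P n).

Definition fres_diff n : {linear fres n.+1 -> fres n} :=
  (fincl P n \o faug P n.+1 : {linear fres n.+1 -> fres n}).

Lemma fres_diffE n x : fres_diff n x = fincl P n (faug P n.+1 x).
Proof. by []. Qed.

Lemma fres_diff_diff n x : fres_diff n (fres_diff n.+1 x) = 0.
Proof. by rewrite !fres_diffE faug_incl linear0. Qed.

End ResolutionDifferential.

(** * Balancing Ext *)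

Section Precomposition.
Variables (K : fieldType) (R : algebra K) (X X' Y : lmodType R) (h : {linear X' -> X}).

Definition homK_pre (f : homK X Y) : homK X' Y := (f \o h : {linear X' -> Y}).
Fact homK_pre_linear : linear homK_pre.
Proof. by move=> a f g; exact: linear_ext. Qed.
HB.instance Definition _ := GRing.isLinear.Build K (homK X Y) (homK X' Y) _ homK_pre
  homK_pre_linear.
Lemma homK_preE f x : homK_pre f x = f (h x).
Proof. by []. Qed.
End Precomposition.

Section HomBicomplex.
Variables (K : fieldType) (R : algebra K) (P : free_resolution R).
Local Notation F := (fres P).
Local Notation N := (fsyz P 0).
Local Notation sgn a := ((-1 : K) ^+ a).

Lemma homKPE (X Y : lmodType R) (k : K) (f g : homK X Y) x :
  (k *: f + g) x = aunit R k *: f x + g x.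
Proof. by []. Qed.
Lemma homKZE (X Y : lmodType R) (k : K) (f : homK X Y) x :
  (k *: f) x = aunit R k *: f x.
Proof. by []. Qed.

Lemma fres_diffK n (V : lmodType R) (f : homK (F n) V) :
  homK_pre (fres_diff P n.+1) (homK_pre (fres_diff P n) f) = 0.
Proof.
apply: linear_ext => x.
by rewrite 2!homK_preE fres_diff_diff linear0.
Qed.

Definition fres_cochain (V : lmodType R) : cochain K :=
  @Cochain K (fun n => homK (F n) V) (fun n => homK_pre (fres_diff P n))
    (fun n => @fres_diffK n V).

Variable C : cochain R.

(** The sign makes the squares anticommute, as a [bicomplex] demands. *)
Definition hom_d2 a b : {linear homK (F a) (C b) -> homK (F a) (C b.+1)} :=
  sgn a \*: (homK_map (cdiff C b) : {linear _ -> _}).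

Lemma hom_d2E a b (f : homK (F a) (C b)) x :
  hom_d2 a b f x = aunit R (sgn a) *: cdiff C b (f x).
Proof. by []. Qed.


Fact hom_bd22 a b f : hom_d2 a b.+1 (hom_d2 a b f) = 0.
Proof.
apply: linear_ext => x; rewrite !hom_d2E linearZ_LR cdiffK.
by rewrite !scaler0.
Qed.

Fact hom_bd12 a b (f : homK (F a) (C b)) :
  homK_pre (fres_diff P a) (hom_d2 a b f) + hom_d2 a.+1 b (homK_pre (fres_diff P a) f) = 0.
Proof.
apply: linear_ext => x.
change (aunit R (sgn a) *: cdiff C b (f (fres_diff P a x)) +
  aunit R (sgn a.+1) *: cdiff C b (f (fres_diff P a x)) = 0).
by rewrite -scalerDl -rmorphD exprS mulN1r subrr rmorph0 scale0r.
Qed.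

Definition hom_bicomplex : bicomplex K :=
  @Bicomplex K (fun a b => homK (F a) (C b))
    (fun a b => homK_pre (fres_diff P a)) hom_d2
    (fun a b => @fres_diffK a (C b)) hom_bd22 hom_bd12.

Lemma sgnK a (V : lmodType R) (x : V) : aunit R (sgn a) *: (aunit R (sgn a) *: x) = x.
Proof. by rewrite scalerA -rmorphM -expr2 sqrr_sign rmorph1 scale1r. Qed.

Lemma hom_d2_eq0 a b (f : homK (F a) (C b)) :
  hom_d2 a b f = 0 <-> forall x, cdiff C b (f x) = 0.
Proof.
split=> [f0 x|f0]; last by apply: linear_ext => x; rewrite hom_d2E f0 scaler0.
by rewrite -[LHS](sgnK a) -hom_d2E f0 scaler0.
Qed.

Lemma hom_d2_lift a b (f : homK (F a) (C b.+1)) :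
  (forall x, exists u, cdiff C b u = f x) -> exists g, hom_d2 a b g = f.
Proof.
move=> /freemod_projective [g gf]; exists (sgn a *: (g : homK (F a) (C b))).
apply: linear_ext => x; rewrite hom_d2E homKZE linearZ_LR gf.
exact: sgnK.
Qed.

(** The rows are exact: a cocycle vanishes on the kernel of the cover, hence factors through a
    syzygy, and injectivity of [C b] extends it along [fincl]. In column 0 the same factorisation
    identifies the kernel with the maps from the resolved module. *)
Lemma injective_abutment : (forall n, injective_module (C n)) -> forall n : nat,
  lmod_iso (tot_cohomology hom_bicomplex n%:Z)
    (cohomology (map_cochain (hom_functor N) C) n).
Proof.
move=> C_inj n.
apply: (@edge_cohomology K hom_bicomplex (map_cochain (hom_functor N) C)
  (fun b => homK_pre (faug P 0))) => [b f g fg|b f|b f|a b f f0].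
- apply: linear_ext => x; have [y <-] := faug_surj x.
  exact: (congr1 (fun h : homK _ _ => h y) fg).
- apply: linear_ext => x; rewrite hom_d2E expr0 rmorph1.
  exact: scale1r.
- split=> [f0|[g <-]].
    have fker x : faug P 0 x = 0 -> f x = 0.
      move=> /faug_ker [y <-]; have [z <-] := faug_surj y.
      exact: (congr1 (fun h : homK _ _ => h z) f0).
    have [g gf] := linear_factor_surj (@faug_surj _ P 0) fker.
    by exists g; exact: linear_ext.
  apply: linear_ext => x.
  apply: etrans (congr1 g (faug_incl _)) _; exact: linear0.
- have fker x : faug P a.+1 x = 0 -> f x = 0.
    move=> /faug_ker [y <-]; have [z <-] := faug_surj y.
    exact: (congr1 (fun h : homK _ _ => h z) f0).
  have [g gf] := linear_factor_surj (@faug_surj _ P a.+1) fker.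
  have [h hg] := C_inj b _ _ (fincl P a) g (@fincl_inj _ P a).
  by exists h; apply: linear_ext => x; apply: etrans (hg _) (gf _).
Qed.

End HomBicomplex.

Section Balance.
Variables (K : fieldType) (R : algebra K) (P : free_resolution R) (V : lmodType R).
Local Notation N := (fsyz P 0).

(* Both edges of the bicomplex Hom(F, I), with I an injective resolution of V,
   are exact. *)
Lemma Ext_free_resolution (n : nat) :
  lmod_iso (Ext n N V) (cohomology (fres_cochain P V) n).
Proof.
have I_inj m : injective_module (injres V m) by exact: ires_injective.
apply: lmod_iso_trans (lmod_iso_sym (injective_abutment P I_inj n)) _.
apply: lmod_iso_trans (tot_cohomology_tr _ _) _.
pose eps b := homK_map (iaug (injres V)) : {linear homK (fres P b) V -> _}.
apply: (@edge_cohomology K (transpose (hom_bicomplex P (injres V))) (fres_cochain P V)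
  eps) => [b f g fg|b f|b f|a b f f0].
- apply: linear_ext => x; apply: (@iaug_inj _ _ (injres V)).
  exact: (congr1 (fun h : homK _ _ => h x) fg).
- exact: linear_ext.
- split=> [/hom_d2_eq0 f0|[g <-]].
    have fi x : exists v, iaug (injres V) v = f x by apply/ires_exact0.
    have [g gf] := linear_factor_inj (@iaug_inj _ _ (injres V)) fi.
    by exists g; exact: linear_ext.
  apply/hom_d2_eq0 => x; apply/ires_exact0.
  by exists (g x).
- apply: hom_d2_lift => x; apply/ires_exact.
  by move: x; apply/hom_d2_eq0.
Qed.
End Balance.

(** * The hyper-Ext spectral sequence *)

Section SecondPage.
Variables (K : fieldType) (R : algebra K) (P : free_resolution R) (C : cochain R).
Local Notation X := (hom_bicomplex P C).
Local Notation F := (fres P).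

Definition hom_ss : spectral_sequence K :=
  filtered_ss (@totK K X) (@filW K X) (@fil_neg K X) (@fil_gt K X).

Let filB p n x y : fil X p n x -> fil X p n y -> fil X p n (x - y).
Proof. by move=> hx hy; rewrite addrC -scaleN1r; apply: smemP. Qed.

(** Fixing the degree leaves (p, q) as the only entry in column p. *)
Lemma fil_next (p q : nat) (n : int) (x : biprod X) : p%:Z + q%:Z = n ->
  fil X p%:Z n x -> x p q = 0 -> fil X (p%:Z + 1) n x.
Proof.
move=> pqn hx xpq a b ab; have [ap|ap] := eqVneq a p; last by apply: hx; lia.
have [bq|bq] := eqVneq b q; first by rewrite ap bq.
by apply: hx; lia.
Qed.

Local Notation ev x p q t := ((x p q : homK (F p) (C q)) t).

Lemma tot1_lowest (p q : nat) (n : int) (x : biprod X) :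
  fil X p%:Z n x -> tot1 x p q = 0.
Proof. by case: p => //= p hx; rewrite hx ?linear0 //; lia. Qed.

Lemma coboundP q a (x y : C q) : cobound x -> cobound y -> cobound (a *: x + y).
Proof.
case: q x y => [|q] x y /=; first by move=> -> ->; rewrite scaler0 addr0.
by move=> [u <-] [v <-]; exists (a *: u + v); rewrite linearP.
Qed.

Lemma tot2_cobound (x : biprod X) (p q : nat) t : cobound (ev (tot2 x) p q t).
Proof.
case: q => [//|q]; exists (aunit R ((-1) ^+ p) *: ev x p q t).
by rewrite linearZ_LR.
Qed.

(** Since [F p] is free, a map with coboundary values is itself a coboundary; subtracting it empties
    column p and only disturbs column p + 1. *)
Lemma cancel_cobound (p q : nat) (n : int) (z : biprod X) : p%:Z + q%:Z = n ->
  fil X p%:Z n z -> (forall t, cobound (ev z p q t)) ->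
  exists2 v, fil X p%:Z (n - 1) v & fil X (p%:Z + 1) n (z - tot X v).
Proof.
case: q => [|q] pqn hz zB.
  exists 0; first exact: smem0.
  rewrite linear0 subr0; apply: fil_next pqn hz _; exact: linear_ext.
have [g gz] := hom_d2_lift zB; have [v [vg v0]] := @single_ex K X p q g.
have hv : fil X p%:Z (n - 1) v by move=> a b ab; apply: v0; lia.
exists v => //; apply: (fil_next pqn).
  by apply: filB => //; have := filD hv; rewrite subrK.
have Dv : tot2 v p q.+1 = z p q.+1 by apply: etrans gz; rewrite /= vg.
rewrite biprodBE totE Dv [tot1 _ _ _](_ : _ = 0) ?add0r ?subrr //.
exact: tot1_lowest hv.
Qed.

Section Position.
Variables p q : nat.
Let n : int := p%:Z + q%:Z.
Variable cl : C q -> cohomology C q.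
Hypothesis cm : class_map (fun x => cdiff C q x = 0) (@cobound R C q) cl.

Let cocycleP a (x y : C q) :
  cdiff C q x = 0 -> cdiff C q y = 0 -> cdiff C q (a *: x + y) = 0.
Proof. by move=> x0 y0; rewrite linearP x0 y0 scaler0 addr0. Qed.

(** Only the entry of [x] in its lowest column matters: its values are cocycles with classes given
    by [h]. *)
Definition page2_rel (x : biprod X) (h : homK (F p) (cohomology C q)) : Prop :=
  forall t, cdiff C q (ev x p q t) = 0 /\ h t = cl (ev x p q t).

Lemma page2_rel_linear a x y h h' : page2_rel x h -> page2_rel y h' ->
  page2_rel (a *: x + y) (a *: h + h').
Proof.
have [cl_lin _ _] := cm; move=> r r' t; rewrite biprodPE !homKPE.
have [x0 ->] := r t; have [y0 ->] := r' t.
by split; [exact: cocycleP|rewrite cl_lin].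
Qed.

(** Filtration p + 2 of [tot X x] means vanishing in two columns: column p yields cocycle values,
    and column p + 1 says that precomposition with the resolution differential gives
    coboundaries. *)
Lemma fcyc_components x : fcyc (tot X) (fil X) 2 p%:Z n x ->
  (forall t, cdiff C q (ev x p q t) = 0) /\
  (forall t, cobound (ev x p q (fres_diff P p t))).
Proof.
move=> [hx hDx]; split.
  apply/hom_d2_eq0; have := hDx p q.+1; rewrite totE (tot1_lowest _ hx) add0r.
  by apply; lia.
move=> t; have /(congr1 (fun f : homK (F p.+1) (C q) => f t)) : tot X x p.+1 q = 0.
  by apply: hDx; lia.
rewrite totE => /eqP; rewrite [X in X == _](_ : _ =
  ev x p q (fres_diff P p t) + ev (tot2 x) p.+1 q t) // addr_eq0 => /eqP ->.
rewrite -scaleN1r -[_ *: _]addr0; apply: coboundP; first exact: tot2_cobound.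
by case: (q) => //= m; exists 0; rewrite linear0.
Qed.

Lemma page2_rel_left x : fcyc (tot X) (fil X) 2 p%:Z n x ->
  exists2 h, cdiff (fres_cochain P (cohomology C q)) p h = 0 & page2_rel x h.
Proof.
move=> /fcyc_components [x0 xB]; have [cl_lin _ cl0] := cm.
have h_lin : linear (fun t : F p => cl (ev x p q t)).
  by move=> a t t'; rewrite linearP cl_lin.
exists (mk_linear h_lin) => //; apply: linear_ext => t.
by apply/cl0.
Qed.

(* The lift of [h] to cocycles becomes a cycle modulo columns >= p + 2 once its
   boundary in column p + 1 is cancelled. *)
Lemma page2_rel_right (h : homK (F p) (cohomology C q)) :
  cdiff (fres_cochain P (cohomology C q)) p h = 0 ->
  exists2 x, fcyc (tot X) (fil X) 2 p%:Z n x & page2_rel x h.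
Proof.
move=> h0; have [cl_lin _ cl0] := cm.
have [f fh] := freemod_lift_class h cm (linear0 _) cocycleP.
have [y [yf y0]] := @single_ex K X p q f.
have hy : fil X p%:Z n y by move=> a b ab; apply: y0; lia.
have Dy_q : tot X y p q.+1 = 0.
  rewrite totE (tot1_lowest _ hy) add0r /= yf; apply/hom_d2_eq0 => t.
  by have [] := fh t.
have hDy : fil X p.+1%:Z (n + 1) (tot X y).
  have E : p.+1%:Z = p%:Z + 1 by lia.
  by rewrite E; apply: fil_next Dy_q; [lia|exact: filD].
have [v hv hDyv] : exists2 v, fil X p.+1%:Z (n + 1 - 1) v &
    fil X (p.+1%:Z + 1) (n + 1) (tot X y - tot X v).
  apply: (@cancel_cobound p.+1 q) => // [|t]; first lia.
  have -> : ev (tot X y) p.+1 q t = f (fres_diff P p t).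
    rewrite totE [tot2 _ _ _](_ : _ = 0) ?addr0 /= ?yf //.
    by case: (q) y0 => //= m y0; rewrite y0 ?linear0 //; lia.
  have [fc fE] := fh (fres_diff P p t); apply/cl0 => //; rewrite fE.
  exact: (congr1 (fun g : homK (F p.+1) (cohomology C q) => g t) h0).
have hv' : fil X p%:Z n v.
  by rewrite -[n](addrK 1); apply: filW hv; lia.
exists (y - v).
  split; first exact: filB.
  rewrite (linearB (tot X)); have -> : p%:Z + 2%:Z = p.+1%:Z + 1 by lia.
  exact: hDyv.
move=> t; rewrite biprodBE yf [v p q](_ : _ = 0) ?subr0; last by apply: hv; lia.
by have [fc ->] := fh t.
Qed.

End Position.

(** The level of a bounding [v] is p + 1 - 2 = p - 1. Its entry in column p - 1 has cocycle values,
    and their classes bound [h]. Conversely a cochain bounding [h] lifts to cocycles by freeness;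
    the lift corrects [x] up to coboundary values, which [cancel_cobound] absorbs. For p = 0 there
    is no such column and [h] has to be zero. *)
Lemma page2_rel_bound (p q : nat) (cl : C q -> cohomology C q)
    (cm : class_map (fun x => cdiff C q x = 0) (@cobound R C q) cl)
    (x : biprod X) (h : homK (F p) (cohomology C q)) :
  fcyc (tot X) (fil X) 2 p%:Z (p%:Z + q%:Z) x -> page2_rel cl x h ->
  (fbnd (tot X) (fil X) 2 p%:Z (p%:Z + q%:Z) x <->
   @cobound K (fres_cochain P (cohomology C q)) p h).
Proof.
have [cl_lin _ cl0] := cm.
have cycP a (y z : C q) : cdiff C q y = 0 -> cdiff C q z = 0 ->
    cdiff C q (a *: y + z) = 0.
  by move=> y0 z0; rewrite linearP y0 z0 scaler0 addr0.
move=> [hx _] r; split.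
- move=> [v hv hxv].
  have Dv : (x - tot X v) p q = 0 by apply: hxv; lia.
  have xE t : ev x p q t = ev (tot1 v) p q t + ev (tot2 v) p q t.
    move/eqP: Dv; rewrite biprodBE subr_eq0 => /eqP ->.
    by rewrite totE.
  case: p h r hx hv hxv {Dv} xE => [|p] h r hx hv hxv xE.
    apply: linear_ext => t; have [x0 ->] := r t; apply/cl0 => //.
    by rewrite xE add0r; exact: tot2_cobound.
  have hv' : fil X p%:Z (p.+1%:Z + q%:Z - 1) v by apply: filW hv; lia.
  have v0 t : cdiff C q (ev v p q t) = 0.
    move: t; apply/hom_d2_eq0.
    have E : (x - tot X v) p q.+1 = 0 by apply: hxv; lia.
    move: E; rewrite biprodBE hx; last lia.
    by rewrite sub0r => /eqP; rewrite oppr_eq0 totE (tot1_lowest _ hv') add0r => /eqP.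
  have u_lin : linear (fun t : F p => cl (ev v p q t)).
    by move=> a t t'; rewrite linearP cl_lin.
  exists (mk_linear u_lin); apply: linear_ext => t; have [x0 ->] := r t.
  apply/esym/(class_map_eq cm cycP x0); first exact: v0.
  rewrite xE addrC addrA [- _ + _]addrC subrr add0r; exact: tot2_cobound.
- move=> hB.
  have [v [hv hDv vB]] : exists v, [/\ fil X (p%:Z + 1 - 2%:Z) (p%:Z + q%:Z - 1) v,
      fil X p%:Z (p%:Z + q%:Z) (tot X v) &
      forall t, cobound (ev (x - tot X v) p q t)].
    case: p h r hB hx => [|p] h r hB hx.
      exists 0; split; [exact: smem0|rewrite linear0; exact: smem0|move=> t].
      by have [x0 hE] := r t; rewrite linear0 subr0; apply/cl0 => //; rewrite -hE hB.
    have [u uh] := hB.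
    have [f fu] := freemod_lift_class u cm (linear0 _) cycP.
    have [v [vf v0]] := @single_ex K X p q f.
    have hv : fil X p%:Z (p.+1%:Z + q%:Z - 1) v by move=> a b ab; apply: v0; lia.
    exists v; split=> [||t].
    + by apply: filW hv; lia.
    + have -> : p.+1%:Z = p%:Z + 1 by lia.
      apply: (@fil_next p q.+1); first lia.
        by have := filD hv; rewrite subrK; have -> : p.+1%:Z = p%:Z + 1 by lia.
      rewrite totE (tot1_lowest _ hv) add0r /= vf; apply/hom_d2_eq0 => t.
      by have [] := fu t.
    have [x0 hE] := r t; have [f0 fE] := fu (fres_diff P p t).
    have -> : ev (x - tot X v) p.+1 q t = ev x p.+1 q t - f (fres_diff P p t).
      rewrite biprodBE totE [tot2 _ _ _](_ : _ = 0) ?addr0 /= ?vf //.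
      by case: (q) v0 => //= m v0; rewrite v0 ?linear0 //; lia.
    apply/(class_map_eq cm cycP x0 f0); rewrite -hE fE -uh.
    by [].
  have [w hw hxw] := cancel_cobound erefl (filB hx hDv) vB.
  exists (v + w); last by rewrite (linearD (tot X)) opprD addrA.
  rewrite -[v]scale1r; apply: smemP => //; apply: filW hw; lia.
Qed.

Lemma hom_ss_page2 (p q : nat) : lmod_iso (hom_ss 2%N p%:Z q%:Z)
  (cohomology (fres_cochain P (cohomology C q)) p).
Proof.
have [cl cm] := cohomology_is_subquot C q.
have page2 : is_subquot (fcyc (tot X) (fil X) 2 p%:Z (p%:Z + q%:Z))
    (fbnd (tot X) (fil X) 2 p%:Z (p%:Z + q%:Z)) (hom_ss 2%N p%:Z q%:Z).
  exact: subquot_is_subquot.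
apply: (subquot_iso (rel := page2_rel cl) page2
  (cohomology_is_subquot (fres_cochain P (cohomology C q)) p)).
- exact: smemP.
- by move=> a h h' h0 h0'; rewrite linearP h0 h0' scaler0 addr0.
- by move=> a x y h h'; apply: page2_rel_linear.
- by move=> x; apply: page2_rel_left.
- by move=> h; apply: page2_rel_right.
- by move=> x h Zx _; apply: page2_rel_bound.
Qed.

Lemma hom_ss_converges : (forall n, injective_module (C n)) ->
  converges_to hom_ss (fun n => cohomology (map_cochain (hom_functor (fsyz P 0)) C) n).
Proof.
move=> C_inj; apply: filtered_ss_converges => [p n x|n]; first exact: filD.
apply: is_subquot_iso (injective_abutment P C_inj n).
exact: tot_cohomology_is_subquot.
Qed.

End SecondPage.

Theorem hyperext_spectral_sequence (K : fieldType) (R : algebra K) (N : lmodType R)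
    (C : cochain R) : (forall n, injective_module (C n)) ->
  exists E : spectral_sequence K,
    (forall p q : nat, lmod_iso (E 2%N p%:Z q%:Z) (Ext p N (cohomology C q))) /\
    converges_to E (fun n => cohomology (map_cochain (hom_functor N) C) n).
Proof.
move=> C_inj; exists (hom_ss (standard_resolution N) C); split=> [p q|].
  apply: lmod_iso_trans (hom_ss_page2 _ _ _ _) _.
  exact: lmod_iso_sym (Ext_free_resolution (standard_resolution N) _ _).
exact: (@hom_ss_converges _ _ (standard_resolution N)).
Qed.

(** * Extension of balanced bilinear maps *)

Section LinearSystems.
Variables (K : fieldType) (P W : lmodType K).

Definition solves (eqn : P -> W -> Prop) (g : {linear P -> W}) :=
  forall c w, eqn c w -> g c = w.

(* Compactness: the consequences of the finite stages form the graph of a linear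
   map on a subspace of P, which extends to P. *)
Lemma directed_system_solvable (I : Type) (i0 : I) (eqn : I -> P -> W -> Prop) :
  (forall i j, exists k, (forall c w, eqn i c w -> eqn k c w) /\
                         (forall c w, eqn j c w -> eqn k c w)) ->
  (forall i, exists g, solves (eqn i) g) ->
  exists g, forall i, solves (eqn i) g.
Proof.
move=> dir sol.
pose U (u : P * W) := exists i, forall g, solves (eqn i) g -> g u.1 = u.2.
have U0 : U 0 by exists i0 => g _; rewrite linear0.
have UP a (u v : P * W) : U u -> U v -> U (a *: u + v).
  move=> [i iu] [j jv]; have [k [ik jk]] := dir i j; exists k => g gk.
  have gi : solves (eqn i) g by move=> c w /ik; exact: gk.
  have gj : solves (eqn j) g by move=> c w /jk; exact: gk.
  by rewrite linearP (iu g gi) (jv g gj).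
pose US := Submodule U0 UP.
pose p1 (u : submod_type US) : P := (val u).1.
pose p2 (u : submod_type US) : W := (val u).2.
have p1_lin : linear p1 by move=> a u v; rewrite /p1 linearP.
have p2_lin : linear p2 by move=> a u v; rewrite /p2 linearP.
have Uval (u : submod_type US) : U (val u) by apply/(@spredP _ _ US); exact: valP.
(* Two values forced for the same element are forced at a common stage, where an actual solution
   makes them equal. *)
have p1_inj : injective (mk_linear p1_lin).
  move=> u v /= uv; apply: val_inj.
  have [i iu] := Uval u; have [j jv] := Uval v; have [k [ik jk]] := dir i j.
  have [g gk] := sol k.
  have gu : g (val u).1 = (val u).2 by apply: iu => c w /ik; exact: gk.
  have gv : g (val v).1 = (val v).2 by apply: jv => c w /jk; exact: gk.
  move: gu gv; rewrite /p1 in uv; rewrite uv => ->.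
  by case: (val u) (val v) uv => [? ?] [? ?] /= -> ->.
have [g gE] := linear_extension (mk_linear p2_lin) p1_inj.
exists g => i c w icw.
have Ucw : U (c, w) by exists i => h /(_ _ _ icw).
have Ucw' : (c, w) \in spred US by exact/spredP.
exact: (gE (Sub (c, w) Ucw' : submod_type US)).
Qed.

End LinearSystems.

Section BalancedExtension.
Variable K : fieldType.

Definition bilinear_map (X L W : lmodType K) (f : X -> L -> W) :=
  (forall z, linear (f^~ z)) /\ (forall x, linear (f x)).

Definition balanced_at (X L W : lmodType K) (p : {linear X -> X}) (q : {linear L -> L})
    (f : X -> L -> W) := forall x z, f (p x) z = f x (q z).

Section BilinearClosure.
Variables (X L W : lmodType K) (f g : X -> L -> W).
Hypotheses (fb : bilinear_map f) (gb : bilinear_map g).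

Lemma bilinear_mapD : bilinear_map (fun x z => f x z + g x z).
Proof.
case: fb gb => fl fr [gl gr]; split=> [z a x y|x a z z'] /=.
  by rewrite fl gl scalerDr addrACA.
by rewrite fr gr scalerDr addrACA.
Qed.

Lemma bilinear_mapB : bilinear_map (fun x z => f x z - g x z).
Proof.
case: fb gb => fl fr [gl gr]; split=> [z a x y|x a z z'] /=.
  by rewrite fl gl lin_combB.
by rewrite fr gr lin_combB.
Qed.

Lemma bilinear_map_comp (X' L' : lmodType K) (p : {linear X' -> X}) (q : {linear L' -> L}) :
  bilinear_map (fun x z => f (p x) (q z)).
Proof.
case: fb => fl fr; split=> [z a x y|x a z z'] /=.
  by rewrite linearP fl.
by rewrite linearP fr.
Qed.
End BilinearClosure.

Variables (E : eqType) (X Y L W : lmodType K) (i : {linear X -> Y}).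
Variables (pX : E -> {linear X -> X}) (p : E -> {linear Y -> Y}) (q : E -> {linear L -> L}).
Hypothesis i_inj : injective i.
Hypothesis ip : forall e x, i (pX e x) = p e (i x).
Hypothesis pp : forall e x, p e (p e x) = p e x.
Hypothesis qq : forall e x, q e (q e x) = q e x.
Hypothesis pC : forall e e' x, p e (p e' x) = p e' (p e x).
Hypothesis qC : forall e e' x, q e (q e' x) = q e' (q e x).
Variable phi : X -> L -> W.
Hypothesis phi_bilin : bilinear_map phi.
Hypothesis phi_bal : forall e, balanced_at (pX e) (q e) phi.

(* A new idempotent e is taken care of by composing with the projection
   1 - (p (x) 1 - 1 (x) q)^2 of the tensor product. *)
Lemma finite_balanced_extension (l : seq E) : exists f : Y -> L -> W,
  [/\ bilinear_map f, forall x z, f (i x) z = phi x z &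
      forall e, e \in l -> balanced_at (p e) (q e) f].
Proof.
elim: l => [|e l [f [fb fi fl]]].
  (* With no idempotent to respect, a K-linear retraction of [i] suffices. *)
  have [r ri] := linear_extension (idfun : {linear X -> X}) i_inj.
  exists (fun y z => phi (r y) z); split=> // [|x z]; last by rewrite ri.
  exact: (bilinear_map_comp phi_bilin r idfun).
pose fp y z := f (p e y) z; pose fq y z := f y (q e z).
pose fpq y z := f (p e y) (q e z).
exists (fun y z => f y z - fp y z - fq y z + (fpq y z + fpq y z)); split.
- have fpqb : bilinear_map fpq by exact: bilinear_map_comp.
  apply: bilinear_mapD; last exact: bilinear_mapD.
  apply: bilinear_mapB; last exact: (bilinear_map_comp fb idfun (q e)).
  by apply: bilinear_mapB => //; exact: (bilinear_map_comp fb (p e) idfun).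
(* On the image of [i] the three corrections all equal [phi x (q e z)] and cancel. *)
- move=> x z; rewrite /fp /fq /fpq -!ip !fi (phi_bal e) (phi_bal e x (q e z)) qq.
  by rewrite addrA !subrK.
(* For the new idempotent both sides reduce to [fpq]; for the earlier ones balancedness survives
   because all the operators commute. *)
- move=> e'; rewrite inE => /predU1P [-> y z|e'l y z].
    rewrite /fp /fq /fpq /= pp qq subrr sub0r addKr.
    by rewrite [X in _ = X + _]addrAC subrr sub0r addKr.
  have bal := fl e' e'l; rewrite /fp /fq /fpq /=.
  by rewrite ![p e (p e' _)]pC ![q e (q e' _)]qC !bal.
Qed.

(** The unknown is a linear map on the free vector space on [Y * L], which makes bilinearity,
    extension of [phi] and balancedness linear equations. Only the last kind depends on [l]. *)
Inductive balanced_eqn (l : seq E) : freemod K (Y * L)%type -> W -> Prop :=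
| EqnL a y y' z : balanced_eqn l
    (gen K (a *: y + y', z) - (a *: gen K (y, z) + gen K (y', z))) 0
| EqnR a y z z' : balanced_eqn l
    (gen K (y, a *: z + z') - (a *: gen K (y, z) + gen K (y, z'))) 0
| EqnExt x z : balanced_eqn l (gen K (i x, z)) (phi x z)
| EqnBal e y z of e \in l : balanced_eqn l (gen K (p e y, z) - gen K (y, q e z)) 0.

Lemma balanced_eqnS (l l' : seq E) : {subset l <= l'} ->
  forall c w, balanced_eqn l c w -> balanced_eqn l' c w.
Proof.
move=> ll' c w [a y y' z|a y z z'|x z|e y z /ll' el].
- exact: EqnL.
- exact: EqnR.
- exact: EqnExt.
- exact: EqnBal.
Qed.

(** Finite lists of idempotents are directed under concatenation, so the finite case and
    [directed_system_solvable] give all idempotents at once. *)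
Lemma balanced_extension : exists f : Y -> L -> W,
  [/\ bilinear_map f, forall x z, f (i x) z = phi x z &
      forall e, balanced_at (p e) (q e) f].
Proof.
have [||g g_sol] := @directed_system_solvable _ _ _ (seq E) [::] balanced_eqn.
- by move=> l l'; exists (l ++ l'); split; apply: balanced_eqnS => e; rewrite mem_cat => ->;
    rewrite ?orbT.
- move=> l; have [f [[fl fr] fi fb]] := finite_balanced_extension l.
  exists (@free_lift K (Y * L)%type W (fun yz => f yz.1 yz.2)).
  move=> c w [a y y' z|a y z z'|x z|e y z el].
  + by rewrite linearB linearP !free_lift_gen fl subrr.
  + by rewrite linearB linearP !free_lift_gen fr subrr.
  + by rewrite free_lift_gen fi.
  + by rewrite linearB !free_lift_gen fb // subrr.
have gE c c' : g (c - c') = 0 -> g c = g c'.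
  by rewrite linearB => /eqP; rewrite subr_eq0 => /eqP.
exists (fun y z => g (gen K (y, z))); split=> [|x z|e y z].
- split=> [z a y y'|y a z z'].
    by rewrite -linearP; apply: gE; apply: (g_sol [::]); exact: EqnL.
  by rewrite -linearP; apply: gE; apply: (g_sol [::]); exact: EqnR.
- by apply: (g_sol [::]); exact: EqnExt.
- by apply: gE; apply: (g_sol [:: e]); apply: EqnBal; rewrite inE.
Qed.

End BalancedExtension.

(** * Maps out of an enveloping algebra *)

Lemma monoid_algebra_ind (K : fieldType) (G : monoidType)
    (Q : monoid_algebra K G -> Prop) :
  Q 0 -> (forall u v, Q u -> Q v -> Q (u + v)) ->
  (forall k g, Q (<< k *g g >> : {malg K[G]})) -> forall u, Q u.
Proof. exact: malg_ind. Qed.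

Section EnvelopingAlgebraMaps.
Variables (K : fieldType) (R : algebra K).
Local Notation RK := (resK (R^o : lmodType R)).

Lemma resKE (V : lmodType R) (k : K) (x : resK V) : k *: x = aunit R k *: (x : V).
Proof. by []. Qed.

Lemma env_ind (Q : env R -> Prop) :
  Q 0 -> (forall u v, Q u -> Q v -> Q (u + v)) -> (forall x y, Q (tens x y)) ->
  forall u, Q u.
Proof.
move=> Q0 QD Qt u; elim/rpiP: u => u; elim/monoid_algebra_ind: u => [|g h IH IH'|k [x y]].
- by rewrite rmorph0.
- by rewrite rmorphD; exact: QD.
have -> : rpi (@env_rel K R) (<< k *g ((x, y) : envmon R) >> : {malg K[envmon R]}) =
    tens (aunit R k * x) y; last exact: Qt.
rewrite tensKl [RHS](_ : _ = rpi (@env_rel K R)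
  (aunit (monoid_algebra K (envmon R)) k * tens0 x y)); last by rewrite rmorphM.
congr (rpi _ _); apply: esym; rewrite [LHS]skew_mulUU //.
by rewrite mulr1 mul1g.
Qed.

Lemma central_tens (M : lmodType (env R)) b x c (m : M) : tens c 1 *: m = tens 1 c *: m ->
  tens (b * (x * c)) 1 *: m = tens b c *: (tens x 1 *: m).
Proof.
move=> cm; rewrite tens_scaleA mul1r.
have -> : tens (b * (x * c)) 1 *: m = tens (b * x) 1 *: (tens c 1 *: m).
  by rewrite tens_scaleA mulr1 mulrA.
by rewrite cm tens_scaleA !mulr1.
Qed.

Variable W : lmodType K.
Implicit Type b : RK -> RK -> W.

Definition monalg_eval (b : RK -> RK -> W) (u : monoid_algebra K (envmon R)) : W :=
  msum (fun (g : envmon R) (k : K) => k *: b g.1 g.2) (u : {malg K[envmon R]}).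

Let eD b (g : envmon R) (k l : K) : (k + l) *: b g.1 g.2 = k *: b g.1 g.2 + l *: b g.1 g.2.
Proof. exact: scalerDl. Qed.

Lemma monalg_evalD b u v : monalg_eval b (u + v) = monalg_eval b u + monalg_eval b v.
Proof. exact: (msumD (eD b)). Qed.
Lemma monalg_evalU b k g : monalg_eval b (<< k *g g >> : {malg K[envmon R]}) = k *: b g.1 g.2.
Proof. exact: (msumU (eD b)). Qed.
Lemma monalg_eval0 b : monalg_eval b 0 = 0.
Proof. exact: (msum0 (eD b)). Qed.
Lemma monalg_evalB b u v : monalg_eval b (u - v) = monalg_eval b u - monalg_eval b v.
Proof. by apply: (addIr (monalg_eval b v)); rewrite -monalg_evalD !subrK. Qed.

Local Notation mono k c d := ((<< k *g ((c, d) : envmon R) >> : {malg K[envmon R]}) :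
  monoid_algebra K (envmon R)).

Lemma monalg_evalUM b k c d u :
  monalg_eval b (mono k c d * u) =
  k *: monalg_eval (fun x y => b (c * (x : R)) ((y : R) * d)) u.
Proof.
elim/monoid_algebra_ind: u => [|g h IH IH'|l [x y]].
- by rewrite mulr0 !monalg_eval0 scaler0.
- by rewrite (mulrDr (mono k c d) g h) 2!monalg_evalD scalerDr; congr (_ + _).
- by rewrite [X in monalg_eval b X]skew_mulUU // !monalg_evalU scalerA.
Qed.

Lemma monalg_evalMU b k c d u :
  monalg_eval b (u * mono k c d) =
  k *: monalg_eval (fun x y => b ((x : R) * c) (d * (y : R))) u.
Proof.
elim/monoid_algebra_ind: u => [|g h IH IH'|l [x y]].
- by rewrite mul0r !monalg_eval0 scaler0.
- by rewrite (mulrDl g h (mono k c d)) 2!monalg_evalD scalerDr; congr (_ + _).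
- by rewrite [X in monalg_eval b X]skew_mulUU // !monalg_evalU scalerA mulrC.
Qed.

Let mulK_linear (c d : R) : linear (fun x : RK => c * (x : R) * d : RK).
Proof.
move=> k x y; rewrite !resKE mulrDr mulrDl; congr (_ + _).
by rewrite /GRing.scale /= !mulrA -aunitC.
Qed.

Lemma bilinear_translate b c d c' d' : bilinear_map b ->
  bilinear_map (fun x y : RK => b (c * (x : R) * d) (c' * (y : R) * d')).
Proof.
move=> bb; exact: (bilinear_map_comp bb (mk_linear (mulK_linear c d))
  (mk_linear (mulK_linear c' d'))).
Qed.

(** All bilinear [b] are treated together, because multiplying by a monomial on either side replaces
    [b] by a translate. *)
Lemma monalg_eval_ideal u : ideal_gen (@env_rel K R) u ->
  forall b, bilinear_map b -> monalg_eval b u = 0.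
Proof.
move=> /(_ (fun v => forall b, bilinear_map b -> monalg_eval b v = 0)); apply; last first.
  move=> {}u + b [bl br].
  have bl' x x' y : b (x + x') y = b x y + b x' y by rewrite -[x]scale1r bl !scale1r.
  have br' x y y' : b x (y + y') = b x y + b x y' by rewrite -[y]scale1r br !scale1r.
  have bl0 y : b 0 y = 0 by apply: (addrI (b 0 y)); rewrite -bl' !addr0.
  have br0 x : b x 0 = 0 by apply: (addrI (b x 0)); rewrite -br' !addr0.
  have blZ k x y : b (aunit R k * (x : R)) y = k *: b x y.
    by have := bl y k x 0; rewrite bl0 !addr0.
  have brZ k x y : b x (aunit R k * (y : R)) = k *: b x y.
    by have := br x k y 0; rewrite br0 !addr0.
  have unitM k x y : monalg_eval b (aunit (monoid_algebra K (envmon R)) k * tens0 x y) =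
      k *: b x y.
    by rewrite monalg_evalUM monalg_evalU scale1r mul1r mulr1.
  case=> [x x' y|x y y'|k x y|k x y];
    rewrite monalg_evalB ?monalg_evalD ?unitM !monalg_evalU !scale1r /=.
  + by rewrite bl' subrr.
  + by rewrite br' subrr.
  + by rewrite blZ subrr.
  + by rewrite brZ subrr.
split=> [b _|x y hx hy b bb|a x hx b bb|a x hx b bb].
- exact: monalg_eval0.
- by rewrite monalg_evalD hx // hy // addr0.
- elim/monoid_algebra_ind: a => [|g h IH IH'|k [c d]]; first by rewrite mul0r monalg_eval0.
    by rewrite (mulrDl g h x) monalg_evalD [X in X + _]IH [X in _ + X]IH' addr0.
  rewrite monalg_evalUM hx ?scaler0 //.
  have := bilinear_translate c 1 1 d bb.
  by congr bilinear_map; do 2 apply: funext => ?; rewrite mulr1 mul1r.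
- elim/monoid_algebra_ind: a => [|g h IH IH'|k [c d]]; first by rewrite mulr0 monalg_eval0.
    by rewrite (mulrDr x g h) monalg_evalD [X in X + _]IH [X in _ + X]IH' addr0.
  rewrite monalg_evalMU hx ?scaler0 //.
  have := bilinear_translate 1 c d 1 bb.
  by congr bilinear_map; do 2 apply: funext => ?; rewrite mulr1 mul1r.
Qed.

(** Universal property of the tensor product over K, for its presentation as a quotient of a monoid
    algebra. *)
Lemma env_lift b : bilinear_map b ->
  exists h : {linear resK ((env R)^o : lmodType (env R)) -> W}, forall x y, h (tens x y) = b x y.
Proof.
move=> bb; pose h (u : resK ((env R)^o : lmodType (env R))) := monalg_eval b (rrepr (u : env R)).
have hE u : h (rpi (@env_rel K R) u) = monalg_eval b u.
  apply/eqP; rewrite -subr_eq0 -monalg_evalB; apply/eqP.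
  by apply: monalg_eval_ideal bb; exact: rrepr_pi.
have h_lin : linear h.
  move=> k; elim/rpiP => u; elim/rpiP => v.
  have -> : k *: (rpi (@env_rel K R) u : resK ((env R)^o : lmodType (env R))) +
      rpi (@env_rel K R) v =
      rpi (@env_rel K R) (aunit (monoid_algebra K (envmon R)) k * u + v).
    by rewrite rmorphD rmorphM.
  rewrite !hE monalg_evalD; congr (_ + _).
  rewrite monalg_evalUM; congr (_ *: monalg_eval _ _).
  by do 2 apply: funext => ?; rewrite mulr1 mul1r.
exists (mk_linear h_lin) => x y; rewrite [LHS]hE monalg_evalU.
exact: scale1r.
Qed.

End EnvelopingAlgebraMaps.

(** * Maps out of a crossed product *)

Lemma msumB (T : choiceType) (A V : zmodType) (f : T -> A -> V)
    (fD : forall t a b, f t (a + b) = f t a + f t b) (g h : {malg A[T]}) :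
  msum f (g - h) = msum f g - msum f h.
Proof. by apply: (addIr (msum f h)); rewrite -msumD // !subrK. Qed.

Section CrossedProductMaps.
Variables (K : fieldType) (S : inverseMonoidType) (A : algebra K).
Variable theta : unital_action S A.
Local Notation Lambda := (crossed theta).
Local Notation e := (ua_e theta).
Local Notation act := (ua_act theta).

Lemma ua_act_idem f a : idem f -> act f a = e f * a.
Proof.
move=> f_idem; have := ua_act_inv theta f a.
by rewrite (idemV f_idem) -ua_act_act (idemE f_idem).
Qed.

Lemma nat_le_mull (u s t : S) : nat_le s t -> nat_le (u * s)%g (u * t)%g.
Proof.
(* As f commutes with u^-1 u, one has u f = (u f u^-1) u. *)
move=> [f f_idem ->]; exists (u * f * sinv u)%g; first exact: idem_conj.
rewrite [RHS](_ : _ = (u * (f * (sinv u * u)) * t)%g); last by rewrite !mulgA.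
by rewrite (idemC f_idem (idem_mulVs u)) !mulgA mulsVs.
Qed.

Lemma nat_le_mulr (s t w : S) : nat_le s t -> nat_le (s * w)%g (t * w)%g.
Proof. by move=> [f f_idem ->]; exists f; rewrite // mulgA. Qed.

Lemma crossed_ind (Q : Lambda -> Prop) :
  Q 0 -> (forall x y, Q x -> Q y -> Q (x + y)) -> (forall s a, Q (cdelta theta s a)) ->
  forall x, Q x.
Proof.
move=> Q0 QD Qd x; elim/rpiP: x => x.
pose mono s a : Lalg theta := Sub << e s * a *g s >> (inLU (e_in_eA theta s a)).
have -> : x = \sum_(s <- msupp (val x)) mono s ((val x)@_s).
  apply: val_inj; rewrite raddf_sum [LHS]monalgE; apply: eq_bigr => s _ /=.
  by have /asboolP/(_ s)/in_eAP -> := valP x.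
rewrite rmorph_sum; apply: big_ind => // s _; exact: Qd.
Qed.

Lemma cdeltaD s a b : cdelta theta s (a + b) = cdelta theta s a + cdelta theta s b.
Proof.
rewrite -[RHS]rmorphD; congr (rpi _ _); apply: val_inj.
by rewrite /= mulrDr monalgUD.
Qed.

Lemma cdeltaK k s a : aunit Lambda k * cdelta theta s a = cdelta theta s (aunit A k * a).
Proof. by rewrite -ciotaK ciotaE cdeltaM mul1g ua_act1. Qed.

(** The extra factor 1_t inside [cdelta t] is harmless: s = f t gives 1_s = 1_f 1_t. *)
Lemma cdelta_le s t a : nat_le s t -> cdelta theta s a = cdelta theta t (e s * a).
Proof.
move=> st; apply/rpi_eq => I _; apply; exists s, t, (e s * a); split=> //.
  exact: e_in_eA.
case: st => f f_idem sE; rewrite /=; congr (<< _ *g _ >> - << _ *g _ >>).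
rewrite mulrA; congr (_ * _).
have -> : e s = e f * e t.
  by rewrite sE -ua_act_one ua_act_act ua_act_one ua_act_idem.
by rewrite mulrA ua_e_central -mulrA ua_e_idem.
Qed.

Variable W : lmodType K.

(** What the values on the classes of [a delta_s] must satisfy to come from a K-linear map out of
    the crossed product; [crossed_lift] shows that it is enough. *)
Definition crossed_datum (h : S -> A -> W) :=
  [/\ forall s a b, h s (a + b) = h s a + h s b,
      forall s k a, h s (aunit A k * a) = k *: h s a,
      forall s a, h s (e s * a) = h s a &
      forall s t a, nat_le s t -> h s a = h t (e s * a)].

(** Stability of data under translation, here and on the other side, makes the elements killed by
    every datum a two-sided ideal; this ideal contains the generators of N. *)
Lemma crossed_datum_mull h u b : crossed_datum h ->
  crossed_datum (fun s a => h (u * s)%g (b * act u a)).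
Proof.
move=> [hD hK he hle]; split=> [s a c|s k a|s a|s t a st].
- by rewrite ua_actD mulrDr hD.
- by rewrite ua_actK mulrA -aunitC -mulrA hK.
- rewrite ua_actM -ua_act_one -ua_act_act ua_act_one mulrA -ua_e_central -mulrA.
  exact: he.
- rewrite (hle _ _ _ (nat_le_mull u st)) ua_actM -[in RHS]ua_act_one -ua_act_act.
  by rewrite ua_act_one !mulrA ua_e_central.
Qed.

Lemma crossed_datum_mulr h w c : crossed_datum h ->
  crossed_datum (fun s a => h (s * w)%g (a * act s c)).
Proof.
move=> [hD hK he hle]; split=> [s a b|s k a|s a|s t a st].
- by rewrite mulrDl hD.
- by rewrite -mulrA hK.
- by rewrite -{2}(ua_act_inran theta s c) !mulrA ua_e_central.
- rewrite (hle _ _ _ (nat_le_mulr w st)) -(he (t * w)%g (e s * a * _)).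
  case: st => f f_idem ->; congr (h _ _).
  have fE x : e (f * x)%g = e f * e x.
    by rewrite -ua_act_one ua_act_act ua_act_one ua_act_idem.
  rewrite -mulgA !fE ua_act_act (ua_act_idem _ f_idem).
  have fC x : e f * x = x * e f by exact: ua_e_central.
  have tC x : e t * x = x * e t by exact: ua_e_central.
  have -> : a * (e f * act t c) = e f * (a * act t c) by rewrite !mulrA fC.
  have -> : e f * e t * a * act t c = e f * (a * act t c).
    by rewrite -!mulrA; congr (_ * _); rewrite mulrA tC -mulrA ua_act_inran.
  by rewrite fC -mulrA; congr (_ * _); rewrite mulrA ua_e_idem.
Qed.

Lemma msum_skew_mull h u b (g : {malg A[S]}) : crossed_datum h ->
  msum h (skew_mul act << b *g u >> g) = msum (fun s a => h (u * s)%g (b * act u a)) g.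
Proof.
move=> hh; have [hD _ _ _] := hh; have [hD' _ _ _] := crossed_datum_mull u b hh.
have aD := @ua_actD K S A theta.
elim/malg_ind: g => [|g g' IH IH'|a s]; first by rewrite skew_mul0r // !msum0.
  by rewrite skew_mulDr // !msumD // IH IH'.
by rewrite skew_mulUU // !msumU.
Qed.

Lemma msum_skew_mulr h w c (g : {malg A[S]}) : crossed_datum h ->
  msum h (skew_mul act g << c *g w >>) = msum (fun s a => h (s * w)%g (a * act s c)) g.
Proof.
move=> hh; have [hD _ _ _] := hh; have [hD' _ _ _] := crossed_datum_mulr w c hh.
have aD := @ua_actD K S A theta.
elim/malg_ind: g => [|g g' IH IH'|a s]; first by rewrite skew_mul0l // !msum0.
  by rewrite skew_mulDl // !msumD // IH IH'.
by rewrite skew_mulUU // !msumU.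
Qed.

Lemma crossed_datum_ideal x : ideal_gen (@N_gen K S A theta) x ->
  forall h, crossed_datum h -> msum h (val x) = 0.
Proof.
have aD := @ua_actD K S A theta.
move=> /(_ (fun y => forall h, crossed_datum h -> msum h (val y) = 0)); apply; last first.
  move=> _ [s [t [_ [st [a ->] ->]]]] h [hD _ he hle].
  by rewrite msumB // !msumU // he (hle _ _ _ st) subrr.
split=> [h [hD _ _ _]|y z hy hz h hh|a y hy h hh|a y hy h hh].
- by rewrite raddf0 msum0.
- by have [hD _ _ _] := hh; rewrite raddfD /= msumD // hy // hz // addr0.
- have [hD _ _ _] := hh; rewrite [val _]/=; elim/malg_ind: (val a) => [|g g' IH IH'|b u].
  + by rewrite skew_mul0l // msum0.
  + by rewrite skew_mulDl // msumD // IH IH' addr0.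
  + by rewrite msum_skew_mull // hy //; exact: crossed_datum_mull.
- have [hD _ _ _] := hh; rewrite [val _]/=; elim/malg_ind: (val a) => [|g g' IH IH'|b u].
  + by rewrite skew_mul0r // msum0.
  + by rewrite skew_mulDr // msumD // IH IH' addr0.
  + by rewrite msum_skew_mulr // hy //; exact: crossed_datum_mulr.
Qed.

Lemma crossed_lift h : crossed_datum h ->
  exists H : {linear resK (Lambda^o : lmodType Lambda) -> W},
    forall s a, H (cdelta theta s a) = h s a.
Proof.
move=> hh; have [hD hK he _] := hh.
pose H (x : resK (Lambda^o : lmodType Lambda)) := msum h (val (rrepr (x : Lambda))).
have HE x : H (rpi (@N_gen K S A theta) x) = msum h (val x).
  apply/eqP; rewrite -subr_eq0; apply/eqP.
  rewrite -(crossed_datum_ideal (rrepr_pi (P := @N_gen K S A theta) x) hh) raddfB /= msumB //.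
have H_lin : linear H.
  move=> k; elim/rpiP => x; elim/rpiP => y.
  have -> : k *: (rpi (@N_gen K S A theta) x : resK (Lambda^o : lmodType Lambda)) +
      rpi (@N_gen K S A theta) y = rpi (@N_gen K S A theta) (L_unit theta k * x + y).
    by rewrite rmorphD rmorphM.
  rewrite !HE raddfD /= msumD //; congr (_ + _).
  rewrite msum_skew_mull //.
  elim/malg_ind: (val x) => [|g g' IH IH'|b u].
  - by rewrite !msum0 ?scaler0 // => s a b; rewrite ua_actD mulrDr hD.
  - rewrite !msumD ?IH ?IH' ?scalerDr // => s a b; by rewrite ua_actD mulrDr hD.
  - rewrite !msumU //; last by move=> s a c; rewrite ua_actD mulrDr hD.
    by rewrite mul1g ua_act1 hK.
exists (mk_linear H_lin) => s a; rewrite [LHS]HE msumU //.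
Qed.

End CrossedProductMaps.

(** * T1 of a coinduced module is injective *)

Section MonoidAlgebraModules.
Variables (K : fieldType) (G : monoidType).
Local Notation KG := (monoid_algebra K G).

Definition mgen (g : G) : KG := (<< 1 *g g >> : {malg K[G]}).

Lemma mgenM g h : mgen (g * h)%g = mgen g * mgen h.
Proof. by apply: esym; rewrite [LHS]skew_mulUU // mul1r. Qed.

Lemma mgen_scaleM (V : lmodType KG) g h (v : V) :
  mgen (g * h)%g *: v = mgen g *: (mgen h *: v).
Proof. by rewrite mgenM scalerA. Qed.

Lemma monoid_algebra_linear (X Y : lmodType KG) (f : X -> Y) :
  (forall k x y, f (aunit KG k *: x + y) = aunit KG k *: f x + f y) ->
  (forall g x, f (mgen g *: x) = mgen g *: f x) -> linear f.
Proof.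
move=> f_lin fg.
have fD x y : f (x + y) = f x + f y.
  by have := f_lin 1 x y; rewrite rmorph1 !scale1r.
have f0 : f 0 = 0 by apply: (addrI (f 0)); rewrite -fD !addr0.
have fZ k x : f (aunit KG k *: x) = aunit KG k *: f x.
  by have := f_lin k x 0; rewrite f0 !addr0.
move=> u x y; rewrite fD; congr (_ + _).
elim/monoid_algebra_ind: u => [|u v IH IH'|k g]; first by rewrite !scale0r.
  by rewrite !scalerDl fD IH IH'.
have -> : (<< k *g g >> : {malg K[G]}) = aunit KG k * mgen g :> KG.
  by apply: esym; rewrite [LHS]skew_mulUU // mulr1 mul1g.
by rewrite -!scalerA fZ fg.
Qed.

Lemma repmod_mgen (V : linrep K G) g (v : repmod V) : mgen g *: v = rep g (v : V) :> V.
Proof. by have := repmod_scaleU 1 g v; rewrite scale1r; apply. Qed.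

Lemma repmod_aunit (V : linrep K G) k (v : repmod V) : aunit KG k *: v = k *: (v : V) :> V.
Proof. by have := repmod_scaleU k 1%g v; rewrite rep1; apply. Qed.

Lemma mgen_resK_linear (V : lmodType KG) g : linear (fun v : resK V => mgen g *: (v : V) : resK V).
Proof. by move=> k x y; rewrite scalerDr !resKE aunit_scaleC. Qed.

End MonoidAlgebraModules.

Section CoinducedEvaluation.
Variables (K : fieldType) (B : algebra K) (W : lmodType B).
Local Notation M := (coind W : lmodType B).

Lemma coindDE (m m' : M) (v : B) :
  ((m + m' : M) : coind W) v = (m : coind W) v + (m' : coind W) v.
Proof. by []. Qed.

Lemma coindZE (u : B) (m : M) (v : B) : ((u *: m : M) : coind W) v = (m : coind W) (v * u).
Proof. by []. Qed.

Lemma coind_unit k (m : M) (v : B) :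
  (m : coind W) (aunit B k * v) = k *: ((m : coind W) v : resK W).
Proof. exact: (linearZ_LR (m : coind W)). Qed.

Lemma coindKE k (m : M) (v : B) :
  ((aunit B k *: m : M) : coind W) v = k *: ((m : coind W) v : resK W).
Proof. by rewrite coindZE -aunitC coind_unit. Qed.
End CoinducedEvaluation.

(** * Elements of a coinduced bimodule as bilinear maps *)

Section CoinducedBimodule.
Variables (K : fieldType) (R : algebra K) (W : lmodType (env R)).
Local Notation M := (coind W : lmodType (env R)).
Local Notation WK := (resK W).
Local Notation RK := (resK (R^o : lmodType R)).
Implicit Types (m : M) (x y : R).

(** In this form c (x) d acts by multiplying the inner sides, x c and d y, so commuting with c means
    being balanced over c. *)
Definition bev (m : M) (x y : R) : WK := (m : coind W) (tens x y).

Lemma bevP k m m' x y :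
  bev (aunit (env R) k *: m + m') x y = k *: bev m x y + bev m' x y.
Proof.
by rewrite /bev coindDE coindKE.
Qed.

Lemma bev_tens c d m x y : bev (tens c d *: m) x y = bev m (x * c) (d * y).
Proof. by rewrite /bev coindZE tensM. Qed.

Lemma bev_central c m x y : tens c 1 *: m = tens 1 c *: m ->
  bev m (x * c) y = bev m x (c * y).
Proof.
move=> /(congr1 (fun m' => bev m' x y)).
by rewrite !bev_tens (mulr1 x) (mul1r y).
Qed.

Lemma bev_bilinear m : bilinear_map (bev m : RK -> RK -> WK).
Proof.
have KE k (x : R) : k *: (x : RK) = aunit R k * x :> R by [].
split=> [z k x y|x k y z]; rewrite /bev KE.
  by rewrite tensDl linearD tensKl coind_unit.
by rewrite tensDr linearD tensKr coind_unit.
Qed.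

Lemma bev_ext m m' : (forall x y, bev m x y = bev m' x y) -> m = m'.
Proof.
move=> mm'; apply: linear_ext; elim/env_ind => [|u v IH IH'|x y]; last exact: mm'.
  by rewrite !linear0.
by rewrite !linearD IH IH'.
Qed.

Lemma bev_centralP c m : (forall x y, bev m (x * c) y = bev m x (c * y)) ->
  tens c 1 *: m = tens 1 c *: m.
Proof. by move=> h; apply: bev_ext => x y; rewrite 2!bev_tens mulr1 mul1r. Qed.

Lemma bev_lift (b : RK -> RK -> WK) : bilinear_map b ->
  exists m, forall x y, bev m x y = b x y.
Proof. by move=> /env_lift [m mE]; exists m. Qed.

End CoinducedBimodule.

(** * Bimodule maps out of A, through their value at 1 *)

Section T1Evaluation.
Variables (K : fieldType) (S : inverseMonoidType) (A : algebra K).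
Variable theta : unital_action S A.
Local Notation Lambda := (crossed theta).
Local Notation act := (ua_act theta).
Local Notation cdelta := (cdelta theta).
Local Notation ciota := (ciota theta).
Variable M : lmodType (env Lambda).

Lemma T1_left (t : T1_space M) a :
  t (a : Aenv A) = tens (ciota a) 1 *: (t (1 : A) : M) :> M.
Proof.
have := resA_linear_bi t a (1 : A) (1 : A); rewrite rmorph1 => <-.
by rewrite !mulr1.
Qed.
Lemma T1_right (t : T1_space M) a :
  t (a : Aenv A) = tens 1 (ciota a) *: (t (1 : A) : M) :> M.
Proof.
have := resA_linear_bi t (1 : A) (1 : A) a; rewrite rmorph1 => <-.
by rewrite !mul1r.
Qed.

(** Here s^-1 sends 1 to 1_(s^-1) rather than to 1, but [delta_s] absorbs this factor. *)
Lemma T1_act_at1 (t : T1_space M) s :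
  T1_act s t (1 : A) = tens (cdelta s 1) (cdelta (sinv s) 1) *: (t (1 : A) : M) :> M.
Proof.
apply: etrans (congr1 (fun m : M => S_act s m) (T1_left t (act (sinv s) 1))) _.
apply: etrans (tens_scaleA _ _ _ _ _) _.
by rewrite mul1r cdelta_iota_l ciotaE cdeltaM mul1g ua_act1 mulr1.
Qed.

Lemma T1_eq_at1 (t t' : T1_space M) : t (1 : A) = t' (1 : A) -> t = t'.
Proof.
move=> tt'; apply: linear_ext => a.
apply: etrans (T1_left t a) _; apply: etrans _ (esym (T1_left t' a)).
by rewrite tt'.
Qed.

Lemma T1_of_central (x : M) :
  (forall c, tens (ciota c) 1 *: x = tens 1 (ciota c) *: x) ->
  exists t : T1_space M, t (1 : A) = x.
Proof.
move=> x_central; pose t (a : Aenv A) : resA M := tens (ciota (a : A)) 1 *: x.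
have t_lin : linear t.
  apply: (@env_mod_linear _ _ (regular_bimodule A) (resA_bimodule M)) => [a b|b a c].
    by rewrite /t rmorphD tensDl scalerDl.
  apply: etrans _ (esym (resA_biE _ _ _)).
  by rewrite /t !rmorphM; exact: central_tens.
by exists (mk_linear t_lin); rewrite /= /t rmorph1 tens1 scale1r.
Qed.

End T1Evaluation.

Section CoinducedT1.
Variables (K : fieldType) (S : inverseMonoidType) (A : algebra K).
Variable theta : unital_action S A.
Local Notation Lambda := (crossed theta).
Local Notation e := (ua_e theta).
Local Notation act := (ua_act theta).
Local Notation cdelta := (cdelta theta).
Local Notation ciota := (ciota theta).
Variable W : lmodType (env Lambda).
Local Notation M := (coind W : lmodType (env Lambda)).
Local Notation WK := (resK W).
Local Notation LK := (resK (Lambda^o : lmodType Lambda)).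

Lemma ua_e_mulsV s : e (s * sinv s)%g = e s.
Proof.
have := ua_e_mul theta (s * sinv s)%g s; rewrite mulsVs => <-.
by rewrite -(ua_e_central theta s) ua_e_mul.
Qed.

Lemma cdelta_idem f a : idem f -> cdelta f a = ciota (e f * a).
Proof.
move=> f_idem; rewrite ciotaE; apply: cdelta_le.
by exists f => //; rewrite mulg1.
Qed.

Definition ev (t : T1_space M) : Lambda -> Lambda -> WK := bev (t (1 : A) : M).

Lemma ev_iota t x a y : ev t (x * ciota a) y = ev t x (ciota a * y).
Proof.
apply: bev_central; exact: etrans (esym (T1_left t a)) (T1_right t a).
Qed.

Lemma ev_act t s x y :
  ev (T1_act s t) x y = ev t (x * cdelta s 1) (cdelta (sinv s) 1 * y).
Proof.
exact: etrans (congr1 (fun m : M => bev m x y) (T1_act_at1 t s)) (bev_tens _ _ _ _ _).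
Qed.

(** The first argument can always be made 1, at the price of acting by s: the product of
    [delta_(s^-1)] and [a delta_s] lies in the image of [A], and [ev t] is balanced over [A]. *)
Lemma ev_cdelta t s a y : ev t (cdelta s a) y = ev (T1_act s t) 1 (cdelta s a * y).
Proof.
rewrite ev_act mul1r mulrA cdeltaM mul1r.
rewrite (cdelta_idem _ (idem_mulVs s)) -ev_iota.
have -> : e (sinv s * s)%g = e (sinv s) by rewrite -{2}(sinvK s) ua_e_mulsV.
by rewrite ua_act_inran cdelta_iota_l ciotaE cdeltaM mul1g ua_act1 mulr1.
Qed.

(** [delta_g] is the class of 1_g in [A], so both copies of it can be gathered in the second
    argument. *)
Lemma ev_idem t g z : idem g -> ev (T1_act g t) 1 z = ev t 1 (cdelta g 1 * z).
Proof.
move=> g_idem; rewrite ev_act mul1r (idemV g_idem).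
have gE := cdelta_idem 1 g_idem.
rewrite {1}gE -[ciota (e g * 1)]mul1r ev_iota -gE mulrA cdelta1M.
by rewrite (idemE g_idem).
Qed.

Lemma T1_ext (t t' : T1_space M) :
  (forall s a y, ev t (cdelta s a) y = ev t' (cdelta s a) y) -> t = t'.
Proof.
move=> tt'; apply: T1_eq_at1; apply: bev_ext => x y.
have [bl _] := bev_bilinear (t (1 : A) : M).
have [bl' _] := bev_bilinear (t' (1 : A) : M).
elim/crossed_ind: x => [|x x' IH IH'|s b]; last exact: tt'.
  have E (b : LK -> WK) : linear b -> b 0 = 0.
    by move=> b_lin; exact: (linear0 (mk_linear b_lin)).
  by rewrite (E _ (bl y)) (E _ (bl' y)).
have := bl y 1 x x'; have := bl' y 1 x x'; rewrite !scale1r => -> ->.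
by rewrite IH IH'.
Qed.

Lemma T1_mgen (t : T1 theta M) s : mgen K s *: t = T1_act s (t : T1_space M) :> T1_space M.
Proof. exact: (@repmod_mgen _ _ (T1_rep M)). Qed.

Lemma ev_lin k (t t' : T1 theta M) x y :
  ev (aunit (monoid_algebra K S) k *: t + t' : T1 theta M) x y = k *: ev t x y + ev t' x y.
Proof.
have kt : aunit (monoid_algebra K S) k *: t = k *: (t : T1_space M) :> T1_space M.
  exact: (@repmod_aunit _ _ (T1_rep M)).
have E : (aunit (monoid_algebra K S) k *: t + t' : T1_space M) (1 : A) =
    aunit (env Lambda) k *: ((t : T1_space M) (1 : A) : M) + ((t' : T1_space M) (1 : A) : M) :> M.
  apply: etrans (congr1 (fun u : T1_space M => (u + (t' : T1_space M)) (1 : A)) kt) _.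
  exact: (congr1 (fun u : M => u + ((t' : T1_space M) (1 : A) : M)) (resA_K k _)).
exact: etrans (congr1 (fun m : M => bev m x y) E) (bevP _ _ _ _ _).
Qed.

Lemma cdelta_conj_idem t g a : idem g ->
  cdelta (t * g * sinv t)%g 1 * cdelta t a = cdelta t a * cdelta g 1.
Proof.
move=> g_idem; set f := (t * g * sinv t)%g.
have f_idem : idem f by exact: idem_conj.
have ft : (f * t = t * g)%g.
  by rewrite /f -!mulgA (idemC g_idem (idem_mulVs t)) !mulgA mulsVs.
have ftg : (f * (t * g) = t * g)%g by rewrite mulgA ft -mulgA idemE.
rewrite !cdeltaM mul1r (ua_act_idem theta _ f_idem) ua_act_one ft.
rewrite -[LHS]cdelta_proj -[RHS]cdelta_proj; congr (cdelta _ _).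
have /= ef := ua_e_mul theta f (t * g)%g; rewrite ftg in ef.
have et := ua_e_mul theta t g.
rewrite mulrA -(ua_e_central theta f) ef.
by rewrite -(ua_e_central theta t) mulrA -(ua_e_central theta t) et.
Qed.

Lemma mulL_linear (c : Lambda) : linear (fun z : LK => c * (z : Lambda) : LK).
Proof.
move=> k x y; apply: etrans (mulrDr _ _ _) _; congr (_ + _).
apply: etrans (mulrA c (aunit Lambda k) x) _.
apply: etrans (congr1 ( *%R^~ (x : Lambda)) (esym (aunitC k c))) _.
exact: esym (mulrA (aunit Lambda k) c x).
Qed.

Lemma linear_at0 (U V : lmodType K) (f : U -> V) : linear f -> f 0 = 0.
Proof. by move=> f_lin; exact: (linear0 (mk_linear f_lin)). Qed.

Section BalancedMaps.
Variables (V : lmodType (monoid_algebra K S)) (psi : resK V -> LK -> WK).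
Hypothesis psi_bilin : bilinear_map psi.
Hypothesis psi_bal : forall g (v : V) (z : Lambda), idem g ->
  psi (mgen K g *: v) z = psi v (cdelta g 1 * z).
Variable v : V.

Let psi_rD (u : V) (x y : Lambda) : psi u (x + y) = psi u x + psi u y.
Proof.
have [_ br] := psi_bilin.
by apply: etrans (etrans (br u 1 x y) _); rewrite ?scale1r.
Qed.

Let psi_rK (u : V) k (x : Lambda) : psi u (aunit Lambda k * x) = k *: psi u x.
Proof.
have [_ br] := psi_bilin; have := br u k x 0.
by rewrite (linear_at0 (br u)) !addr0; apply.
Qed.

(** The formula is the one forced by [ev_cdelta]. For s = f t, compatibility with the natural order
    is balancedness at the idempotent f. *)
Lemma balanced_datum (y : Lambda) :
  crossed_datum theta (fun s a => psi (mgen K s *: v) (cdelta s a * y)).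
Proof.
split=> [s a b|s k a|s a|s t a st].
- by rewrite cdeltaD mulrDl psi_rD.
- by rewrite -cdeltaK -mulrA psi_rK.
- by rewrite cdelta_proj.
- rewrite -(cdelta_le theta a st); case: st => f f_idem sE.
  rewrite {1}sE mgen_scaleM psi_bal // mulrA cdeltaM mul1r (ua_act_idem theta _ f_idem).
  have fs : (f * s = s)%g by rewrite sE mulgA idemE.
  have ef := ua_e_mul theta f s; rewrite fs in ef.
  by rewrite fs -[cdelta s (e f * a)]cdelta_proj mulrA -(ua_e_central theta f) ef cdelta_proj.
Qed.

Lemma balanced_coind : exists m : M, forall s a y,
  bev m (cdelta s a) y = psi (mgen K s *: v) (cdelta s a * y).
Proof.
pose H (y : Lambda) := sval (cid (crossed_lift (balanced_datum y))).
have HE y s a : H y (cdelta s a) = psi (mgen K s *: v) (cdelta s a * y).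
  exact: (svalP (cid (crossed_lift (balanced_datum y))) s a).
have b_bilin : bilinear_map (fun x y : LK => H y x).
  split=> [y|x]; first exact: linearP.
  move=> k y y'; elim/crossed_ind: x => [|x x' IH IH'|s a].
  - by rewrite !linear0 ?scaler0 addr0.
  - by rewrite !linearD IH IH' ?scalerDr addrACA.
  rewrite !HE -psi_rK -psi_rD; congr (psi _ _).
  exact: mulL_linear.
have [m mE] := bev_lift b_bilin.
by exists m => s a y; rewrite mE.
Qed.

(** Multiplying [a delta_s] by an element of [A] keeps s, and for fixed s the value depends only on
    the product of the two arguments; hence the form is balanced over [A]. *)
Lemma balanced_T1 : exists t : T1_space M, forall s a y,
  ev t (cdelta s a) y = psi (mgen K s *: v) (cdelta s a * y).
Proof.
have [m mE] := balanced_coind.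
have m_central c : tens (ciota c) 1 *: m = tens 1 (ciota c) *: m.
  apply: bev_centralP => x y.
  have [bl _] := bev_bilinear m.
  elim/crossed_ind: x => [|x x' IH IH'|s a].
  - by rewrite mul0r (linear_at0 (bl y)) (linear_at0 (bl (ciota c * y))).
  - have bD z x1 x2 : bev m (x1 + x2) z = bev m x1 z + bev m x2 z.
      by have := bl z 1 x1 x2; rewrite !scale1r.
    by rewrite mulrDl !bD IH IH'.
  - rewrite mE mulrA ciotaE cdeltaM mulg1 mE.
    by [].
have [t tE] := T1_of_central m_central.
exists t => s a y; rewrite -mE; exact: (congr1 (fun m' : M => bev m' _ _) tE).
Qed.
End BalancedMaps.

(* A map f : X -> T1 (coind W) is determined by the balanced bilinear map
   (v, z) |-> ev (f v) 1 z, by [ev_cdelta]. *)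
Lemma T1_coind_injective : injective_module (T1 theta M).
Proof.
move=> X Y i f i_inj.
pose act_lin (V : lmodType (monoid_algebra K S)) (g : idempotents S) : {linear resK V -> resK V} :=
  mk_linear (mgen_resK_linear (V:=V) (val g)).
pose q (g : idempotents S) : {linear LK -> LK} := mk_linear (mulL_linear (cdelta (val g) 1)).
pose phi (v : resK X) (z : LK) : WK := ev (f (v : X) : T1_space M) 1 (z : Lambda).
have phi_act s v z : phi (mgen K s *: (v : X)) z = ev (T1_act s (f (v : X))) 1 z.
  by rewrite /phi linearZ_LR T1_mgen.
have phi_bilin : bilinear_map phi.
  split=> [z k u v|v].
    apply: etrans _ (ev_lin k (f (u : X)) (f (v : X)) 1 z).
    by rewrite /phi resKE linearP.
  by have [_] := bev_bilinear ((f (v : X) : T1_space M) (1 : A) : M); apply.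
have phi_bal g : balanced_at (act_lin X g) (q g) phi.
  move=> v z; apply: etrans (phi_act _ _ _) _.
  exact: (ev_idem _ _ (valP g)).
have idem_act_lin (V : lmodType (monoid_algebra K S)) g x :
    act_lin V g (act_lin V g x) = act_lin V g x.
  by rewrite /= -mgen_scaleM (idemE (valP g)).
have act_linC (V : lmodType (monoid_algebra K S)) g g' x :
    act_lin V g (act_lin V g' x) = act_lin V g' (act_lin V g x).
  by rewrite /= -!mgen_scaleM (idemC (valP g) (valP g')).
have qq g z : q g (q g z) = q g z.
  by rewrite /= mulrA cdelta1M (idemE (valP g)).
have qC g g' z : q g (q g' z) = q g' (q g z).
  by rewrite /= !mulrA !cdelta1M (idemC (valP g) (valP g')).
have [psi [psi_bilin psi_ext psi_bal]] := @balanced_extension K (idempotents S)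
  (resK X) (resK Y) LK WK (mk_linear (resK_linear i)) (act_lin X) (act_lin Y) q i_inj
  (fun g x => linearZ_LR i _ _) (idem_act_lin Y) qq (act_linC Y) qC phi phi_bilin phi_bal.
have psi_bal' g (v : Y) (z : Lambda) : idem g ->
    psi (mgen K g *: v) z = psi v (cdelta g 1 * z).
  by move=> g_idem; have := psi_bal (Sub g g_idem) v z.
pose g v := sval (cid (balanced_T1 psi_bilin psi_bal' v)).
have gE v s a y : ev (g v) (cdelta s a) y = psi (mgen K s *: v) (cdelta s a * y).
  exact: (svalP (cid (balanced_T1 psi_bilin psi_bal' v)) s a y).
have g_lin : linear (g : Y -> T1 theta M).
  apply: monoid_algebra_linear => [k u v|s v]; apply: T1_ext => t a y.
    have [bl _] := psi_bilin.
    apply: etrans _ (esym (ev_lin k (g u) (g v) _ _)).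
    rewrite !gE -bl; congr (psi _ _).
    exact: (mgen_resK_linear t k u v).
  apply: etrans _ (esym (congr1 (fun u : T1_space M => ev u (cdelta t a) y) (T1_mgen (g v) s))).
  rewrite gE ev_act -mgen_scaleM cdeltaM gE -cdeltaM mulrA -[in RHS](mulrA (cdelta t a)) cdelta1M.
  (* The factor [delta_(s s^-1)] passes to the left of [a delta_t] as the conjugate idempotent (t
     s)(t s)^-1, and balancedness moves it onto (t s) v, which it fixes. *)
  have ss_idem := idem_mulsV s.
  rewrite -(cdelta_conj_idem _ _ ss_idem) -mulrA -psi_bal'; last exact: idem_conj.
  congr (psi _ _); rewrite -mgen_scaleM; congr (mgen K _ *: _).
  have -> : (t * (s * sinv s) * sinv t = (t * s) * sinv (t * s))%g by rewrite sinvM !mulgA.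
  by rewrite mulsVs.
exists (mk_linear g_lin) => x; apply: T1_ext => s a y.
apply: etrans (gE _ _ _ _) _; rewrite ev_cdelta -phi_act -psi_ext.
by congr (psi _ _); rewrite /= linearZ_LR.
Qed.

End CoinducedT1.

(** * Central elements and the abutment *)

Lemma cohomology_iso (R : pzRingType) (C C' : cochain R)
    (rel : forall n, C n -> C' n -> Prop) :
  (forall n a x y x' y', rel n x x' -> rel n y y' -> rel n (a *: x + y) (a *: x' + y')) ->
  (forall n x, exists x', rel n x x') -> (forall n x', exists x, rel n x x') ->
  (forall n x x', rel n x x' -> (x = 0 <-> x' = 0)) ->
  (forall n x x', rel n x x' -> rel n.+1 (cdiff C n x) (cdiff C' n x')) ->
  forall n, lmod_iso (cohomology C n) (cohomology C' n).
Proof.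
move=> rlin rtot rsurj r0 rd n.
have rB m x y x' y' : rel m x x' -> rel m y y' -> rel m (x - y) (x' - y').
  by move=> h h'; rewrite ![_ - _]addrC -!scaleN1r; apply: rlin.
apply: (subquot_iso (rel := rel n) (cohomology_is_subquot C n)
  (cohomology_is_subquot C' n)).
- by move=> a x y x0 y0; rewrite linearP x0 y0 scaler0 addr0.
- by move=> a x y x0 y0; rewrite linearP x0 y0 scaler0 addr0.
- by move=> a x y x' y'; exact: rlin.
- by move=> x x0; have [x' r] := rtot n x; exists x' => //; apply/(r0 _ _ _ (rd _ _ _ r)).
- by move=> x' x0; have [x r] := rsurj n x'; exists x => //; apply/(r0 _ _ _ (rd _ _ _ r)).
- move=> x x' _ _ r; case: n x x' r => [|n] x x' r /=; first exact: r0 r.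
  split=> [[u ux]|[u' ux']].
    have [u' s] := rtot n u; exists u'; apply/eqP; rewrite -subr_eq0; apply/eqP.
    apply/(r0 n.+1 (cdiff C n u - x)); first exact: rB (rd _ _ _ s) r.
    by rewrite ux subrr.
  have [u s] := rsurj n u'; exists u; apply/eqP; rewrite -subr_eq0; apply/eqP.
  apply/(r0 n.+1 _ (cdiff C' n u' - x')); first exact: rB (rd _ _ _ s) r.
  by rewrite ux' subrr.
Qed.

Section CentralElements.
Variables (K : fieldType) (R : algebra K) (M : lmodType (env R)).

Definition central (x : M) : Prop := forall c : R, tens c 1 *: x = tens 1 c *: x.

Lemma tens_split a b (x : M) : tens a b *: x = tens a 1 *: (tens 1 b *: x).
Proof. by rewrite tens_scaleA !mulr1. Qed.

Lemma tens_split' a b (x : M) : tens a b *: x = tens 1 b *: (tens a 1 *: x).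
Proof. by rewrite tens_scaleA !mul1r. Qed.

Lemma central_scale (x : M) a b : central x -> tens a b *: x = tens (a * b) 1 *: x.
Proof. by move=> xc; rewrite tens_split -xc tens_scaleA mulr1. Qed.

(** Put k = d d'. Multiplying d x d' = k x k on the right by d gives d x (d' d) = x k k d = x d,
    while the left side is d (d' d) x = d x. *)
Lemma central_partial_unit (x : M) (d d' : R) :
  d * d' * d = d ->
  tens (d * d') 1 *: x = tens 1 (d * d') *: x ->
  tens (d' * d) 1 *: x = tens 1 (d' * d) *: x ->
  tens d d' *: x = tens (d * d') (d * d') *: x ->
  tens d 1 *: x = tens 1 d *: x.
Proof.
move=> dd'd xk xg xd.
have -> : tens d 1 *: x = tens d (d' * d) *: x.
  by rewrite [RHS]tens_split -xg tens_scaleA mulr1 mulrA dd'd.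
have -> : tens d (d' * d) *: x = tens 1 d *: (tens d d' *: x).
  by rewrite tens_scaleA mul1r.
rewrite xd tens_scaleA mul1r dd'd tens_split' xk tens_scaleA mul1r.
by rewrite dd'd.
Qed.

Lemma central_mul (x : M) (c d : R) : tens c 1 *: x = tens 1 c *: x ->
  tens d 1 *: x = tens 1 d *: x -> tens (c * d) 1 *: x = tens 1 (c * d) *: x.
Proof.
move=> xc xd; have -> : tens (c * d) 1 *: x = tens c 1 *: (tens d 1 *: x).
  by rewrite tens_scaleA mulr1.
rewrite xd -tens_split tens_split' xc tens_scaleA mul1r.
by [].
Qed.

Lemma central_add (x : M) (c d : R) : tens c 1 *: x = tens 1 c *: x ->
  tens d 1 *: x = tens 1 d *: x -> tens (c + d) 1 *: x = tens 1 (c + d) *: x.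
Proof. by move=> xc xd; rewrite tensDl tensDr !scalerDl xc xd. Qed.

Lemma central0 (x : M) : tens (0 : R) 1 *: x = tens 1 0 *: x.
Proof.
have -> : tens (0 : R) 1 = 0 by apply: (addrI (tens 0 1)); rewrite -tensDl !addr0.
by have -> : tens 1 (0 : R) = 0 by apply: (addrI (tens 1 0)); rewrite -tensDr !addr0.
Qed.

Local Notation reg := (env_mod (regular_bimodule R)).

Lemma reg_hom_left (f : homK reg M) (c : R) : f (c : reg) = tens c 1 *: f (1 : R).
Proof.
rewrite -linearZ_LR; congr (f _).
by rewrite [RHS](env_modE (B := regular_bimodule R)) /= !mulr1.
Qed.

Lemma reg_hom_right (f : homK reg M) (c : R) : f (c : reg) = tens 1 c *: f (1 : R).
Proof.
rewrite -linearZ_LR; congr (f _).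
by rewrite [RHS](env_modE (B := regular_bimodule R)) /= !mul1r.
Qed.

Lemma reg_hom_central (f : homK reg M) : central (f (1 : R)).
Proof. by move=> c; rewrite -reg_hom_left reg_hom_right. Qed.

Lemma central_reg_hom (x : M) : central x -> exists f : homK reg M, f (1 : R) = x.
Proof.
move=> xc; pose f (c : reg) : M := tens (c : R) 1 *: x.
have fD c c' : f (c + c') = f c + f c' by rewrite /f tensDl scalerDl.
have f0 : f 0 = 0 by apply: (addrI (f 0)); rewrite -fD !addr0.
have f_lin : linear f.
  move=> u c c'; rewrite fD; congr (_ + _).
  elim/env_ind: u => [|u v IH IH'|a b]; first by rewrite !scale0r.
    by rewrite !scalerDl fD IH IH'.
  rewrite [tens a b *: c](env_modE (B := regular_bimodule R)).
  exact: central_tens.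
by exists (mk_linear f_lin); rewrite /= /f tens1 scale1r.
Qed.

Lemma reg_hom_eq0 (f : homK reg M) : f = 0 <-> f (1 : R) = 0.
Proof.
split=> [->//|f0]; apply: linear_ext => c.
by apply: etrans (reg_hom_left f c) _; rewrite f0 scaler0.
Qed.

End CentralElements.

(** * The generator 1 of KE(S) *)

Section KEHom.
Variables (K : fieldType) (S : inverseMonoidType).

Lemma idem1 : idem (1%g : S).
Proof. by apply/eqP; rewrite mulg1. Qed.

Definition idem_gen (g : idempotents S) : KE K S := (<< 1 *g g >> : {malg K[idempotents S]}).
Definition KEone : KE K S := idem_gen (Sub 1%g idem1).

Lemma KE_mgen s : mgen K s *: KEone = idem_gen (Sub (s * sinv s)%g (idem_mulsV s)).
Proof.
apply: etrans (repmod_mgen (V := KE_rep K S) s KEone) _.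
rewrite /= /KE_act /KEone msumU; last by move=> *; exact: monalgUD.
by congr (<< _ *g _ >>); apply: val_inj; rewrite /= mulg1.
Qed.

Lemma KE_mgen_mulsV s : mgen K (s * sinv s)%g *: KEone = mgen K s *: KEone.
Proof.
rewrite !KE_mgen; congr idem_gen; apply: val_inj => /=.
by rewrite (idemV (idem_mulsV s)) (idemE (idem_mulsV s)).
Qed.

(** An idempotent g sends the generator to g 1 g^-1 = g, so the orbit of the generator spans. *)
Lemma KE_ind (Q : KE K S -> Prop) : Q 0 -> (forall x y, Q x -> Q y -> Q (x + y)) ->
  (forall k g, Q (aunit (monoid_algebra K S) k *: (mgen K g *: KEone))) ->
  forall x, Q x.
Proof.
move=> Q0 QD Qg; apply: malg_ind => // k g.
suff <- : aunit (monoid_algebra K S) k *: (mgen K (val g) *: KEone) =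
  (<< k *g g >> : {malg K[idempotents S]}) :> KE K S by exact: Qg.
apply: etrans (repmod_aunit (V := KE_rep K S) k _) _; rewrite KE_mgen.
apply/malgP => f; rewrite mcoeffZ !mcoeffU mulrnAr mulr1; congr (_ *+ (_ == f)).
by apply: val_inj; rewrite /= (idemV (valP g)) (idemE (valP g)).
Qed.

End KEHom.

(** * Homomorphisms from KE(S) to T1 M as central elements *)

Section CentralT1.
Variables (K : fieldType) (S : inverseMonoidType) (A : algebra K).
Variable theta : unital_action S A.
Local Notation Lambda := (crossed theta).
Local Notation cdelta := (cdelta theta).
Local Notation ciota := (ciota theta).
Variable M : lmodType (env Lambda).
Local Notation one := (KEone K S).

(* As s and s s^-1 agree on [KEone], delta_s x delta_(s^-1) = 1_s x; multiplying by
   delta_s on the right gives delta_s x = x delta_s. *)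
Lemma KE_hom_central (h : homK (KE K S) (T1 theta M)) :
  central ((h one : T1_space M) (1 : A) : M).
Proof.
set t : T1_space M := h one; set x : M := t (1 : A).
have xA c : tens (ciota c) 1 *: x = tens 1 (ciota c) *: x.
  exact: etrans (esym (T1_left t c)) (T1_right t c).
have xs s : tens (cdelta s 1) (cdelta (sinv s) 1) *: x =
    tens (cdelta (s * sinv s)%g 1) (cdelta (s * sinv s)%g 1) *: x.
  have E : T1_act s t = T1_act (s * sinv s)%g t.
    have mE u : T1_act u t = h (mgen K u *: one).
      by rewrite linearZ_LR; exact: esym (@repmod_mgen _ _ (T1_rep M) u t).
    by rewrite !mE KE_mgen_mulsV.
  have := congr1 (fun u : T1_space M => u (1 : A) : M) E.
  move=> /(etrans (esym (T1_act_at1 t s))) /esym /(etrans (esym (T1_act_at1 t _))) /esym.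
  by rewrite (idemV (idem_mulsV s)).
have xd s : tens (cdelta s 1) 1 *: x = tens 1 (cdelta s 1) *: x.
  have kE := cdelta1M theta s (sinv s); have gE := cdelta1M theta (sinv s) s.
  apply: (@central_partial_unit _ _ _ _ _ (cdelta (sinv s) 1)).
  - by rewrite !cdelta1M mulsVs.
  - by rewrite kE (cdelta_idem theta 1 (idem_mulsV s)).
  - by rewrite gE (cdelta_idem theta 1 (idem_mulVs s)).
  - by rewrite kE.
elim/crossed_ind => [|c c' IH IH'|s a]; first exact: central0.
  exact: central_add.
have -> : cdelta s a = ciota a * cdelta s 1.
  by rewrite ciotaE cdeltaM mul1g ua_act1 mulr1.
exact: central_mul.
Qed.

(** The homomorphism sends an idempotent g to g . t. It respects the action because u . t depends
    only on u u^-1: for central x, [delta_u] x [delta_(u^-1)] is [delta_(u u^-1)] x, and s g s^-1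
    and s g have the same u u^-1. *)
Lemma central_KE_hom (x : M) : central x ->
  exists h : homK (KE K S) (T1 theta M), (h one : T1_space M) (1 : A) = x.
Proof.
move=> xc; have [t tx] := T1_of_central (fun c => xc (ciota c)).
have t_conj s g : idem g -> T1_act (s * g * sinv s)%g t = T1_act (s * g)%g t.
  have act_at1 u : T1_act u t (1 : A) = tens (cdelta (u * sinv u)%g 1) 1 *: x :> M.
    apply: etrans (T1_act_at1 t u) _.
    apply: etrans (congr1 (fun m : M => tens (cdelta u 1) (cdelta (sinv u) 1) *: m) tx) _.
    apply: etrans (central_scale _ _ xc) _.
    exact: (congr1 (fun c => tens c 1 *: x) (cdelta1M theta u (sinv u))).
  move=> g_idem; apply: T1_eq_at1.
  apply: etrans (act_at1 _) _; apply: etrans _ (esym (act_at1 _)).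
  have E : (s * g * sinv s * sinv (s * g * sinv s) = s * g * sinv (s * g))%g.
    rewrite (idemV (idem_conj s g_idem)) (idemE (idem_conj s g_idem)) sinvM (idemV g_idem).
    by rewrite mulgA -(mulgA s g g) (idemE g_idem).
  exact: (congr1 (fun u => tens (cdelta u 1) 1 *: x) E).
pose h (z : KE K S) : T1_space M :=
  msum (fun (g : idempotents S) k => k *: T1_act (val g) t) (z : {malg K[idempotents S]}).
have hD u v : h (u + v) = h u + h v by apply: msumD => g k l; exact: scalerDl.
have h0 : h 0 = 0 by apply: (addrI (h 0)); rewrite -hD !addr0.
have hU k g : h (<< k *g g >> : {malg K[idempotents S]}) = k *: T1_act (val g) t.
  by apply: msumU => f l l'; exact: scalerDl.
have h_lin : linear (h : KE_rep K S -> T1_space M).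
  move=> k u v; rewrite hD; congr (_ + _).
  elim/malg_ind: u => [|u w IH IH'|l g]; first by rewrite scaler0 h0 scaler0.
    by rewrite scalerDr !hD IH IH' scalerDr.
  rewrite hU scalerA -hU; congr h.
  by apply/malgP => f; rewrite mcoeffZ !mcoeffU mulrnAr.
have h_rep s (z : KE_rep K S) : h (rep s z) = T1_act s (h z).
  have actD (u v : T1_space M) : T1_act s (u + v) = T1_act s u + T1_act s v.
    by have := T1_act_Klinear s 1 u v; rewrite !scale1r.
  have act0 : T1_act s (0 : T1_space M) = 0.
    by apply: (addrI (T1_act s 0)); rewrite -actD !addr0.
  have KD (f : idempotents S) (a b : K) : << a + b *g idem_act s f >> =
      << a *g idem_act s f >> + << b *g idem_act s f >> :> {malg K[idempotents S]}.
    exact: monalgUD.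
  elim/malg_ind: z => [|u w IH IH'|l g].
  - by rewrite /= /KE_act msum0 // h0 act0.
  - by rewrite /= /KE_act msumD // hD hD actD; congr (_ + _).
  rewrite /= /KE_act msumU // hU hU /= (t_conj _ _ (valP g)).
  have := T1_act_Klinear s l (T1_act (val g) t) 0; rewrite act0 !addr0 => ->.
  by rewrite T1_actM.
have h_KS := @repmod_linear _ _ (KE_rep K S) (T1_rep M) h h_lin h_rep.
exists (mk_linear h_KS); rewrite -tx.
have E : h one = t by rewrite hU scale1r T1_act1.
exact: (congr1 (fun u : T1_space M => u (1 : A) : M) E).
Qed.

Lemma KE_hom_eq0 (h : homK (KE K S) (T1 theta M)) :
  h = 0 <-> (h one : T1_space M) (1 : A) = 0 :> M.
Proof.
split=> [->//|h0].
have h10 : h one = 0 by apply: T1_eq_at1; exact: h0.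
apply: linear_ext; elim/KE_ind => [|x y IH IH'|k g]; first by rewrite !linear0.
  by rewrite !linearD IH IH'.
by rewrite 2!linearZ_LR h10 2!scaler0.
Qed.

End CentralT1.

(** Both complexes are evaluated in [injres M]: at the unit of the crossed product, and at the
    idempotent 1 followed by the unit of [A]. Equality of these values is preserved by the
    differentials, which act by postcomposition. *)
Lemma hochschild_KE_hom (K : fieldType) (S : inverseMonoidType) (A : algebra K)
    (theta : unital_action S A) (M : lmodType (env (crossed theta))) n :
  lmod_iso (hochschild n M)
    (cohomology (map_cochain (hom_functor (KE K S)) (map_cochain (T1 theta) (injres M))) n).
Proof.
pose C := map_cochain (hom_functor (env_mod (regular_bimodule (crossed theta)))) (injres M).
pose C' := map_cochain (hom_functor (KE K S)) (map_cochain (T1 theta) (injres M)).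
pose at1 m (t : T1 theta (injres M m)) : injres M m := (t : T1_space (injres M m)) (1 : A).
pose ev m (f : homK (env_mod (regular_bimodule (crossed theta))) (injres M m)) : injres M m :=
  f (1 : crossed theta).
pose ev' m (h : homK (KE K S) (T1 theta (injres M m))) : injres M m := at1 m (h (KEone K S)).
pose rel m (f : C m) (h : C' m) : Prop := ev m f = ev' m h.
change (lmod_iso (cohomology C n) (cohomology C' n)).
apply: (cohomology_iso (rel := rel)) => m.
- move=> k f g h h'; rewrite /rel => fh gh'.
  have evE : ev m (k *: f + g) = aunit (env (crossed theta)) k *: ev m f + ev m g by [].
  apply: etrans evE _; rewrite fh gh'; apply: esym.
  have at1D t t' : at1 m (t + t') = at1 m t + at1 m t' by [].
  have at1K t : at1 m (aunit (monoid_algebra K S) k *: t) =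
      aunit (env (crossed theta)) k *: at1 m t.
    have kt : aunit (monoid_algebra K S) k *: t =
        k *: (t : T1_space (injres M m)) :> T1_space (injres M m).
      exact: (@repmod_aunit _ _ (T1_rep (injres M m))).
    apply: etrans (congr1 (at1 m) kt) _; exact: resA_K.
  by apply: etrans (at1D _ _) _; rewrite at1K.
- move=> f; have [h hE] := central_KE_hom (reg_hom_central f).
  by exists h; exact: esym hE.
- move=> h; have [f fE] := central_reg_hom (KE_hom_central h).
  by exists f.
- move=> f h r; split=> [/reg_hom_eq0 f0|/KE_hom_eq0 h0].
    by apply/KE_hom_eq0; apply: etrans (esym r) f0.
  by apply/reg_hom_eq0; apply: etrans r h0.
- by move=> f h r; exact: (congr1 (cdiff (injres M) m) r).
Qed.

Lemma converges_to_iso (K : fieldType) (E : spectral_sequence K) (H H' : nat -> lmodType K) :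
  (forall n, lmod_iso (H n) (H' n)) -> converges_to E H -> converges_to E H'.
Proof.
move=> HH' EH n; have [F [F0 FS Fn Fgr]] := EH n; have [f [g fK gK]] := HH' n.
have g_lin : linear g by move=> a x y; apply: (can_inj fK); rewrite linearP !gK.
have F'0 p : F p (g 0) by rewrite -(linear0 f) fK; exact: smem0.
have F'P p a x y : F p (g x) -> F p (g y) -> F p (g (a *: x + y)).
  by move=> hx hy; rewrite g_lin; apply: smemP.
pose F' p := @Submodule _ (H' n) (fun x => F p (g x)) (F'0 p) (F'P p).
exists F'; split=> [x|p x|x /Fn gx0|p q pqn]; [exact: F0|exact: FS| |].
  by rewrite -(gK x) gx0 linear0.
apply: lmod_iso_trans (Fgr p q pqn) _.
apply: (subquot_iso (rel := fun x y => f x = y) (subquot_is_subquot _ _)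
  (subquot_is_subquot _ _)).
- exact: smemP.
- exact: smemP.
- by move=> a x y x' y' <- <-; rewrite linearP.
- by move=> x Fx; exists (f x); rewrite //= fK.
- by move=> y Fy; exists (g y).
- by move=> x y _ _ <-; rewrite /= fK.
Qed.

Theorem theorem5p9 (K : fieldType) (S : inverseMonoidType) (A : algebra K)
    (theta : unital_action S A) (M : lmodType (env (crossed theta))) :
  exists E : spectral_sequence K,
    (forall p q : nat,
      lmod_iso (E 2%N p%:Z q%:Z)
        (imonoid_cohomology p (rderived (T1 theta) q M))) /\
    converges_to E (fun n => hochschild n M).
Proof.
(* Each term of [injres M] is a coinduced module. *)
have C_inj n : injective_module (map_cochain (T1 theta) (injres M) n).
  exact: T1_coind_injective.
have [E [E2 Econv]] := hyperext_spectral_sequence (KE K S) C_inj.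
exists E; split=> [p q|]; first exact: E2.
apply: converges_to_iso Econv => n; exact/lmod_iso_sym/hochschild_KE_hom.
Qed.
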